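(* Let $G$ be a simple subcubic graph, and suppose at most four edges of $G\square K_2$ are properly precolored with colors from $\{1,\dots,5\}$. Then the precoloring can be extended to a proper $5$-edge-coloring of $G\square K_2$.
   Context: A graph is subcubic if its maximum degree is at most $3$. A precoloring is a proper edge-coloring (adjacent edges receive distinct colors) of a subset of the edges; extending it means finding a proper edge-coloring of the whole graph with the given colors that agrees with it on the precolored edges. The Cartesian product $G\square H$ has vertex set $V(G)\times V(H)$, with $(u_1,u_2)\sim(v_1,v_2)$ iff either $u_1=v_1$ and $u_2v_2\in E(H)$, or $u_2=v_2$ and $u_1v_1\in E(G)$. *)

(* Defs.v *)
From mathcomp Require Import all_boot.

Set Implicit Arguments.
Unset Strict Implicit.
Unset Printing Implicit Defensive.

Record sgraph := SGraph {
  vertex :> finType;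
  adj : rel vertex;
  adj_sym : symmetric adj;
  adj_irrefl : irreflexive adj
}.

(* An edge is encoded as the two-element set of its endpoints. *)
Definition edges (G : sgraph) : {set {set G}} :=
  [set e | [exists x, exists y, adj x y && (e == [set x; y])]].

Definition degree (G : sgraph) (x : G) : nat := #|[set y | adj x y]|.

Definition max_degree (G : sgraph) : nat := \max_(x : G) degree x.

Definition subcubic (G : sgraph) : Prop := max_degree G <= 3.

Section CartesianProduct.
Variables G H : sgraph.

Definition cart_adj : rel (G * H)%type := fun u v =>
  ((u.1 == v.1) && adj u.2 v.2) || ((u.2 == v.2) && adj u.1 v.1).

Lemma cart_adj_sym : symmetric cart_adj.
Proof.
move=> u v; rewrite /cart_adj [u.1 == _]eq_sym [u.2 == _]eq_sym.
by rewrite (adj_sym u.1) (adj_sym u.2).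
Qed.

Lemma cart_adj_irrefl : irreflexive cart_adj.
Proof. by move=> u; rewrite /cart_adj !adj_irrefl !andbF. Qed.

Definition cart : sgraph := SGraph cart_adj_sym cart_adj_irrefl.

End CartesianProduct.

Section CompleteGraph.
Variable n : nat.

Definition complete_adj : rel 'I_n := fun i j => i != j.

Lemma complete_adj_sym : symmetric complete_adj.
Proof. by move=> i j; rewrite /complete_adj eq_sym. Qed.

Lemma complete_adj_irrefl : irreflexive complete_adj.
Proof. by move=> i; rewrite /complete_adj eqxx. Qed.

Definition complete : sgraph := SGraph complete_adj_sym complete_adj_irrefl.

End CompleteGraph.

Definition edges_adjacent (G : sgraph) (e f : {set G}) : bool :=
  (e != f) && (e :&: f != set0).

(* A coloring of a set F of edges is a total function of which only the values
   on F are meaningful; the colors are the elements of 'I_k. *)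
Definition proper_on (G : sgraph) (k : nat) (F : {set {set G}})
    (c : {set G} -> 'I_k) : Prop :=
  forall e f, e \in F -> f \in F -> edges_adjacent e f -> c e != c f.

Definition is_precoloring (G : sgraph) (k : nat) (F : {set {set G}})
    (c : {set G} -> 'I_k) : Prop :=
  F \subset edges G /\ proper_on F c.

Definition extendable (G : sgraph) (k : nat) (F : {set {set G}})
    (c : {set G} -> 'I_k) : Prop :=
  exists c' : {set G} -> 'I_k,
    proper_on (edges G) c' /\ (forall e, e \in F -> c' e = c e).

(* Main.v *)
(** A 5-edge-colouring of the prism over [G] amounts to two proper edge colourings
    [phi0], [phi1] of [G], one per copy, such that at every vertex some colour is
    missing from both; it goes on the rung.  A precoloured rung prescribes that
    missing colour.

    If the precolourings of the two copies do not clash, take [phi0 = phi1]: at most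
    four edges and missing colours extend to one colouring of [G].  Free edges whose
    ends leave a colour are deleted; a vertex with a prescribed missing colour and
    few such neighbours is removed and put back after a Kempe change, which is
    possible because a Kempe component has at most two ends; what remains has at most
    five vertices and is settled by a finite computation.

    If they clash, take [phi1] to be [phi0] with two colours exchanged: at each vertex
    the two copies still use at most four colours together.  When all but one of the
    prescriptions have the same colour [mu], Vizing's theorem gives a colouring
    avoiding [mu], in which [mu] is then painted where it is prescribed.  In the
    remaining cases the edges at the critical vertices are coloured first and the
    rest greedily. *)

Require Import Defs.
From mathcomp Require Import all_boot all_fingroup zify.

Set Implicit Arguments.
Unset Strict Implicit.
Unset Printing Implicit Defensive.

(** An edge of a subcubic graph meets at most four others, so with five colours a proper
    precolouring of edges alone extends greedily, however many edges it contains. The obstacle is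
    the prescribed missing colours, each of which costs a further colour at every edge of its
    vertex. The bound four makes this affordable in three places. In an irreducible instance with
    special vertices A, other active vertices N and precoloured edges E, double counting gives 3|N|
    <= |A| + 2|E|; with |A| + |E| <= 4 this yields |A| + |N| <= 16/3, whence the five vertices of
    the computation. In a Kempe change the remaining prescriptions are too few to block every choice
    of the two colours. For clashing copies, either one copy has a single precoloured edge, or both
    have two and no rung is precoloured. If an edge has different colours in the two copies and
    these are exchanged, a vertex that must miss one of them has to miss both, so only three colours
    remain for its star; that star can be fixed in advance because the greedy extension puts no
    limit on the number of precoloured edges. *)

Section Colorings.
Variables (V T : finType).
Implicit Types (e : rel V) (phi : {set V} -> T) (x y z u v w : V) (c : T).

(** Graphs are relations on a fixed vertex type, so deleting an edge or a star changes only the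
    relation. A colouring is a function on all vertex sets, whose values off the edges carry no
    meaning. *)
Definition subcubic_rel e := [/\ symmetric e, irreflexive e & forall x, #|e x| <= 3].

Definition proper_col e phi := forall x y z,
  e x y -> e x z -> y != z -> phi [set x; y] != phi [set x; z].

Definition used e phi x : {set T} := [set phi [set x; y] | y in e x].

Definition restr e (P : pred {set V}) : rel V :=
  fun x y => e x y && P [set x; y].

Lemma avoid (A B : {set T}) :
  #|B| < #|A| -> exists2 c, c \in A & c \notin B.
Proof.
move=> h; apply/subsetPn; apply: contraTN h => /subset_leq_card.
by rewrite -leqNgt.
Qed.

Lemma set2_inj x y z : [set x; y] = [set x; z] -> y = z.
Proof.
move=> E; have: y \in [set x; z] by rewrite -E !inE eqxx orbT.
rewrite !inE => /orP[/eqP yx|/eqP//].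
have: z \in [set x; y] by rewrite E !inE eqxx orbT.
by rewrite yx !inE orbb => /eqP.
Qed.

Lemma mem_used e phi x y : e x y -> phi [set x; y] \in used e phi x.
Proof. by move=> exy; apply/imsetP; exists y. Qed.

Lemma usedP e phi x c :
  reflect (exists2 y, e x y & c = phi [set x; y]) (c \in used e phi x).
Proof. by apply: (iffP imsetP) => -[y exy ->]; exists y. Qed.

Lemma card_used e phi x : #|used e phi x| <= #|e x|.
Proof. exact: leq_imset_card. Qed.

Lemma subcubic_restr e P : subcubic_rel e -> subcubic_rel (restr e P).
Proof.
move=> [es ei e3]; split=> [x y|x|x].
- by rewrite /restr es setUC.
- by rewrite /restr ei.
- apply: leq_trans (e3 x); apply: subset_leq_card.
  by apply/subsetP=> y /andP[].
Qed.

Lemma proper_sub e e' phi : subrel e' e -> proper_col e phi -> proper_col e' phi.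
Proof. by move=> s p x y z /s exy /s exz; apply: p. Qed.

Lemma used_sub e e' phi x : subrel e' e -> used e' phi x \subset used e phi x.
Proof. by move=> s; apply/subsetP=> c /usedP[y /s exy ->]; apply: mem_used. Qed.

Lemma eq_used e phi psi x :
  (forall y, e x y -> phi [set x; y] = psi [set x; y]) ->
  used e phi x = used e psi x.
Proof.
move=> E; apply/setP=> c; apply/usedP/usedP=> -[y exy ->]; exists y => //.
  exact: E.
by rewrite E.
Qed.

(** * Kempe changes *)

(** A duplicate-free path from [x] to [y] already fills the component: the degree bounds leave none
    of its vertices a neighbour off the path. So [z] would be an inner vertex, of degree two. *)
Lemma three_ends (k : rel V) x y z :
    symmetric k -> (forall v, #|k v| <= 2) ->
    #|k x| <= 1 -> #|k y| <= 1 -> #|k z| <= 1 ->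
    x != y -> x != z -> y != z -> connect k x y -> connect k x z -> False.
Proof.
move=> ks k2 kx ky kz nxy nxz nyz /connectP[p0 p0p yE].
case/shortenP: p0p yE => p pp up _ yE.
have adj j : j < size p -> k (nth x (x :: p) j) (nth x (x :: p) j.+1).
  by move=> jl; move/pathP: pp => /(_ x j jl).
have lst : nth x (x :: p) (size p) = y by rewrite yE (last_nth x).
have sp0 : 0 < size p by case: (p) yE nxy => // ->; rewrite eqxx.
have dist i j : i <= size p -> j <= size p -> i != j ->
    nth x (x :: p) i != nth x (x :: p) j.
  by move=> il jl ij; rewrite nth_uniq //=; lia.
have inner i : 0 < i < size p -> 1 < #|k (nth x (x :: p) i)|.
  case: i => // i il; apply/card_gt1P.
  exists (nth x (x :: p) i), (nth x (x :: p) i.+2).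
  by split; [rewrite unfold_in ks; apply: adj; lia | apply: adj; lia |
             apply: dist; lia].
have nth_q v : v \in x :: p -> exists2 i, i <= size p & v = nth x (x :: p) i.
  move=> vp; exists (index v (x :: p)); last by rewrite nth_index.
  by move: vp; rewrite -index_mem ltnS.
have cl v w : k v w -> v \in x :: p -> w \in x :: p.
  move=> kvw /nth_q[i il vE]; apply: contraLR isT => wp.
  have nw j : j <= size p -> w != nth x (x :: p) j.
    by move=> jl; apply: contraNneq wp => ->; apply: mem_nth.
  case: i il vE => [|i] il vE.
    move: kx; rewrite leqNgt => /negP[]; apply/card_gt1P.
    exists w, (nth x (x :: p) 1); split; [by move: kvw; rewrite vE| |exact: nw].
    exact: (adj 0).
  have [E|il2] := eqVneq i.+1 (size p).
    move: ky; rewrite leqNgt => /negP[]; apply/card_gt1P.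
    exists w, (nth x (x :: p) i); split; last by apply: nw; lia.
      by move: kvw; rewrite vE E lst.
    by rewrite unfold_in ks -lst -E; apply: adj; lia.
  move: (k2 v); rewrite leqNgt => /negP[]; apply/card_gt2P.
  exists w, (nth x (x :: p) i), (nth x (x :: p) i.+2); split=> //.
    split=> //; first by rewrite unfold_in ks vE; apply: adj; lia.
    by rewrite unfold_in vE; apply: adj; lia.
  split; [by apply: nw; lia | by apply: dist; lia|].
  by rewrite eq_sym; apply: nw; lia.
have clp : closed k (mem (x :: p)).
  by move=> v w kvw; apply/idP/idP; apply: cl; rewrite // ks.
move/(closed_connect clp); rewrite inE eqxx => /esym /nth_q[i il zE].
have i0 : i != 0 by apply: contraNneq nxz => i0; rewrite zE i0.
have i1 : i != size p by apply: contraNneq nyz => i1; rewrite zE i1 lst.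
by move: kz; rewrite leqNgt zE inner //; lia.
Qed.

Definition kempe_rel e phi c d : rel V :=
  restr e (fun f => phi f \in [set c; d]).

Definition kempe_comp e phi c d x : {set V} :=
  [set v | connect (kempe_rel e phi c d) x v].

(** The edges affected are those that meet [X]. When [X] is closed, an edge that meets [X] without
    lying in it has a colour fixed by the transposition, so the test could equally be made at either
    end. *)
Definition kempe_swap phi c d (X : {set V}) (f : {set V}) :=
  if [disjoint f & X] then phi f else tperm c d (phi f).

Lemma mem_tperm c d k (A : {set T}) :
  (k \in tperm c d @: A) = (tperm c d k \in A).
Proof. by rewrite -{1}(tpermK c d k) mem_imset //; apply: perm_inj. Qed.

Lemma kempe_rel_sym e phi c d : symmetric e -> symmetric (kempe_rel e phi c d).
Proof. by move=> es x y; rewrite /kempe_rel /restr es setUC. Qed.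

Lemma kempe_relC e phi c d : kempe_rel e phi c d = kempe_rel e phi d c.
Proof. by rewrite /kempe_rel setUC. Qed.

Lemma kempe_rel_card e phi c d x : proper_col e phi -> #|kempe_rel e phi c d x| <= 2.
Proof.
move=> pe; rewrite leqNgt; apply/card_gt2P => -[y1 [y2 [y3]]].
case=> -[/andP[e1 h1] /andP[e2 h2] /andP[e3 h3]] [n12 n23 n31].
have := pe _ _ _ e1 e2 n12; have := pe _ _ _ e2 e3 n23.
have := pe _ _ _ e3 e1 n31; move: h1 h2 h3; rewrite !inE.
by do 3 case/orP=> /eqP ->; rewrite ?eqxx.
Qed.

Lemma kempe_rel_card1 e phi c d x :
  proper_col e phi -> d \notin used e phi x -> #|kempe_rel e phi c d x| <= 1.
Proof.
move=> pe dx; rewrite leqNgt; apply/card_gt1P => -[y1 [y2]].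
case=> -/andP[e1 h1] /andP[e2 h2] n12.
have h y : e x y -> phi [set x; y] \in [set c; d] -> phi [set x; y] = c.
  move=> exy; rewrite !inE => /orP[/eqP//|/eqP E].
  by rewrite -E mem_used in dx.
by have := pe _ _ _ e1 e2 n12; rewrite (h _ e1 h1) (h _ e2 h2) eqxx.
Qed.

Section Swap.
Variables (e : rel V) (phi : {set V} -> T) (c d : T) (X : {set V}).
Hypothesis clX : forall x y, kempe_rel e phi c d x y -> (x \in X) = (y \in X).

Lemma kempe_swapE x y : e x y ->
  kempe_swap phi c d X [set x; y]
  = if x \in X then tperm c d (phi [set x; y]) else phi [set x; y].
Proof.
move=> exy; rewrite /kempe_swap disjoints_subset subUset !sub1set !inE.
case: ifP => [/andP[/negPf-> _]//|]; case: ifP => //= xX /negbFE yX.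
have : ~~ kempe_rel e phi c d x y by apply/negP=> /clX; rewrite xX yX.
rewrite /kempe_rel /restr exy /= !inE negb_or => /andP[nc nd].
by rewrite tpermD // eq_sym.
Qed.

Lemma kempe_swap_proper : proper_col e phi -> proper_col e (kempe_swap phi c d X).
Proof.
move=> pe x y z exy exz yz; rewrite !kempe_swapE //.
by case: ifP => _; rewrite ?(inj_eq perm_inj); apply: pe.
Qed.

Lemma kempe_swap_used x :
  used e (kempe_swap phi c d X) x
  = if x \in X then tperm c d @: used e phi x else used e phi x.
Proof.
case: ifP => xX; last by apply: eq_used => y exy; rewrite kempe_swapE ?xX.
apply/setP=> k; apply/usedP/imsetP=> [[y exy ->]|[_ /usedP[y exy ->] ->]].
  by exists (phi [set x; y]); rewrite ?mem_used // kempe_swapE ?xX.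
by exists y; rewrite // kempe_swapE ?xX.
Qed.

End Swap.

Lemma kempe_comp_closed e phi c d v : symmetric e -> forall x y,
  kempe_rel e phi c d x y -> (x \in kempe_comp e phi c d v) = (y \in kempe_comp e phi c d v).
Proof.
move=> es x y kxy; rewrite !inE.
exact: (same_connect1r (sym_connect_sym (kempe_rel_sym _ _ _ es)) kxy).
Qed.

Lemma kempe_comp_id e phi c d x : x \in kempe_comp e phi c d x.
Proof. by rewrite inE connect0. Qed.

(** Meant for vertices that miss one of the two colours: they are ends of their Kempe component, and
    a component has at most two ends. *)
Lemma kempe_comp3 e phi c d v x y z :
    subcubic_rel e -> proper_col e phi ->
    [&& x != y, x != z & y != z] ->
    #|kempe_rel e phi c d x| <= 1 -> #|kempe_rel e phi c d y| <= 1 ->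
    #|kempe_rel e phi c d z| <= 1 ->
    x \in kempe_comp e phi c d v -> y \in kempe_comp e phi c d v ->
    z \in kempe_comp e phi c d v -> False.
Proof.
move=> [es _ _] pe /and3P[xy xz yz] kx ky kz; rewrite !inE => vx vy vz.
have ks := kempe_rel_sym phi c d es.
have xv : connect (kempe_rel e phi c d) x v by rewrite (sym_connect_sym ks).
apply: (three_ends ks _ kx ky kz) => // [w||]; first exact: kempe_rel_card.
  exact: connect_trans xv vy.
exact: connect_trans xv vz.
Qed.

(** * Vizing's theorem for subcubic graphs *)

Definition del e u v := restr e (fun f => f != [set u; v]).

Definition recol phi (f : {set V}) c (g : {set V}) := if g == f then c else phi g.

Definition ranges e phi (K : {set T}) := forall x y, e x y -> phi [set x; y] \in K.

Lemma recol_same phi f c : recol phi f c f = c.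
Proof. by rewrite /recol eqxx. Qed.

Lemma recol_diff phi f c g : g != f -> recol phi f c g = phi g.
Proof. by rewrite /recol => /negPf->. Qed.

Lemma set2_cases x y u v : [set x; y] = [set u; v] ->
  (x = u /\ y = v) \/ (x = v /\ y = u).
Proof.
move=> E; have: x \in [set u; v] by rewrite -E !inE eqxx.
rewrite !inE => /orP[] /eqP xE; rewrite xE in E *; [left | right].
  by split=> //; apply: set2_inj E.
by split=> //; apply: (@set2_inj v); rewrite E setUC.
Qed.

Lemma set2_neq x y u v : x != u -> x != v -> [set x; y] != [set u; v].
Proof.
move=> xu xv; apply/negP=> /eqP /set2_cases[] [E _].
  by rewrite E eqxx in xu.
by rewrite E eqxx in xv.
Qed.

Lemma del_sub e u v : subrel (del e u v) e.
Proof. by move=> x y /andP[]. Qed.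

Lemma del_edge e u v x y : del e u v x y = e x y && ([set x; y] != [set u; v]).
Proof. by []. Qed.

Lemma del_C e u v : del e u v = del e v u.
Proof. by rewrite /del setUC. Qed.

Lemma card_del e u v : e u v -> #|del e u v u| < #|e u|.
Proof.
move=> euv; apply: proper_card; apply/properP; split.
  by apply/subsetP=> y /andP[].
by exists v => //; apply/negP => /andP[_]; rewrite eqxx.
Qed.

Lemma used_recol_other e phi x y c v :
  v != x -> v != y -> used e (recol phi [set x; y] c) v = used e phi v.
Proof.
by move=> vx vy; apply: eq_used => w _; rewrite recol_diff // set2_neq.
Qed.

Lemma used_recol e phi x y c k : proper_col e phi -> e x y ->
  k \in used e (recol phi [set x; y] c) x ->
  k = c \/ k \in used e phi x /\ k != phi [set x; y].
Proof.
move=> pe exy /usedP[z exz ->]; rewrite /recol; case: eqP => [|/eqP n]; first by left.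
right; split; first exact: mem_used.
by apply: pe => //; apply: contraNneq n => ->.
Qed.

Lemma add_edge e phi u v c : symmetric e -> e u v -> proper_col (del e u v) phi ->
  c \notin used (del e u v) phi u -> c \notin used (del e u v) phi v ->
  proper_col e (recol phi [set u; v] c).
Proof.
move=> es euv pe cu cv.
have key x y z : [set x; y] = [set u; v] -> e x y -> e x z -> y != z ->
    c != recol phi [set u; v] c [set x; z].
  move=> E exy exz yz.
  have n : [set x; z] != [set u; v].
    by rewrite -E; apply: contraNneq yz => /set2_inj ->.
  rewrite recol_diff //.
  have dxz : del e u v x z by rewrite del_edge exz.
  case/set2_cases: E => -[E _]; rewrite {}E in dxz *.
    by apply: contraNneq cu => ->; apply: mem_used.
  by apply: contraNneq cv => ->; apply: mem_used.
move=> x y z exy exz yz.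
have [E|n] := eqVneq [set x; y] [set u; v].
  by rewrite E recol_same; apply: key E exy exz yz.
have [E|n'] := eqVneq [set x; z] [set u; v].
  by rewrite E recol_same eq_sym; apply: key E exz exy _; rewrite eq_sym.
by rewrite !recol_diff //; apply: pe; rewrite ?del_edge ?exy ?exz.
Qed.

Lemma recol_proper e phi u v c : symmetric e -> e u v -> proper_col e phi ->
  c \notin used e phi u -> c \notin used e phi v ->
  proper_col e (recol phi [set u; v] c).
Proof.
move=> es euv pe cu cv; apply: add_edge => //.
- exact: proper_sub (@del_sub e u v) pe.
- by apply: contraNN cu; apply: subsetP; apply: used_sub; apply: del_sub.
- by apply: contraNN cv; apply: subsetP; apply: used_sub; apply: del_sub.
Qed.

Section Fan.
Variables (e : rel V) (K : {set T}) (u v : V).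
Hypotheses (e3 : subcubic_rel e) (K4 : 3 < #|K|) (euv : e u v).
Let e' := del e u v.

(** [A] records the colours whose edges may change. [vizing2] relies on it: an edge with a colour
    outside [A] keeps that colour while the edge [uv] receives [j]. *)
Definition fan_ext phi j (A : {set T}) phi' :=
  [/\ proper_col e phi', ranges e phi' K, phi' [set u; v] = j &
      forall x y, e' x y -> phi [set x; y] \notin A ->
        phi' [set x; y] = phi [set x; y]].

Let uv : u != v.
Proof. by apply: contraTneq euv => ->; case: e3 => _ ->. Qed.

Let es : symmetric e. Proof. by case: e3. Qed.

Let es' : symmetric e'. Proof. by case: (subcubic_restr (fun f => f != [set u; v]) e3). Qed.

Let e'uv w : e' u w -> (w != v) && (w != u).
Proof.
case/andP=> euw n; apply/andP; split; first by apply: contraNneq n => ->.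
by apply: contraTneq euw => ->; case: e3 => _ ->.
Qed.

Lemma fan0 phi j : proper_col e' phi -> ranges e' phi K -> j \in K ->
  j \notin used e' phi u -> j \notin used e' phi v ->
  exists phi', fan_ext phi j set0 phi'.
Proof.
move=> pe rK jK ju jv; exists (recol phi [set u; v] j); split.
- exact: add_edge.
- move=> x y exy; rewrite /recol; case: eqP => // /eqP n; apply: rK.
  by rewrite /e' del_edge exy.
- exact: recol_same.
- by move=> x y /andP[_ n] _; rewrite recol_diff.
Qed.

Lemma fan1 phi j w t : proper_col e' phi -> ranges e' phi K -> j \in K ->
  j \notin used e' phi v -> e' u w -> phi [set u; w] = j -> t \in K ->
  t \notin used e' phi u -> t \notin used e' phi w ->
  exists phi', fan_ext phi j [set j] phi'.
Proof.
move=> pe rK jK jv euw wj tK tu tw; have /andP[wv wu] := e'uv euw.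
pose phi1 := recol phi [set u; w] t.
have pe1 : proper_col e' phi1 by apply: recol_proper.
have r1 : ranges e' phi1 K.
  by move=> x y exy; rewrite /phi1 /recol; case: ifP => // _; apply: rK.
have ju : j \notin used e' phi1 u.
  apply/negP=> /(used_recol pe euw)[jt|[_]]; last by rewrite wj eqxx.
  by rewrite -jt -wj mem_used in tu.
have jv1 : j \notin used e' phi1 v by rewrite used_recol_other // eq_sym.
have [phi' [p' r' j' a']] := fan0 pe1 r1 jK ju jv1.
exists phi'; split=> // x y exy; rewrite inE => nj.
by rewrite a' ?inE // /phi1 recol_diff //; apply: contraNneq nj => ->; rewrite wj.
Qed.

(** The outer blade moves first: giving [t2] to the edge [u w2] frees [t] at [u], and a fan with the
    single blade [w] is left. *)
Lemma fan2 phi j w t w2 t2 : proper_col e' phi -> ranges e' phi K -> j \in K ->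
  j \notin used e' phi v -> e' u w -> phi [set u; w] = j ->
  e' u w2 -> phi [set u; w2] = t -> t != j -> t \in K ->
  t \notin used e' phi w -> t2 \in K ->
  t2 \notin used e' phi u -> t2 \notin used e' phi w2 ->
  exists phi', fan_ext phi j [set j; t] phi'.
Proof.
move=> pe rK jK jv euw wj euw2 w2t tj tK tw t2K t2u t2w.
have /andP[wv wu] := e'uv euw; have /andP[w2v w2u] := e'uv euw2.
have ww2 : w != w2 by apply: contraNneq tj => E; rewrite -w2t -E wj.
pose phi1 := recol phi [set u; w2] t2.
have pe1 : proper_col e' phi1 by apply: recol_proper.
have r1 : ranges e' phi1 K.
  by move=> x y exy; rewrite /phi1 /recol; case: ifP => // _; apply: rK.
have tu : t \notin used e' phi1 u.
  apply/negP=> /(used_recol pe euw2)[tt2|[_]]; last by rewrite w2t eqxx.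
  by rewrite -tt2 -w2t mem_used in t2u.
have jv1 : j \notin used e' phi1 v by rewrite used_recol_other // eq_sym.
have wj1 : phi1 [set u; w] = j.
  by rewrite /phi1 recol_diff //; apply: contraNneq ww2 => /set2_inj ->.
have tw1 : t \notin used e' phi1 w by rewrite used_recol_other.
have [phi' [p' r' j' a']] := fan1 pe1 r1 jK jv1 euw wj1 tK tu tw1.
exists phi'; split=> // x y exy; rewrite !inE negb_or => /andP[nj nt].
have E : phi1 [set x; y] = phi [set x; y].
  by rewrite /phi1 recol_diff //; apply: contraNneq nt => ->; rewrite w2t.
by rewrite a' ?E // inE.
Qed.

(* The fan at u has at most two blades since u has at most two coloured edges;
   if it does not open, a Kempe change at the last blade opens it. *)
Lemma fan phi i j : proper_col e' phi -> ranges e' phi K ->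
  i \in K -> i \notin used e' phi u -> j \in K -> j \notin used e' phi v ->
  exists phi', fan_ext phi j (i |: (j |: used e' phi u)) phi'.
Proof.
move=> pe rK iK iu jK jv.
have wk (A : {set T}) phi1 : A \subset i |: (j |: used e' phi u) ->
    (forall x y, e' x y -> phi [set x; y] \notin i |: (j |: used e' phi u) ->
       phi1 [set x; y] = phi [set x; y]) ->
    (exists phi', fan_ext phi1 j A phi') ->
    exists phi', fan_ext phi j (i |: (j |: used e' phi u)) phi'.
  move=> sA E [phi' [p' r' j' a']]; exists phi'; split=> // x y exy nA.
  rewrite a' ?E //; exact: contraNN (subsetP sA _) nA.
have [ju|ju] := boolP (j \in used e' phi u); last first.
  by apply: (wk set0 phi) => //; [apply: sub0set | apply: fan0].
have e'3 : subcubic_rel e' by apply: subcubic_restr.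
have swK (X : {set V}) : (forall x y, kempe_rel e' phi i j x y -> (x \in X) = (y \in X)) ->
    [/\ proper_col e' (kempe_swap phi i j X), ranges e' (kempe_swap phi i j X) K &
     forall x y, e' x y -> phi [set x; y] \notin i |: (j |: used e' phi u) ->
       kempe_swap phi i j X [set x; y] = phi [set x; y]].
  move=> cX; split; first exact: kempe_swap_proper.
    move=> x y exy; rewrite (kempe_swapE cX) //; case: ifP => _; last exact: rK.
    by case: tpermP => // _ _; apply: rK.
  move=> x y exy; rewrite !inE !negb_or => /and3P[ni nj _].
  by rewrite (kempe_swapE cX) // tpermD ?if_same // eq_sym.
have [w euw wj] : exists2 w, e' u w & phi [set u; w] = j.
  by case/usedP: ju => w; exists w.
(* If [v] is outside the component of [u], a swap there frees [j] at [u]. Otherwise [u] and [v] are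
   the two ends of that component, so it contains no third vertex missing [i] or [j]. *)
have [vX|vX] := boolP (v \in kempe_comp e' phi i j u); last first.
  have cX := @kempe_comp_closed e' phi i j u es'.
  have [p1 r1 a1] := swK _ cX.
  apply: (wk set0 _ _ a1); first exact: sub0set.
  apply: fan0 => //; rewrite (kempe_swap_used cX) ?kempe_comp_id ?(negPf vX) //.
  by rewrite mem_tperm tpermR.
have [t tK tw] : exists2 t, t \in K & t \notin used e' phi w.
  apply: avoid; apply: leq_ltn_trans (card_used _ _ _) (leq_ltn_trans _ K4).
  by case: e'3.
have tj : t != j.
  by apply: contraNneq tw => ->; rewrite -wj setUC mem_used // es'.
have [tu|tu] := boolP (t \in used e' phi u); last first.
  apply: (wk [set j] phi) => //; last exact: fan1 euw wj tK tu tw.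
  by rewrite sub1set !inE eqxx orbT.
have [w2 euw2 w2t] : exists2 w2, e' u w2 & phi [set u; w2] = t.
  by case/usedP: tu => w2; exists w2.
have sub : [set j; t] \subset i |: (j |: used e' phi u).
  by rewrite subUset !sub1set !inE eqxx tu !orbT.
have uE : used e' phi u = [set j; t].
  apply/eqP; rewrite eq_sym eqEcard subUset !sub1set ju tu cards2 eq_sym tj.
  apply: leq_trans (card_used _ _ _) _; rewrite -ltnS.
  by apply: leq_trans (card_del euv) _; case: e3.
have fin phi1 t2 : proper_col e' phi1 -> ranges e' phi1 K ->
    (forall x y, e' x y -> phi [set x; y] \notin i |: (j |: used e' phi u) ->
       phi1 [set x; y] = phi [set x; y]) ->
    j \notin used e' phi1 v -> phi1 [set u; w] = j -> phi1 [set u; w2] = t ->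
    t \notin used e' phi1 w -> t2 \in K -> t2 \notin used e' phi1 u ->
    t2 \notin used e' phi1 w2 ->
    exists phi', fan_ext phi j (i |: (j |: used e' phi u)) phi'.
  move=> p1 r1 a1 jv1 wj1 w2t1 tw1 t2K t2u t2w; apply: (wk _ phi1 sub a1).
  exact: fan2 euw wj1 euw2 w2t1 tj tK tw1 t2K t2u t2w.
have [iw2|iw2] := boolP (i \in used e' phi w2); last exact: (fin phi i).
(* If [w2] sees [j], a colour missing at [w2] differs from [j] and [t], the only colours at [u], so
   the fan opens without a Kempe change. *)
have [jw2|jw2] := boolP (j \in used e' phi w2).
  have [t2 t2K t2w2] : exists2 t2, t2 \in K & t2 \notin used e' phi w2.
    apply: avoid; apply: leq_ltn_trans (card_used _ _ _) (leq_ltn_trans _ K4).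
    by case: e'3.
  apply: (fin phi t2) => //; rewrite uE !inE negb_or; apply/andP; split.
    by apply: contraNneq t2w2 => ->.
  by apply: contraNneq t2w2 => ->; rewrite -w2t setUC mem_used // es'.
(* Now [w2] misses [j] and is an end of a component other than that of [u], [v] and [w]. The swap
   leaves these three alone and makes [i] missing at [w2]. *)
have cX := @kempe_comp_closed e' phi i j w2 es'.
have /andP[w2v w2u] := e'uv euw2.
have kend x : j \notin used e' phi x -> #|kempe_rel e' phi i j x| <= 1.
  exact: kempe_rel_card1.
have kendu : #|kempe_rel e' phi i j u| <= 1.
  by rewrite kempe_relC kempe_rel_card1.
have uX : u \notin kempe_comp e' phi i j w2.
  apply/negP; rewrite inE (sym_connect_sym (kempe_rel_sym _ _ _ es')) => uw2.
  apply: (@kempe_comp3 e' phi i j u u v w2) => //; rewrite ?kempe_comp_id ?inE //;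
    by rewrite ?kend // uv eq_sym w2u eq_sym.
have notX x : x \in kempe_comp e' phi i j u -> x \notin kempe_comp e' phi i j w2.
  rewrite !inE => ux; apply: contraNN uX; rewrite inE => w2x.
  by rewrite (connect_trans w2x) // (sym_connect_sym (kempe_rel_sym _ _ _ es')).
have wX : w \notin kempe_comp e' phi i j w2.
  by apply: notX; rewrite inE connect1 // /kempe_rel /restr euw wj !inE eqxx orbT.
have [p1 r1 a1] := swK _ cX.
apply: (fin _ i p1 r1 a1); rewrite ?(kempe_swapE cX) ?(kempe_swap_used cX) //.
- by rewrite (negPf (notX _ vX)).
- by rewrite (negPf uX).
- by rewrite (negPf uX).
- by rewrite (negPf wX).
- by rewrite (negPf uX).
- by rewrite kempe_comp_id mem_tperm tpermL.
Qed.

End Fan.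

(** Ordered pairs are counted, so a symmetric relation gives twice its number of edges; the value
    serves as an induction measure. *)
Definition nedges e := #|[set p : V * V | e p.1 p.2]|.

Lemma nedges_lt e e' u v :
  subrel e' e -> e u v -> ~~ e' u v -> nedges e' < nedges e.
Proof.
move=> s euv neuv; apply: proper_card; apply/properP; split.
  by apply/subsetP=> p; rewrite !inE; apply: s.
by exists (u, v); rewrite inE.
Qed.

Lemma vizing e (K : {set T}) : subcubic_rel e -> 3 < #|K| ->
  exists phi, proper_col e phi /\ ranges e phi K.
Proof.
move=> e3 K4; have [n] := ubnP (nedges e); elim: n e e3 => // n IH e e3 ltn.
have [c cK] : exists c, c \in K by apply/card_gt0P; apply: leq_trans K4.
have [/existsP[u /existsP[v euv]]|] := boolP [exists u, exists v, e u v]; last first.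
  move=> ne; exists (fun=> c); split=> [x y z exy|x y exy //].
  by case/existsP: ne; exists x; apply/existsP; exists y.
have d3 : subcubic_rel (del e u v) by apply: subcubic_restr.
have [|phi [p r]] := IH _ d3.
  rewrite -ltnS; apply: leq_trans ltn; rewrite ltnS.
  by apply: nedges_lt (@del_sub e u v) euv _; rewrite del_edge eqxx andbF.
have es : symmetric e by case: e3.
have small x y : e x y -> #|used (del e x y) phi x| < #|K|.
  move=> exy; apply: leq_ltn_trans (card_used _ _ _) (leq_ltn_trans _ K4).
  by have [_ _ h] := subcubic_restr (fun f => f != [set x; y]) e3; apply: h.
have [i iK iu] := avoid (small _ _ euv).
have [j jK jv] := avoid (small v u (etrans (es _ _) euv)).
rewrite del_C in jv.
by have [phi' [p' r' _ _]] := fan e3 K4 euv p r iK iu jK jv; exists phi'.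
Qed.

(** If both edges have colour [k], the edge [uv] is recoloured through a fan with [i] and [j]
    different from [k]. By properness no other edge at [u] has colour [k], so [k] is not among the
    colours that may change and [xy] keeps it. *)
Lemma vizing2 e (K : {set T}) u v x y : subcubic_rel e -> 3 < #|K| ->
    e u v -> e x y -> [set u; v] != [set x; y] ->
  exists phi, [/\ proper_col e phi, ranges e phi K & phi [set u; v] != phi [set x; y]].
Proof.
move=> e3 K4 euv exy n; have [phi [p r]] := vizing e3 K4.
have [E|ne] := eqVneq (phi [set u; v]) (phi [set x; y]); last by exists phi.
have es : symmetric e by case: e3.
pose k := phi [set u; v].
have dsub := @del_sub e u v.
(* At most two other edges remain at an end of the deleted edge, so together with [k] they exclude
   at most three of the four colours. *)
have h a b : e a b -> #|k |: used (del e a b) phi a| < #|K|.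
  move=> eab; apply: leq_ltn_trans K4; rewrite cardsU1.
  have := leq_trans (card_used (del e a b) phi a) (leqnn _).
  by have := card_del eab; case: e3 => _ _ /(_ a); case: (_ \notin _); lia.
have [i iK] := avoid (h _ _ euv); rewrite !inE negb_or => /andP[ik iu].
have [j jK] := avoid (h v u (etrans (es _ _) euv)).
rewrite del_C !inE negb_or => /andP[jk jv].
have [||phi' [p' r' j' a']] := fan e3 K4 euv _ _ iK iu jK jv.
- exact: proper_sub p.
- by move=> a b /dsub; apply: r.
exists phi'; split=> //; rewrite j' a' -?E //.
  by rewrite del_edge exy eq_sym.
rewrite !inE !negb_or eq_sym ik eq_sym jk /=.
apply/negP=> /usedP[w /andP[euw nw] /eqP]; apply/negP; apply: p => //.
by apply: contraNneq nw => ->.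
Qed.

(** * Extending precolourings with five colours *)

Section Extension.
Variables (a : V -> T) (E : {set {set V}}) (pc : {set V} -> T).
Hypothesis T5 : #|T| = 5.
Implicit Types (S : {set V}).

Definition good e S phi :=
  [/\ proper_col e phi,
      forall x y, e x y -> x \in S -> phi [set x; y] != a x &
      forall x y, e x y -> [set x; y] \in E -> phi [set x; y] = pc [set x; y]].

Definition compat e S :=
  (forall x y z, e x y -> e x z -> y != z -> [set x; y] \in E ->
     [set x; z] \in E -> pc [set x; y] != pc [set x; z]) /\
  (forall x y, e x y -> x \in S -> [set x; y] \in E -> pc [set x; y] != a x).

Definition free e := restr e (fun f => f \notin E).

Lemma compat_sub e e' S S' : subrel e' e -> S' \subset S ->
  compat e S -> compat e' S'.
Proof.
move=> se /subsetP sS [c1 c2]; split=> [x y z /se exy /se exz|x y /se exy /sS xS].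
  exact: c1.
exact: c2.
Qed.

Lemma free_sub e e' u v : subrel e' e -> free e u v -> ~~ e' u v ->
  nedges (free e') < nedges (free e).
Proof.
move=> se fuv neuv; apply: nedges_lt fuv _.
  by move=> x y /andP[/se exy nE]; rewrite /free /restr exy.
by apply: contraNN neuv => /andP[].
Qed.

Lemma good_all e S : compat e S -> (forall x y, ~~ free e x y) -> good e S pc.
Proof.
move=> [c1 c2] nf; have inE' x y : e x y -> [set x; y] \in E.
  by move=> exy; move: (nf x y); rewrite /free /restr exy negbK.
split=> // [x y z exy exz yz|x y exy xS]; [apply: c1|apply: c2] => //; exact: inE'.
Qed.

(** Each end excludes the colours of its other edges, at most [#|e u| - 1] or [#|e v| - 1], and its
    prescribed missing colour if it is in [S]. A sum of at most 6 therefore means at most 4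
    exclusions among 5 colours. *)
Lemma good_add e S u v phi : subcubic_rel e -> free e u v ->
  (u \in S) + (v \in S) + #|e u| + #|e v| <= 6 ->
  good (del e u v) S phi -> exists phi', good e S phi'.
Proof.
move=> e3 fuv h [p1 p2 p3]; have [es ei _] := e3; have [euv nE] := andP fuv.
have evu : e v u by rewrite es.
pose forb w := if w \in S then [set a w] else set0.
have forb1 w : #|forb w| = (w \in S) by rewrite /forb; case: ifP; rewrite ?cards1 ?cards0.
have [c _] : exists2 c, c \in [set: T] & c \notin
    (used (del e u v) phi u :|: used (del e u v) phi v) :|: (forb u :|: forb v).
  apply: avoid; rewrite cardsT T5.
  have := leq_of_leqif (leq_card_setU (used (del e u v) phi u :|: used (del e u v) phi v) (forb u :|: forb v)).
  have := leq_of_leqif (leq_card_setU (used (del e u v) phi u) (used (del e u v) phi v)).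
  have := leq_of_leqif (leq_card_setU (forb u) (forb v)).
  have := card_used (del e u v) phi u; have := card_used (del e u v) phi v.
  have := card_del euv; have := card_del evu; rewrite [del e v u]del_C !forb1; lia.
rewrite !inE !negb_or => /andP[/andP[cu cv] /andP[fu fv]].
have forbP w : w \in S -> c \notin forb w -> c != a w.
  by rewrite /forb => ->; rewrite inE.
exists (recol phi [set u; v] c); split; first exact: add_edge.
  move=> x y exy xS; rewrite /recol; case: ([set x; y] =P [set u; v]) => [/set2_cases|/eqP n].
    by case=> -[E' _]; rewrite E' in xS *; apply: forbP.
  by apply: p2 => //; rewrite del_edge exy.
move=> x y exy xyE; rewrite recol_diff ?p3 // ?del_edge ?exy //=;
  by apply: contraNneq nE => <-.
Qed.

(** Without missing colours the sum in [good_add] is at most 3 + 3, whatever the size of [E]. *)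
Lemma greedy e : subcubic_rel e -> compat e set0 -> exists phi, good e set0 phi.
Proof.
have [n] := ubnP (nedges (free e)); elim: n e => // n IH e ltn e3 ce.
have [/existsP[u /existsP[v fuv]]|nf] := boolP [exists u, exists v, free e u v]; last first.
  exists pc; apply: good_all => // x y; apply: contraNN nf => fxy.
  by apply/existsP; exists x; apply/existsP; exists y.
have dn : ~~ del e u v u v by rewrite del_edge eqxx andbF.
have [||phi gphi] := IH (del e u v) _ (subcubic_restr _ e3).
- by rewrite -ltnS; apply: leq_trans ltn; rewrite ltnS; apply: free_sub fuv dn; apply: del_sub.
- exact: compat_sub (@del_sub e u v) (subxx _) ce.
apply: good_add fuv _ gphi => //; rewrite !in_set0 /=.
by case: e3 => _ _ h; have := h u; have := h v; lia.
Qed.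

(** The star at [x] meets the rest of the graph only in its leaves, so [phi] and [col] interact
    there alone. The constraint of [x] concerns [col] only, hence [S :\ x] for [phi]. *)
Lemma star_ext e S x phi (col : V -> T) : subcubic_rel e ->
  good (restr e (fun f => x \notin f)) (S :\ x) phi ->
  {in e x &, injective col} ->
  (forall y, e x y -> col y \notin used (restr e (fun f => x \notin f)) phi y) ->
  (forall y, e x y -> y \in S -> col y != a y) ->
  (forall y, e x y -> x \in S -> col y != a x) ->
  (forall y, e x y -> [set x; y] \in E -> col y = pc [set x; y]) ->
  exists phi', good e S phi'.
Proof.
set e' := restr e _ => e3 [p1 p2 p3] inj cu cS cx cE; have [es ei _] := e3.
pose phi' f := if [pick y | e x y && (f == [set x; y])] is Some y
               then col y else phi f.
have at_x y : e x y -> phi' [set x; y] = col y.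
  move=> exy; rewrite /phi'; case: pickP => [z /andP[_ /eqP /set2_inj->] //|].
  by move/(_ y); rewrite exy eqxx.
have off u v : u != x -> v != x -> phi' [set u; v] = phi [set u; v].
  move=> ux vx; rewrite /phi'; case: pickP => // z /andP[_ /eqP uvE].
  have: x \in [set u; v] by rewrite uvE !inE eqxx.
  by rewrite !inE ![x == _]eq_sym (negPf ux) (negPf vx).
have e'E u v : e u v -> u != x -> v != x -> e' u v.
  by move=> euv ux vx; rewrite /e' /restr euv !inE negb_or ![x == _]eq_sym ux.
have nx u v : e u v -> u = x -> v != x.
  by move=> euv ux; apply: contraTneq euv => ->; rewrite ux ei.
have one u v w : e u v -> e u w -> v != w -> v = x -> phi' [set u; v] != phi' [set u; w].
  move=> euv euw vw vx; rewrite vx in euv vw *.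
  have exu : e x u by rewrite es.
  have ux : u != x by apply: contraTneq euv => ->; rewrite ei.
  rewrite setUC at_x // off //; last by rewrite eq_sym.
  by apply: contraNneq (cu _ exu) => ->; apply: mem_used; apply: e'E; rewrite // eq_sym.
exists phi'; split.
- move=> u v w euv euw vw.
  have [ux|ux] := eqVneq u x.
    rewrite ux in euv euw *; rewrite !at_x //.
    by apply: contraNneq vw => /inj->.
  have [vx|vx] := eqVneq v x; first exact: one.
  have [wx|wx] := eqVneq w x; first by rewrite eq_sym; apply: one; rewrite // eq_sym.
  by rewrite !off //; apply: p1 => //; apply: e'E.
- move=> u v euv uS; have [ux|ux] := eqVneq u x.
    by rewrite ux in euv uS *; rewrite at_x // cx.
  have [vx|vx] := eqVneq v x.
    by rewrite vx in euv *; rewrite setUC at_x 1?es // cS // es.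
  by rewrite off // p2 ?e'E // !inE ux.
- move=> u v euv uvE; have [ux|ux] := eqVneq u x.
    by rewrite ux in euv uvE *; rewrite at_x // cE.
  have [vx|vx] := eqVneq v x.
    by rewrite vx setUC in euv uvE *; rewrite at_x 1?es // cE // es.
  by rewrite off // p3 ?e'E.
Qed.

(** For lists of sizes at least 2, 2 and 1, Hall's condition can fail only if the union of the three
    has size 2; the second alternative describes this case. *)
Lemma hall3 (L1 L2 L3 : {set T}) : 1 < #|L1| -> 1 < #|L2| -> 0 < #|L3| ->
  (exists c1 c2 c3, [/\ c1 \in L1, c2 \in L2, c3 \in L3 &
     [/\ c1 != c2, c1 != c3 & c2 != c3]]) \/
  [/\ L1 = L2, #|L1| = 2 & L3 \subset L1].
Proof.
move=> l1 l2 l3.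
have pick1 (L : {set T}) c : 1 < #|L| -> exists2 d, d \in L & d != c.
  move=> l; have [|d dL] := @avoid L [set c]; first by rewrite cards1.
  by rewrite inE; exists d.
have [s1|/subsetPn[c3 c3L c3n]] := boolP (L3 \subset L1); last first.
  have [c2 c2L n2] := pick1 L2 c3 l2; have [c1 c1L n1] := pick1 L1 c2 l1.
  left; exists c1, c2, c3; split=> //; split=> //.
  by apply: contraNneq c3n => <-.
have [s2|/subsetPn[c3 c3L c3n]] := boolP (L3 \subset L2); last first.
  have [c1 c1L n1] := pick1 L1 c3 l1; have [c2 c2L n2] := pick1 L2 c1 l2.
  left; exists c1, c2, c3; split=> //; split=> //; first by rewrite eq_sym.
  by apply: contraNneq c3n => <-.
have /card_gt0P[c3 c3L] := l3.
have [g1|le1] := ltnP 2 #|L1|.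
  have [c2 c2L n2] := pick1 L2 c3 l2.
  have [|c1 c1L] := @avoid L1 [set c2; c3].
    by rewrite cards2; case: (_ != _) => //=; lia.
  rewrite !inE negb_or => /andP[n12 n13].
  by left; exists c1, c2, c3.
have [g2|le2] := ltnP 2 #|L2|.
  have [c1 c1L n1] := pick1 L1 c3 l1.
  have [|c2 c2L] := @avoid L2 [set c1; c3].
    by rewrite cards2; case: (_ != _) => //=; lia.
  rewrite !inE negb_or => /andP[n12 n13].
  by left; exists c1, c2, c3; split=> //; split=> //; rewrite eq_sym.
have E1 : #|L1| = 2 by lia.
have [->|n] := eqVneq L1 L2; first by right; split=> //; lia.
have /subsetPn[c1 c1L c1n] : ~~ (L1 \subset L2).
  by apply: contraNN n => s; rewrite eqEcard s E1.
have [c2 c2L n2] := pick1 L2 c3 l2.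
left; exists c1, c2, c3; split=> //; split=> //.
  by apply: contraNneq c1n => ->.
by apply: contraNneq c1n => ->; apply: subsetP s2 _ c3L.
Qed.

Definition forb S y : {set T} := if y \in S then [set a y] else set0.

Lemma card_forb S y : #|forb S y| = (y \in S).
Proof. by rewrite /forb; case: ifP; rewrite ?cards1 ?cards0. Qed.

Definition avail e S x phi y : {set T} :=
  ~: (a x |: (used (restr e (fun f => x \notin f)) phi y :|: forb S y)).

Lemma availE e S x phi y k : (k \in avail e S x phi y) =
  [&& k != a x, k \notin used (restr e (fun f => x \notin f)) phi y &
      k \notin forb S y].
Proof. by rewrite in_setC in_setU1 in_setU !negb_or. Qed.

Lemma star_ext3 e S x y1 y2 y3 phi c1 c2 c3 : subcubic_rel e ->
  good (restr e (fun f => x \notin f)) (S :\ x) phi ->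
  (forall y, e x y -> [|| y == y1, y == y2 | y == y3]) ->
  (forall y, e x y -> [set x; y] \notin E) ->
  c1 \in avail e S x phi y1 -> c2 \in avail e S x phi y2 ->
  c3 \in avail e S x phi y3 ->
  [/\ y1 != y2, y1 != y3 & y2 != y3] -> [/\ c1 != c2, c1 != c3 & c2 != c3] ->
  exists phi', good e S phi'.
Proof.
move=> e3 g nb nE A1 A2 A3 [y12 y13 y23] [c12 c13 c23].
pose col y := if y == y1 then c1 else if y == y2 then c2 else c3.
have colA y : e x y -> col y \in avail e S x phi y.
  move/nb; rewrite /col; case: eqP => [->|_ /=] //; case: eqP => [->|_ /=] //.
  by move/eqP->.
apply: (@star_ext e S x phi col) => //.
- move=> y y' /nb h /nb h'; rewrite /col; move: h h'.
  have [->|n1] := eqVneq y y1; have [->|n1'] := eqVneq y' y1 => //=.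
  + by case: ifP => _ _ _ E'; move: c12 c13; rewrite E' eqxx.
  + by case: ifP => _ _ _ E'; rewrite E' ?eqxx in c12 c13 *.
  have [->|n2] := eqVneq y y2; have [->|n2'] := eqVneq y' y2 => //=.
  + by move=> _ _ E'; rewrite E' eqxx in c23.
  + by move=> _ _ E'; rewrite E' eqxx in c23.
  by move=> /eqP-> /eqP->.
- by move=> y /colA; rewrite !inE !negb_or => /and3P[].
- move=> y /colA; rewrite !inE !negb_or => /and3P[_ _] h yS.
  by move: h; rewrite /forb yS inE.
- by move=> y /colA; rewrite !inE !negb_or => /and3P[].
- by move=> y /nE /negPf->.
Qed.

Definition hits (K : seq (V * T)) c d :=
  count (fun k : V * T => (k.2 == c) || (k.2 == d)) K.

(** Averaging: let [n t] count the anchors of colour [t], let [p], [q] be the colours of [D], and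
    let [d] minimise [n] on [Z]. Then [n p + n q + #|Z| * n d <= size K <= 2 + ~~ b]. So either
    [n d = 0], or [n d = 1] and neither [p] nor [q] is hit. A single hit is tolerated only for a
    colour of [U], which excludes at most [b] of the two. *)
Lemma few_hits (K : seq (V * T)) (D U Z : {set T}) (b : bool) :
  #|D| = 2 -> 2 + ~~ b <= #|Z| -> size K <= 2 + ~~ b -> [disjoint D & Z] ->
  #|D :\: U| <= b ->
  exists c d, [/\ c \in D, d \in Z &
    hits K c d = 0 \/ (hits K c d <= 1 /\ c \in U)].
Proof.
move=> D2 Zn Kn dDZ DU; pose n t := count (fun k : V * T => k.2 == t) K.
have [d0 d0Z] : exists d, d \in Z by apply/card_gt0P; apply: leq_trans Zn; case: (b).
have [d dZ dmin] := @arg_minnP _ d0 (fun t => t \in Z) n d0Z.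
have hn c : hits K c d <= n c + n d.
  by rewrite /hits /n -count_predUI leq_addr.
have sumK : \sum_(t : T) n t = size K.
  rewrite /n -sum1_size; under eq_bigr => t _ do rewrite -sum1_count.
  rewrite (exchange_big_dep predT) //=; apply: eq_bigr => k _.
  by rewrite (big_pred1 k.2) // => t; rewrite eq_sym.
have sumDZ : \sum_(t in D) n t + #|Z| * n d <= size K.
  rewrite -sumK [leqRHS](bigID (mem D)) /= leq_add2l /= -sum_nat_const.
  apply: leq_trans (_ : \sum_(t in Z) n t <= _); first exact: leq_sum.
  rewrite [leqRHS](bigID (mem Z)) /= -[leqLHS]addn0 leq_add //.
  rewrite [leqRHS](eq_bigl (fun t => t \in Z)) // => t.
  by rewrite andb_idl ?andb_idr // => tZ; rewrite (disjointFl dDZ).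
move/eqP: D2 => /cards2P[p [q [pq DE]]].
have pnq : p \notin [set q] by rewrite inE.
rewrite DE (big_setU1 _ pnq) big_set1 /= in sumDZ.
have pD : p \in D by rewrite DE !inE eqxx.
have qD : q \in D by rewrite DE !inE eqxx orbT.
have ok c : c \in D -> hits K c d = 0 -> exists c d, [/\ c \in D, d \in Z &
    hits K c d = 0 \/ (hits K c d <= 1 /\ c \in U)].
  by move=> cD h; exists c, d; split=> //; left.
have ok1 c : c \in D -> c \in U -> hits K c d <= 1 -> exists c d, [/\ c \in D, d \in Z &
    hits K c d = 0 \/ (hits K c d <= 1 /\ c \in U)].
  by move=> cD cU h; exists c, d; split=> //; right.
have hp := hn p; have hq := hn q.
have DUE c : c \in D -> c \notin U -> c \in D :\: U by move=> h h'; rewrite inE h'.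
case: b Zn Kn DU => /= Zn Kn DU.
  have sz : 2 * n d <= #|Z| * n d by rewrite leq_mul2r Zn orbT.
  have [pU|pU] := boolP (p \in U).
    have [?|?] := leqP (n p + n d) 1; first by apply: (ok1 p) => //; lia.
    by apply: (ok q) => //; lia.
  have qU : q \in U.
    apply: contraTT DU => qU; rewrite -ltnNge; apply/card_gt1P.
    by exists p, q; rewrite !DUE.
  have [?|?] := leqP (n q + n d) 1; first by apply: (ok1 q) => //; lia.
  by apply: (ok p) => //; lia.
have sz : 3 * n d <= #|Z| * n d by rewrite leq_mul2r Zn orbT.
have allU c : c \in D -> c \in U.
  move=> cD; apply: contraTT DU => cU; rewrite -ltnNge; apply/card_gt0P.
  by exists c; apply: DUE.
have [?|?] := leqP (n p) (n q); first by apply: (ok1 p) => //; [exact: allU | lia].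
by apply: (ok1 q) => //; [exact: allU | lia].
Qed.

(** * Kempe changes at a star in the presence of prescriptions *)

Section KempeStar.
Variables (e : rel V) (S : {set V}) (x : V).
Hypotheses (e3 : subcubic_rel e) (ce : compat e S) (xS : x \in S).
Hypothesis nE : forall y, e x y -> [set x; y] \notin E.
Hypothesis SE4 : #|S| + #|E| <= 4.
Let e' := restr e (fun f => x \notin f).

Let e'3 : subcubic_rel e'. Proof. exact: subcubic_restr. Qed.

Let e's : symmetric e'. Proof. by case: e'3. Qed.

Let e'x y : e x y -> #|e' y| <= 2.
Proof.
move=> exy; have [es ei h] := e3; have eyx : e y x by rewrite es.
rewrite -ltnS; apply: leq_trans (h y); apply: proper_card.
apply/properP; split; first by apply/subsetP=> z /andP[].
by exists x => //; apply/negP=> /andP[_]; rewrite !inE eqxx orbT.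
Qed.

Lemma card_avail y phi : e x y -> 1 < #|avail e S x phi y| + (y \in S).
Proof.
move=> exy; have h := leq_trans (card_used e' phi y) (e'x exy).
have := cardsC (a x |: (used e' phi y :|: forb S y)).
rewrite T5 /avail -/e' cardsU1.
have := leq_of_leqif (leq_card_setU (used e' phi y) (forb S y)).
by rewrite card_forb; case: (_ \notin _); case: (y \in S); rewrite /=; lia.
Qed.

(* A Kempe change of a component without anchors of its two colours respects
   every prescription, except possibly the one at y. *)
Definition anchors y : seq (V * T) :=
  [seq (v, a v) | v <- enum (S :\ x :\ y)] ++
  [seq (odflt x [pick v in pred_of_set f], pc f) | f : {set V} <- enum E].

(** Since [x] has left [S], at most three prescriptions remain, and one fewer when [y] is another
    vertex of [S]. For [y != x] this is the bound [2 + ~~ b] of [few_hits]. *)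
Lemma size_anchors y : size (anchors y) + 1 + (y \in S) <= 4 + (y == x).
Proof.
rewrite size_cat !size_map -!cardE.
have := cardsD1 y (S :\ x); have := cardsD1 x S; rewrite xS !inE.
case: eqP => _; case: (y \in S) => /=; move: SE4;
  by set A := #|S|; set B := #|E|; set C := #|(S :\ x) :\ y|; set D := #|S :\ x|; lia.
Qed.

(** The constraint at [y] has no anchor. If it involves [c] or [d], it survives because [y] is
    isolated in the graph of these two colours and so is outside the component of [s]. *)
Lemma kempe_swap_good phi c d y s :
  good e' (S :\ x) phi ->
  (y \in S -> (a y == c) || (a y == d) ->
     (c \notin used e' phi y) && (d \notin used e' phi y) && (s != y)) ->
  (forall k, k \in anchors y -> (k.2 == c) || (k.2 == d) ->
     k.1 \notin kempe_comp e' phi c d s) ->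
  good e' (S :\ x) (kempe_swap phi c d (kempe_comp e' phi c d s)).
Proof.
move=> [p1 p2 p3] hy hK; set X := kempe_comp e' phi c d s.
have cX := @kempe_comp_closed e' phi c d s e's.
have fix_col k t : (k == c) || (k == d) = false -> (tperm c d t == k) = (t == k).
  move=> /norP[kc kd]; rewrite -(inj_eq (@perm_inj _ (tperm c d))) tpermK.
  by rewrite tpermD // eq_sym.
split; first exact: kempe_swap_proper.
- move=> v w evw; rewrite !inE => /andP[vx vS]; rewrite (kempe_swapE cX) //.
  have h : phi [set v; w] != a v by rewrite p2 // !inE vx.
  case: ifP => // vX; have [hv|hv] := boolP ((a v == c) || (a v == d)); last first.
    by rewrite fix_col //; apply: negbTE.
  have [vy|vy] := eqVneq v y; last first.
    have: (v, a v) \in anchors y.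
      rewrite mem_cat; apply/orP; left; apply/mapP; exists v => //.
      by rewrite mem_enum !inE vy vx.
    by move/hK => /(_ hv); rewrite /= -/X vX.
  rewrite vy in vS hv vX; have /andP[/andP[nc nd] sy] := hy vS hv.
  move: vX; rewrite inE (sym_connect_sym (kempe_rel_sym _ _ _ e's)).
  case/connectP=> -[|w' q] /=; first by move=> _ E'; rewrite E' eqxx in sy.
  case/andP=> /andP[eyw]; rewrite !inE => /orP[] /eqP E' _ _.
    by rewrite -E' mem_used in nc.
  by rewrite -E' mem_used in nd.
- move=> v w evw vwE; rewrite (kempe_swapE cX) //; case: ifP => vX; last exact: p3.
  have vwc := p3 _ _ evw vwE.
  have [hv|hv] := boolP ((pc [set v; w] == c) || (pc [set v; w] == d)); last first.
    by apply/eqP; rewrite fix_col ?vwc //; apply: negbTE.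
  (* One end is enough to anchor a precoloured edge: if its colour is [c] or [d], both ends lie in
     the same component. *)
  pose r := odflt x [pick t in [set v; w]].
  have: (r, pc [set v; w]) \in anchors y.
    rewrite mem_cat; apply/orP; right; apply/mapP; exists [set v; w] => //.
    by rewrite mem_enum.
  move/hK => /(_ hv); rewrite /= -/X => /negP[].
  have wX : w \in X by rewrite -(cX v w) // /kempe_rel /restr evw /= vwc !inE.
  have : r \in [set v; w].
    by rewrite /r; case: pickP => //= /(_ v); rewrite !inE eqxx.
  by case/set2P=> ->.
Qed.

(* If the star at x cannot be coloured, then y1 and y2 see the same two colours.
   Exchanging one of them, c, with a colour d free at y3 along the Kempe component
   of some y_i opens the star; at most one anchor has colour c or d, and by
   [three_ends] its component misses one of the y_i. *)
Lemma kempe_star y1 y2 y3 : [/\ y1 != y2, y1 != y3 & y2 != y3] ->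
  [/\ e x y1, e x y2 & e x y3] ->
  (forall y, e x y -> [|| y == y1, y == y2 | y == y3]) ->
  y1 \notin S -> y2 \notin S ->
  (exists phi, good e' (S :\ x) phi) -> exists phi, good e S phi.
Proof.
move=> [y12 y13 y23] [x1 x2 x3] nb y1S y2S [phi gphi].
have l1 := card_avail phi x1; have l2 := card_avail phi x2.
have l3 := card_avail phi x3.
rewrite (negPf y1S) addn0 in l1; rewrite (negPf y2S) addn0 in l2.
have l3' : 0 < #|avail e S x phi y3| by move: l3; case: (_ \in S); lia.
case: (hall3 l1 l2 l3') => [[c1 [c2 [c3 [A1 A2 A3 d]]]]|[L12 L1c L31]].
  exact: (star_ext3 e3 gphi nb nE A1 A2 A3).
set L := avail e S x phi y1 in L12 L1c L31.
pose D := used e' phi y1.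
have LE : L = ~: (a x |: D) by rewrite /L /avail /forb (negPf y1S) setU0.
have LE2 : L = ~: (a x |: used e' phi y2).
  by rewrite L12 /avail /forb (negPf y2S) setU0.
(* Since [L] has only two colours, the count in [card_avail] is tight: [y1] and [y2] each see
   exactly the two colours of [D], and [a x] is not one of them. *)
have c3D : #|a x |: D| = 3 by have := cardsC L; rewrite T5 L1c LE setCK; lia.
have cD : #|D| <= 2 by apply: leq_trans (card_used _ _ _) (e'x x1).
have cD2 : #|used e' phi y2| <= 2 by apply: leq_trans (card_used _ _ _) (e'x x2).
have axD : a x \notin D.
  by apply/negP=> h; move: c3D; rewrite cardsU1 h; lia.
have D2 : #|D| = 2 by move: c3D; rewrite cardsU1 axD; lia.
have DE2 : used e' phi y2 = D.
  have E' : a x |: used e' phi y2 = a x |: D.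
    by apply: setC_inj; rewrite -LE -LE2.
  have ax2 : a x \notin used e' phi y2.
    by apply/negP=> h; move: c3D; rewrite -E' cardsU1 h; lia.
  by rewrite -(setU1K ax2) E' setU1K.
pose A3 := used e' phi y3 :|: forb S y3.
(* A colour of [D] outside [A3] would be available for [y3] and hence lie in [L], which is disjoint
   from [D]. *)
have DA3 : D \subset A3.
  apply/subsetP=> t tD; apply: contraTT tD => tA.
  have [->|tx] := eqVneq t (a x); first exact: axD.
  have : t \in L by apply: (subsetP L31); rewrite in_setC in_setU1 negb_or tx.
  by rewrite LE in_setC in_setU1 negb_or => /andP[].
have cA3 : #|A3| <= 2 + (y3 \in S).
  have := leq_of_leqif (leq_card_setU (used e' phi y3) (forb S y3)).
  have := leq_trans (card_used e' phi y3) (e'x x3); rewrite card_forb -/A3.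
  by move: #|A3| #|used _ _ _| => m n; case: (y3 \in S); clear; lia.
have y3x : y3 != x by apply: contraTneq x3 => ->; case: e3 => _ ->.
(* Requiring [c] to be seen at [y3] when there is a hit excludes [c = a y3] for [y3] in [S], so that
   the swap may also start at [y3]. *)
have [c [d [cinD dinZ hit]]] : exists c d, [/\ c \in D, d \in ~: A3 &
    hits (anchors y3) c d = 0 \/ (hits (anchors y3) c d <= 1 /\ c \in used e' phi y3)].
  apply: (@few_hits _ D _ (~: A3) (y3 \in S)) => //.
  - have := cardsC A3; rewrite T5; move: cA3; move: #|A3| #|~: A3| => m n.
    by case: (y3 \in S); clear; lia.
  - have := size_anchors y3; rewrite (negPf y3x); move: (size _) => m.
    by case: (y3 \in S) => /=; clear; lia.
  - by rewrite disjoints_subset setCK.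
  - rewrite -(card_forb S y3); apply: subset_leq_card; apply/subsetP=> t.
    rewrite inE => /andP[tu tD]; have := subsetP DA3 _ tD.
    by rewrite inE (negPf tu).
rewrite inE in dinZ; have dD : d \notin D by apply: contraNN dinZ; apply: subsetP.
have cd : c != d by apply: contraNneq dD => <-.
have d1 : d \notin used e' phi y1 by [].
have d2 : d \notin used e' phi y2 by rewrite DE2.
have d3 : d \notin used e' phi y3.
  by apply: contraNN dinZ; rewrite inE => ->.
have pphi : proper_col e' phi by case: gphi.
clear l1 l2 l3 c3D cD cD2 cA3 LE2.
have key s : [\/ s = y1, s = y2 | s = y3 /\ c \in used e' phi y3] ->
    (forall k, k \in anchors y3 -> (k.2 == c) || (k.2 == d) ->
      k.1 \notin kempe_comp e' phi c d s) -> exists phi, good e S phi.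
  move=> sy hK.
  have iso3 : y3 \in S -> (a y3 == c) || (a y3 == d) ->
      (c \notin used e' phi y3) && (d \notin used e' phi y3) && (s != y3).
    move=> y3S /orP[] /eqP aE; last first.
      by case/negP: dinZ; rewrite !inE /forb y3S -aE inE eqxx orbT.
    have cn : c \notin used e' phi y3.
      apply/negP=> /usedP[w eyw cE]; case: gphi => _ /(_ _ _ eyw) h _.
      by move: h; rewrite !inE y3x y3S -cE aE eqxx => /(_ isT).
    by rewrite cn d3; case: sy => [->|->|[]] //; rewrite (negPf cn).
  have g' := kempe_swap_good gphi iso3 hK.
  set X := kempe_comp e' phi c d s in g' hK *; set phi' := kempe_swap phi c d X in g' *.
  have cX := @kempe_comp_closed e' phi c d s e's.
  have uE y : used e' phi' y = if y \in X then tperm c d @: used e' phi y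
                               else used e' phi y by rewrite /phi' kempe_swap_used.
  have cax : c != a x by apply: contraNneq axD => <-.
  have [t0 t0L] : exists t0, t0 \in avail e S x phi y3 by apply/card_gt0P.
  (* After the swap a leaf in [X] gains [c] but can no longer take [d]. So [c] goes to a leaf in
     [X], and [t], chosen to be [d] if [d] is in [L], to a leaf outside [X]. The other colour [s']
     of [L] suits [y1] and [y2] in either position. *)
  pose t := if d \in L then d else t0.
  have tL3 : t \in avail e S x phi y3.
    rewrite /t; case: ifP => // dL.
    move: dinZ; rewrite in_setU negb_or availE -/e' => /andP[-> ->]; rewrite !andbT.
    by move: dL; rewrite LE in_setC in_setU1 negb_or => /andP[].
  have tL : t \in L := subsetP L31 _ tL3.
  have [s' s'L s't] : exists2 s', s' \in L & s' != t.
    by have [|s' ? h] := @avoid L [set t]; [rewrite cards1 L1c | exists s'; rewrite // inE in h].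
  have s'd : s' != d by apply: contraNneq s't => s'd; rewrite /t -s'd s'L.
  have LD k : k \in L -> (k != a x) && (k \notin D) by rewrite LE in_setC in_setU1 negb_or.
  have cL : c \notin L by rewrite LE in_setC in_setU1 cinD orbT.
  have cs : c != s' by apply: contraNneq cL => ->.
  have ct : c != t by apply: contraNneq cL => ->.
  have av y k : y \notin S -> used e' phi y = D -> k \in L -> (y \in X -> k != d) ->
      k \in avail e S x phi' y.
    move=> yS yD kL kd; have /andP[kx kD] := LD _ kL.
    rewrite availE -/e' kx /forb (negPf yS) in_set0 andbT uE yD.
    case: ifP => // yX; rewrite mem_tperm tpermD ?kD // eq_sym ?kd //.
    by apply: contraNneq cL => <-.
  have avc y : y \notin S -> used e' phi y = D -> y \in X -> c \in avail e S x phi' y.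
    move=> yS yD yX; rewrite availE -/e' cax /forb (negPf yS) in_set0 andbT uE yD.
    by rewrite yX mem_tperm tpermL.
  (* All three leaves miss [d], so they cannot all lie in one component. *)
  have two y y' y'' : [/\ y != y', y != y'' & y' != y''] ->
     d \notin used e' phi y -> d \notin used e' phi y' -> d \notin used e' phi y'' ->
     y \in X -> y' \in X -> y'' \notin X.
    move=> [n1 n2 n3] h h' h'' yX y'X; apply/negP=> y''X.
    apply: (@kempe_comp3 e' phi c d s y y' y'') => //; rewrite ?n1 ?n2 ?n3 //;
      exact: kempe_rel_card1.
  have av3 : y3 \notin X -> t \in avail e S x phi' y3.
    by move=> y3X; move: tL3; rewrite !availE -/e' uE (negPf y3X).
  have [y3X|y3X] := boolP (y3 \in X).
    have avc3 : c \in avail e S x phi' y3.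
      rewrite availE -/e' cax uE y3X mem_tperm tpermL d3 /=.
      rewrite /forb; case: ifP => [y3S|]; rewrite ?in_set0 // inE.
      apply/negP=> /eqP cE; have /andP[/andP[cn _] sy3] := iso3 y3S (introT orP (or_introl (introT eqP (esym cE)))).
      move: y3X; rewrite inE (sym_connect_sym (kempe_rel_sym _ _ _ e's)).
      case/connectP=> -[|w' q] /=; first by move=> _ E'; rewrite E' eqxx in sy3.
      case/andP=> /andP[eyw]; rewrite !inE => /orP[] /eqP E' _ _.
        by rewrite -E' mem_used in cn.
      by rewrite -E' mem_used in d3.
    have [y2X|y2X] := boolP (y2 \in X).
      have y1X : y1 \notin X by apply: (two y3 y2); rewrite // ![y3 == _]eq_sym y13 y23 eq_sym y12.
      apply: (@star_ext3 e S x y1 y2 y3 phi' t s' c) => //.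
      - by apply: av => //; rewrite (negPf y1X).
      - exact: av.
      - by split; rewrite eq_sym // eq_sym.
    apply: (@star_ext3 e S x y1 y2 y3 phi' s' t c) => //.
    - exact: av.
    - by apply: av => //; rewrite (negPf y2X).
    - by split; rewrite // eq_sym.
  have [y1X|y1X] := boolP (y1 \in X).
    apply: (@star_ext3 e S x y1 y2 y3 phi' c s' t) => //.
    - exact: avc.
    - exact: av.
    - exact: av3.
  have y2X : y2 \in X.
    have sX : s \in X by apply: kempe_comp_id.
    by case: sy sX => [->|->|[-> _]] //; rewrite ?(negPf y1X) ?(negPf y3X).
  apply: (@star_ext3 e S x y1 y2 y3 phi' s' c t) => //.
  - exact: av.
  - exact: avc.
  - exact: av3.
  - by split; rewrite // eq_sym.
have nohit s : hits (anchors y3) c d = 0 -> forall k, k \in anchors y3 ->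
    (k.2 == c) || (k.2 == d) -> k.1 \notin kempe_comp e' phi c d s.
  move=> /eqP h k kK hk; move: h; rewrite -leqn0 leqNgt -has_count => /hasPn.
  by move/(_ k kK); rewrite hk.
case: hit => [h0|[h1 cu]]; first by apply: (key y1); [constructor 1 | exact: nohit].
have [k0 hk0] : exists k0, forall k, k \in anchors y3 ->
    (k.2 == c) || (k.2 == d) -> k = k0.
  move: h1; rewrite /hits -size_filter; set F := filter _ _ => szF.
  have FE k : k \in anchors y3 -> (k.2 == c) || (k.2 == d) -> k \in F.
    by move=> kK hk; rewrite mem_filter hk.
  case: F szF FE => [|k0 [|//]] _ FE; last by exists k0 => k kK /FE; rewrite inE => /(_ kK) /eqP.
  by exists (x, c) => k kK /FE => /(_ kK).
(* If the only anchor to be avoided were in the components of all three leaves, these would coincide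
   and have three ends. *)
have [s sy sk0] : exists2 s, [\/ s = y1, s = y2 | s = y3 /\ c \in used e' phi y3] &
    k0.1 \notin kempe_comp e' phi c d s.
  have sw s r : (s \in kempe_comp e' phi c d r) = (r \in kempe_comp e' phi c d s).
    by rewrite !inE (sym_connect_sym (kempe_rel_sym _ _ _ e's)).
  have [h|h] := boolP (k0.1 \in kempe_comp e' phi c d y1); last by exists y1 => //; constructor 1.
  have [h'|h'] := boolP (k0.1 \in kempe_comp e' phi c d y2); last by exists y2 => //; constructor 2.
  exists y3; first by constructor 3.
  apply/negP=> h''; apply: (@kempe_comp3 e' phi c d k0.1 y1 y2 y3) => //;
    rewrite ?(sw y1) ?(sw y2) ?(sw y3) // ?y12 ?y13 ?y23 //; exact: kempe_rel_card1.
by apply: (key s sy) => k kK hk; rewrite (hk0 _ kK hk).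
Qed.

End KempeStar.

End Extension.

End Colorings.

(** * Irreducible configurations *)

Fixpoint subseqs (A : Type) (s : seq A) : seq (seq A) :=
  if s is x :: s' then let r := subseqs s' in map (cons x) r ++ r else [:: [::]].

Fixpoint lists (A : Type) (ls : seq (seq A)) : seq (seq A) :=
  if ls is l :: ls' then [seq x :: r | x <- l, r <- lists ls'] else [:: [::]].

Definition add_forb (c i : nat) (F : seq (seq nat)) : seq (seq nat) :=
  set_nth [::] F i (c :: nth [::] F i).

(* The conditionals make call-by-value evaluation stop early. *)
Fixpoint search (A : Type) (a : pred A) (s : seq A) : bool :=
  if s is x :: s' then if a x then true else search a s' else false.

(** Backtracking over the edges of [H]. A colour given to an edge joins the lists of both ends, so
    prescriptions and properness become one membership test. *)
Fixpoint colourable (F : seq (seq nat)) (H : seq (nat * nat)) : bool :=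
  if H is (i, j) :: H' then
    search (fun c => if (c \in nth [::] F i) || (c \in nth [::] F j) then false
                     else colourable (add_forb c i (add_forb c j F)) H') (iota 0 5)
  else true.

Definition hadj (H : seq (nat * nat)) i j := ((i, j) \in H) || ((j, i) \in H).

Definition hdeg n H i := count (hadj H i) (iota 0 n).

(** Pairs of unconstrained vertices are left out: by tightness every free edge has an end in [S],
    that is, an index below [k]. *)
Definition pairs k := [seq (i, j) | i <- iota 0 k, j <- iota i.+1 (4 - i)].

Definition degs H := [seq hdeg 5 H i | i <- iota 0 5].

(* Vertices 0, ..., 4, of which the first k carry a vertex constraint; H is the
   graph of free edges, d its degrees and P the numbers of precoloured edges. *)
Definition irreducible k H (d P : seq nat) :=
  let p := nth 0 P in
  let o i j := [&& 0 < p i, 0 < p j & ~~ hadj H i j] in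
  if all (fun i => if nth 0 d i is 0 then p i == 0 else nth 0 d i + p i <= 3) (iota 0 5) then
  if all (fun ij => 7 <= (ij.1 < k) + (ij.2 < k) +
      (nth 0 d ij.1 + p ij.1) + (nth 0 d ij.2 + p ij.2)) H then
  if all (fun i => if nth 0 d i is 0 then true else
      if p i is 0 then 1 < hdeg k H i else true) (iota 0 k) then
  all (fun i => all (fun j => all (fun l =>
          p i + p j + p l <= 4 - k + o i j + o i l + o j l)
        (iota j.+1 (4 - j))) (iota i.+1 (4 - i))) (iota 0 5)
  else false else false else false.

Definition forb_lists k (P : seq nat) : seq (seq (seq nat)) :=
  lists [seq [seq l <- subseqs (iota 0 5) | size l == (i < k) + nth 0 P i] | i <- iota 0 5].

(** Entries of [P] stop at 2, because a vertex with a free edge has at most two precoloured ones,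
    and at [4 - k], because [k] vertex constraints allow no more precoloured edges. The beta-redex
    computes the degrees once for each [H]. *)
Definition irreducible_colourable :=
  all (fun k => all (fun H => (fun d => all (fun P =>
    if irreducible k H d P then
      all (fun F => colourable F H) (forb_lists k P) else true)
    (lists (nseq 5 (iota 0 (minn 2 (4 - k)).+1)))) (degs H))
  (subseqs (pairs k))) (iota 0 5).

Lemma irreducible_colourable_true : irreducible_colourable.
Proof. by vm_compute. Qed.

Lemma subseqsP (A : eqType) (s t : seq A) : subseq t s -> t \in subseqs s.
Proof.
elim: s t => [|x s IH] t /=; first by move=> /eqP->; rewrite inE.
rewrite mem_cat; case: t => [|y t]; first by rewrite IH ?sub0seq ?orbT.
case: ifP => [/eqP->|_]; last by move=> h; rewrite IH ?orbT.
by move=> h; apply/orP; left; apply: map_f; apply: IH.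
Qed.

Lemma lists_map (B : eqType) (t : seq nat) (f : nat -> B) (g : nat -> seq B) :
  {in t, forall i, f i \in g i} -> map f t \in lists (map g t).
Proof.
elim: t => //= i t IH h; apply/allpairsP; exists (f i, map f t); split=> //=.
  by apply: h; rewrite inE eqxx.
by apply: IH => j jt; apply: h; rewrite inE jt orbT.
Qed.

Lemma colourableP F H : uniq H -> all (fun ij => ij.1 < ij.2) H -> colourable F H ->
  exists col : nat -> nat -> nat, [/\ forall i j, col i j = col j i,
    forall i j, hadj H i j -> col i j < 5 /\ col i j \notin nth [::] F i &
    forall i j l, hadj H i j -> hadj H i l -> j != l -> col i j != col i l].
Proof.
elim: H F => [|[i0 j0] H IH] F /=; first by exists (fun _ _ => 0).
case/andP=> nH uH /andP[lt0 ltH].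
have ex : search (fun c => if (c \in nth [::] F i0) || (c \in nth [::] F j0) then false
    else colourable (add_forb c i0 (add_forb c j0 F)) H) (iota 0 5) ->
    exists2 c, c < 5 & [/\ c \notin nth [::] F i0, c \notin nth [::] F j0 &
      colourable (add_forb c i0 (add_forb c j0 F)) H].
  have : all (fun c => c < 5) (iota 0 5) by [].
  elim: (iota 0 5) => //= c s IHs /andP[c5 s5]; case: ifP; last by move=> _; apply: IHs.
  by case: ifP => // /norP[]; exists c.
case/ex=> c c5 [ci cj /(IH _ uH ltH)[col [cs cF cp]]].
have nthF l i k : nth [::] (add_forb l i k) =1
    fun v => if v == i then l :: nth [::] k i else nth [::] k v.
  by move=> v; rewrite /add_forb nth_set_nth.
pose new i j := ((i, j) == (i0, j0)) || ((j, i) == (i0, j0)).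
have newC i j : new i j = new j i by rewrite /new orbC.
have hadjE i j : hadj ((i0, j0) :: H) i j = new i j || hadj H i j.
  by rewrite /hadj /new !inE orbACA.
have ij0 : i0 != j0 by rewrite neq_ltn lt0.
have newP i j : new i j -> i = i0 /\ j = j0 \/ i = j0 /\ j = i0.
  by case/orP=> /eqP[-> ->]; [left | right].
(* The head differs from all later pairs, and since pairs are increasing its reversal does not occur
   either. *)
have old i j : hadj H i j -> new i j = false.
  move=> hij; apply/negP=> /newP h; have: hadj H i0 j0.
    by case: h hij => -[-> ->] //; rewrite /hadj orbC.
  rewrite /hadj (negPf nH) /= => /(allP ltH) /=.
  by rewrite ltnNge ltnW.
have oldc i j : hadj H i j -> col i j < 5 /\ col i j \notin nth [::] F i /\
    (i = i0 \/ i = j0 -> col i j != c).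
  move=> /cF[? h]; split=> //; move: h; rewrite nthF; case: eqP => [->|n0].
    by rewrite nthF (negPf ij0) inE negb_or => /andP[].
  rewrite nthF; case: eqP => [->|ni]; first by rewrite inE negb_or => /andP[].
  by move=> h; split=> // -[].

exists (fun i j => if new i j then c else col i j); split.
- by move=> i j; rewrite newC cs.
- move=> i j; rewrite hadjE; case: ifP => [/newP h _|_ /= /oldc[? []] //].
  by split=> //; case: h => -[->].
- move=> i j l; rewrite !hadjE => /orP[] h1 /orP[] h2 jl.
  + have [[E1 E2]|[E1 E2]] := newP _ _ h1; have [[E3 E4]|[E3 E4]] := newP _ _ h2.
    - by rewrite E2 E4 eqxx in jl.
    - by rewrite -E1 E3 eqxx in ij0.
    - by rewrite -E1 E3 eqxx in ij0.
    - by rewrite E2 E4 eqxx in jl.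
  + rewrite h1 (old _ _ h2) eq_sym; have [_ [_]] := oldc _ _ h2; apply.
    by case: (newP _ _ h1) => -[-> _]; [left | right].
  + rewrite h2 (old _ _ h1); have [_ [_]] := oldc _ _ h1; apply.
    by case: (newP _ _ h2) => -[-> _]; [left | right].
  by rewrite (old _ _ h1) (old _ _ h2); apply: cp.
Qed.

(** * Reduction of tight instances to the enumerated configurations *)

Section Irreducible.
Variables (V : finType) (a : V -> 'I_5) (E : {set {set V}}) (pc : {set V} -> 'I_5).
Variables (e : rel V) (S : {set V}).
Implicit Types (x y z u v : V).

Definition pre x := [set [set x; y] | y in restr e (fun f => f \in E) x].

Hypotheses (e3 : subcubic_rel e) (ce : compat a E pc e S) (SE4 : #|S| + #|E| <= 4).
Let fr : rel V := free E e.
Hypothesis tight : forall u v, fr u v -> 7 <= (u \in S) + (v \in S) + #|e u| + #|e v|.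
Hypothesis two_free : forall x y, x \in S -> fr x y ->
  0 < #|pre x| \/ 1 < #|[set z in S | fr x z]|.

Lemma preP x f : reflect (exists2 y, e x y & f = [set x; y] /\ f \in E) (f \in pre x).
Proof.
apply: (iffP imsetP) => [[y /andP[exy fE] ->]|[y exy [-> fE]]]; exists y => //.
by rewrite unfold_in /restr exy.
Qed.

Lemma pre_sub x : pre x \subset E.
Proof. by apply/subsetP=> f /preP[y _ []]. Qed.

Lemma card_split x : #|fr x| + #|pre x| = #|e x|.
Proof.
rewrite card_in_imset => [|y z _ _]; last exact: set2_inj.
rewrite -(cardID (fun y => [set x; y] \in E) (e x)) addnC; congr (_ + _).
by apply: eq_card => y; rewrite !inE unfold_in andbC.
Qed.

Let fs : symmetric fr. Proof. by case: (subcubic_restr (fun f => f \notin E) e3). Qed.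
Let fi : irreflexive fr. Proof. by case: (subcubic_restr (fun f => f \notin E) e3). Qed.

Lemma card_split3 x : #|fr x| + #|pre x| <= 3.
Proof. by rewrite card_split; case: e3. Qed.

Let act := [set x | 0 < #|fr x|].
Let A := S :&: act.
Let N := act :\: S.

Let actP x y : fr x y -> x \in act.
Proof. by move=> f; rewrite inE; apply/card_gt0P; exists y. Qed.

(** Tightness at an edge with an end outside [S] leaves no slack: 7 can only be 1 + 3 + 3. *)
Lemma act_nonspecial v : v \in N ->
  3 = #|fr v| + #|pre v| /\ forall u, fr v u -> u \in S.
Proof.
rewrite inE => /andP[vS]; rewrite inE => /card_gt0P[u fvu].
have h w : fr v w -> w \in S /\ 3 <= #|e v|.
  move=> /tight; rewrite (negPf vS); case: e3 => _ _ h3.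
  by have := h3 v; have := h3 w; case: (w \in S); lia.
split; last by move=> w /h[].
by apply/eqP; rewrite eqn_leq card_split3 card_split; case: (h _ fvu) => _ ->.
Qed.

(** If [x] has precoloured edges, at most [3 - #|pre x|] edges are free; if not, at least two of its
    at most three edges lead into [S]. *)
Lemma act_special x : x \in A -> #|[set y in N | fr x y]| <= 1 + #|pre x|.
Proof.
rewrite inE => /andP[xS]; rewrite inE => /card_gt0P[y fxy].
have d : #|[set z in S | fr x z]| + #|[set y in N | fr x y]| <= #|fr x|.
  rewrite -(cardID (mem S) (fr x)); apply: leq_add; apply: subset_leq_card.
    by apply/subsetP=> z; rewrite 2!inE => /andP[zS fz]; apply/andP.
  apply/subsetP=> z; rewrite 3!inE => /andP[/andP[zS _] fz]; exact/andP.
by have := two_free xS fxy; have := card_split3 x; lia.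
Qed.

Lemma sum_pre : \sum_(x : V) #|pre x| <= 2 * #|E|.
Proof.
have -> : \sum_(x : V) #|pre x| = \sum_(f in E) \sum_(x : V) (f \in pre x).
  rewrite exchange_big /=; apply: eq_bigr => x _.
  rewrite -sum1_card big_mkcond [RHS]big_mkcond /=; apply: eq_bigr => f _.
  by case: ifP => h; [rewrite (subsetP (pre_sub x) _ h) | case: ifP].
rewrite mulnC -sum_nat_const; apply: leq_sum => f _.
have [->|[x0 fx0]] : \sum_(x : V) (f \in pre x) = 0 \/ exists x, f \in pre x.
- have [/existsP[x h]|/existsPn h] := boolP [exists x, f \in pre x].
    by right; exists x.
  by left; rewrite big1 // => x _; rewrite (negPf (h x)).
- by [].
have /preP[y _ [fE _]] := fx0.
rewrite -big_mkcond /= sum1dep_card.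
apply: leq_trans (_ : #|[set x0; y]| <= 2); last by rewrite cards2; case: (_ != _).
apply: subset_leq_card; apply/subsetP=> x; rewrite -fE inE => /preP[z _ [-> _]].
by rewrite !inE eqxx.
Qed.

(** Each vertex of [N] has three edges. The free ones all lead to [A] and are counted from there by
    [act_special]; the precoloured ones, at [A] and at [N] together, are counted at most twice
    each. *)
Lemma card_nonspecial : 3 * #|N| <= #|A| + 2 * #|E|.
Proof.
have cnt : \sum_(v in N) #|fr v| = \sum_(x in A) #|[set y in N | fr x y]|.
  rewrite [RHS](eq_bigr (fun x => \sum_(v in N) (fr v x : nat))); last first.
    move=> x _; rewrite -sum1dep_card [LHS]big_mkcondr.
    by apply: eq_bigr => v _; rewrite fs; case: (fr v x).
  rewrite exchange_big /=; apply: eq_bigr => v vN.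
  rewrite -sum1_card [RHS]big_mkcond [LHS]big_mkcond /=; apply: eq_bigr => x _.
  rewrite -[x \in fr v]/(fr v x); case: (boolP (fr v x)) => fvx; last by case: ifP.
  by rewrite inE (actP (_ : fr x v)) 1?fs // (proj2 (act_nonspecial vN)).
have : \sum_(v in N) 3 = \sum_(v in N) #|fr v| + \sum_(v in N) #|pre v|.
  by rewrite -big_split; apply: eq_bigr => v /act_nonspecial[].
rewrite sum_nat_const mulnC cnt => ->.
apply: leq_trans (_ : \sum_(x in A) (1 + #|pre x|) + \sum_(v in N) #|pre v| <= _).
  by rewrite leq_add2r; apply: leq_sum => x; apply: act_special.
rewrite big_split /= sum1_card -addnA leq_add2l.
apply: leq_trans sum_pre; rewrite [leqRHS](bigID (mem S)) /= leq_add //.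
  rewrite [leqLHS]big_mkcond [leqRHS]big_mkcond /=; apply: leq_sum => x _.
  by rewrite !inE; case: (x \in S) => //=; case: ifP.
rewrite [leqLHS]big_mkcond [leqRHS]big_mkcond /=; apply: leq_sum => x _.
by rewrite !inE; case: (x \in S) => //=; case: ifP.
Qed.

Lemma card_A4 : #|A| + #|E| <= 4.
Proof. by apply: leq_trans SE4; rewrite leq_add2r subset_leq_card // subsetIl. Qed.

Variable x0 : V.
(** Listing [A] before [N] makes the constrained vertices exactly the indices below [k], as the
    encoding expects. *)
Let s := enum A ++ enum N.
Let w := nth x0 s.
Let k := #|A|.

Let sz5 : size s <= 5.
Proof.
rewrite size_cat -!cardE; have := card_nonspecial; have := card_A4.
by move: #|A| #|N| #|E|; clear; lia.
Qed.

Let k4 : k <= 4. Proof. exact: leq_trans (leq_addr _ _) card_A4. Qed.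

Let mem_s x : (x \in s) = (x \in act).
Proof. by rewrite mem_cat !mem_enum !inE -andb_orl orbN. Qed.

Let uniq_s : uniq s.
Proof.
rewrite cat_uniq !enum_uniq andbT /=; apply/hasPn=> x.
by rewrite !mem_enum !inE => /andP[/negPf->].
Qed.

Let w_act i : i < size s -> w i \in act.
Proof. by move=> h; rewrite -mem_s mem_nth. Qed.

Let w_S i : i < size s -> (w i \in S) = (i < k).
Proof.
move=> h; rewrite /w nth_cat -cardE -/k; case: ltnP => ik.
  have : nth x0 (enum A) i \in A by rewrite -mem_enum mem_nth // -cardE.
  by rewrite inE => /andP[].
apply/negbTE; have : nth x0 (enum N) (i - k) \in N.
  rewrite -mem_enum mem_nth // -cardE ltn_subLR //.
  by move: h; rewrite size_cat -!cardE.
by rewrite inE => /andP[].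
Qed.

Let f i j := [&& i < size s, j < size s & fr (w i) (w j)].
Let H := [seq ij <- pairs k | f ij.1 ij.2].

Lemma mem_pairs i j : ((i, j) \in pairs k) = [&& i < k, i < j & j < 5].
Proof.
apply/allpairsPdep/and3P=> [[i' [j' []]]|[ik ij j5]].
  rewrite !mem_iota => /andP[_ ik] /andP[ij j5] [-> ->]; split=> //.
  by move: k4 ik j5; clear; lia.
exists i, j; split; rewrite // !mem_iota //=.
by move: k4 ik ij j5; clear; lia.
Qed.

Let fC i j : f i j = f j i.
Proof. by rewrite /f fs andbCA. Qed.

Lemma hadj_H i j : hadj H i j = f i j.
Proof.
rewrite /hadj !mem_filter /= !mem_pairs [f j i]fC -andb_orr.
have [/and3P[hi hj fij]|//] := boolP (f i j); rewrite /=.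
(* If both indices were at least [k], tightness would require 7 <= 3 + 3, so the smaller index is
   below [k]. *)
have := tight fij; rewrite !w_S //; case: e3 => _ _ h3.
have := h3 (w i); have := h3 (w j); move: (leq_trans hi sz5) (leq_trans hj sz5).
have : i != j by apply: contraTneq fij => ->; rewrite fi.
by move: #|_| #|_| k; clear; lia.
Qed.

Let map_w n : n <= size s -> map w (iota 0 n) = take n s.
Proof.
move=> h; have <- : mkseq w (size s) = s by apply: mkseq_nth.
by rewrite -map_take take_iota (minn_idPl h).
Qed.

Let count_f n i : n <= size s -> i < size s ->
  count (f i) (iota 0 n) = count (fr (w i)) (take n s).
Proof.
move=> h hi; rewrite -map_w // count_map; apply: eq_in_count => j.
by rewrite mem_iota /f hi /= => hj; rewrite (leq_trans hj h).
Qed.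

Lemma hdeg5 i : hdeg 5 H i = if i < size s then #|fr (w i)| else 0.
Proof.
rewrite /hdeg (eq_count (hadj_H i)); case: ifP => hi; last first.
  by rewrite (eq_count (a2 := pred0)) ?count_pred0 // => j; rewrite /f hi.
rewrite -(subnKC sz5) iotaD count_cat.
rewrite (@eq_in_count _ _ pred0 (iota (0 + _) _)) ?count_pred0 ?addn0; last first.
  by move=> j; rewrite mem_iota /f add0n => /andP[h _]; rewrite hi ltnNge h.
rewrite count_f // take_size -size_filter.
have /card_uniqP<- : uniq (filter (fr (w i)) s) by rewrite filter_uniq.
apply: eq_card => y; rewrite mem_filter mem_s andb_idr // fs; exact: actP.
Qed.

Lemma hdegk i : i < size s -> hdeg k H i = #|[set z in S | fr (w i) z]|.
Proof.
move=> hi; rewrite /hdeg (eq_count (hadj_H i)) count_f //; last first.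
  by rewrite size_cat -cardE leq_addr.
rewrite take_cat -cardE ltnn subnn take0 cats0 -size_filter.
have /card_uniqP<- : uniq (filter (fr (w i)) (enum A)) by rewrite filter_uniq ?enum_uniq.
apply: eq_card => y; rewrite mem_filter mem_enum !inE.
case: (boolP (fr _ _)); rewrite ?andbF //= => fy; rewrite andbT -[0 < _](in_set (fun x => 0 < #|fr x|)) andb_idr // => _.
by apply: (@actP _ (w i)); rewrite fs.
Qed.

Let Pe i := if i < size s then pre (w i) else set0.
Let P := [seq #|Pe i| | i <- iota 0 5].

Let nthP i : i < 5 -> nth 0 P i = #|Pe i|.
Proof. by move=> h; rewrite (nth_map 0) ?size_iota // nth_iota. Qed.

Lemma card_Pe i : #|Pe i| <= minn 2 (4 - k).
Proof.
rewrite /Pe; case: ifP => h; last by rewrite cards0.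
rewrite leq_min; apply/andP; split.
  by have := w_act h; rewrite inE; have := card_split3 (w i); lia.
have := subset_leq_card (pre_sub (w i)); have := card_A4.
by rewrite /k; move: #|A| #|E| #|pre _|; clear; lia.
Qed.

(** A precoloured edge at both vertices is the edge joining them; so there is only one, and the
    vertices are not joined by a free edge. *)
Lemma PeI i j : i != j ->
  #|Pe i :&: Pe j| <= [&& 0 < #|Pe i|, 0 < #|Pe j| & ~~ hadj H i j].
Proof.
move=> ij; have [->|[g]] := set_0Vmem (Pe i :&: Pe j); first by rewrite cards0.
rewrite inE => /andP[gi gj].
have -> : 0 < #|Pe i| by apply/card_gt0P; exists g.
have -> : 0 < #|Pe j| by apply/card_gt0P; exists g.
move: gi gj; rewrite /Pe; case: ifP => hi; last by rewrite inE.
case: ifP => hj; last by rewrite inE.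
have wij : w i != w j by rewrite nth_uniq.
have key h : h \in pre (w i) :&: pre (w j) -> h = [set w i; w j] /\ h \in E.
  rewrite inE => /andP[/preP[y _ [-> hE]] /preP[z _ [E' _]]]; split=> //.
  case/set2_cases: E' => -[E1 E2]; first by rewrite E1 eqxx in wij.
  by rewrite E2.
move=> gi gj; have /key[gE gg] : g \in pre (w i) :&: pre (w j) by rewrite inE gi.
rewrite hadj_H /f hi hj /= /fr /free /restr -gE gg andbF /=.
rewrite -(cards1 [set w i; w j]); apply: subset_leq_card; apply/subsetP=> h /key[-> _].
by rewrite inE.
Qed.

Lemma irreducible_H : irreducible k H (degs H) P.
Proof.
have degE i : i < 5 -> nth 0 (degs H) i = if i < size s then #|fr (w i)| else 0.
  by move=> i5; rewrite (nth_map 0) ?size_iota // nth_iota // hdeg5.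
rewrite /irreducible; case: ifP => [_|/negP[]]; last first.
  apply/allP=> i; rewrite mem_iota add0n => i5; rewrite degE // nthP // /Pe.
  case: ifP => h; last by rewrite cards0.
  have := w_act h; rewrite inE; have := card_split3 (w i).
  by case: (#|fr (w i)|).
case: ifP => [_|/negP[]]; last first.
  apply/allP=> -[i j]; rewrite mem_filter /= => /andP[/and3P[hi hj fij] _].
  have i5 := leq_trans hi sz5; have j5 := leq_trans hj sz5.
  rewrite !degE // !nthP // /Pe hi hj !card_split -!w_S //.
  exact: tight.
case: ifP => [_|/negP[]]; last first.
  apply/allP=> i; rewrite mem_iota add0n => ik.
  have hi : i < size s by rewrite size_cat -cardE ltn_addr.
  have i5 := leq_trans hi sz5; rewrite degE // nthP // /Pe hi hdegk //.
  case E1: #|fr (w i)| => //; case E2: #|pre (w i)| => //.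
  have /card_gt0P[y fy] : 0 < #|fr (w i)| by rewrite E1.
  by have [||//] := two_free _ fy; rewrite ?E2 // w_S.
apply/allP=> i; rewrite mem_iota add0n => /= i5.
apply/allP=> j; rewrite mem_iota => /andP[ij j5].
apply/allP=> l; rewrite mem_iota => /andP[jl l5].
have {}j5 : j < 5 by move: i5 j5; clear; lia.
have {}l5 : l < 5 by move: j5 l5; clear; lia.
rewrite !nthP //.
have il : i != l by rewrite neq_ltn (ltn_trans ij jl).
have := PeI (negbT (ltn_eqF ij)); have := PeI (negbT (ltn_eqF jl)); have := PeI il.
move: (nat_of_bool _) (nat_of_bool _) (nat_of_bool _) => b1 b2 b3.
(* Inclusion-exclusion for three subsets of [E], with pairwise intersections bounded by [PeI]. *)
have sub : (Pe i :|: Pe j) :|: Pe l \subset E.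
  have h i' : Pe i' \subset E by rewrite /Pe; case: ifP => _; [apply: pre_sub | apply: sub0set].
  by rewrite !subUset !h.
have := subset_leq_card sub.
have := cardsUI (Pe i) (Pe j); have := cardsUI (Pe i :|: Pe j) (Pe l).
rewrite setIUl; have := cardsUI (Pe i :&: Pe l) (Pe j :&: Pe l).
have := card_A4; rewrite -/k.
move: #|Pe i| #|Pe j| #|Pe l| #|E| #|_| #|_| #|_| #|_| #|_| #|_| #|_| k4; move: k.
clear; lia.
Qed.

Let B i : {set 'I_5} := if i < size s then forb a S (w i) :|: pc @: Pe i else set0.
Let F := [seq [seq val c | c <- enum (B i)] | i <- iota 0 5].

(** An exact size is required, since [forb_lists] enumerates lists of one size for each vertex. It
    holds because [compat] makes all colours prescribed at a vertex distinct. *)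
Lemma card_B i : #|B i| = (i < k) + nth 0 P i.
Proof.
have [hi|hi] := ltnP i (size s); last first.
  rewrite /B ltnNge hi /= cards0 ltnNge (leq_trans _ hi) ?size_cat -?cardE ?leq_addr //=.
  have [h|h] := ltnP i 5; last by rewrite nth_default // size_map size_iota.
  by rewrite nthP // /Pe ltnNge hi cards0.
have i5 := leq_trans hi sz5; rewrite /B hi nthP // cardsU card_forb w_S //.
rewrite /Pe hi card_in_imset; last first.
  move=> g h /preP[y ey [-> yE]] /preP[z ez [-> zE]] pcE.
  have [->//|yz] := eqVneq y z.
  by case: ce => c1 _; have := c1 _ _ _ ey ez yz yE zE; rewrite pcE eqxx.
suff -> : forb a S (w i) :&: pc @: pre (w i) = set0 by rewrite cards0 subn0.
apply/eqP; rewrite setI_eq0 disjoints_subset; apply/subsetP=> c.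
rewrite /forb; case: ifP => [wS|]; last by rewrite inE.
rewrite !inE => /eqP->; apply/imsetP=> -[g /preP[y ey [-> yE]] E'].
by case: ce => _ c2; have := c2 _ _ ey wS yE; rewrite E' eqxx.
Qed.

Lemma F_ok : F \in forb_lists k P.
Proof.
apply: lists_map => i _; rewrite mem_filter size_map -cardE card_B eqxx andTb.
apply: subseqsP; rewrite -val_enum_ord map_subseq //.
by rewrite {1}/enum_mem -enumT filter_subseq.
Qed.

Lemma H_colourable : colourable F H.
Proof.
have kin : k \in iota 0 5 by rewrite mem_iota ltnS.
have Hin : H \in subseqs (pairs k) by apply: subseqsP; apply: filter_subseq.
have Pin : P \in lists (nseq 5 (iota 0 (minn 2 (4 - k)).+1)).
  rewrite -[nseq _ _]/(map (fun=> iota 0 (minn 2 (4 - k)).+1) (iota 0 5)).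
  by apply: lists_map => i _; rewrite mem_iota add0n ltnS card_Pe.
have := allP (allP (allP irreducible_colourable_true k kin) H Hin) P Pin.
by rewrite irreducible_H => /allP; apply; apply: F_ok.
Qed.

Lemma irreducible_ext : exists phi, good a E pc e S phi.
Proof.
have uH : uniq H.
  rewrite filter_uniq //; apply: allpairs_uniq_dep; rewrite ?iota_uniq //.
    by move=> i _; rewrite iota_uniq.
  by move=> [i j] [i' j'] _ _ /= [-> ->].
have ltH : all (fun ij => ij.1 < ij.2) H.
  by apply/allP=> -[i j]; rewrite mem_filter mem_pairs => /and4P[].
have [col [cC cF cN]] := colourableP uH ltH H_colourable.
pose ix x := index x s.
have ixP x y : fr x y -> ix x < size s /\ w (ix x) = x.
  by move=> /actP; rewrite -mem_s => h; rewrite /ix /w nth_index // index_mem.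
have hadjP x y : fr x y -> hadj H (ix x) (ix y).
  move=> fxy; have [h1 h2] := ixP _ _ fxy.
  have [h3 h4] : ix y < size s /\ w (ix y) = y by apply: (ixP y x); rewrite fs.
  by rewrite hadj_H /f h1 h3 h2 h4.
(* The [pick] orients an unordered edge arbitrarily, which is harmless because [col] is
   symmetric. *)
pose phi g := if [pick q : V * V | fr q.1 q.2 && (g == [set q.1; q.2])] is Some q
              then inord (col (ix q.1) (ix q.2)) else pc g.
have phi_fr x y : fr x y -> phi [set x; y] = col (ix x) (ix y) :> nat.
  move=> fxy; have [c5 _] := cF _ _ (hadjP _ _ fxy).
  rewrite /phi; case: pickP => [[u v] /= /andP[_ /eqP/set2_cases]|/(_ (x, y))].
    by case=> -[<- <-]; rewrite ?[col (ix y) _]cC inordK.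
  by rewrite /= fxy eqxx.
have phi_E x y : [set x; y] \in E -> phi [set x; y] = pc [set x; y].
  move=> xyE; rewrite /phi; case: pickP => // -[u v] /= /andP[/andP[_ nE] /eqP uvE].
  by rewrite uvE (negPf nE) in xyE.
have phi_B x y c : fr x y -> c \in B (ix x) -> phi [set x; y] != c.
  move=> fxy cB; have [hx _] := ixP _ _ fxy; have x5 := leq_trans hx sz5.
  have [_] := cF _ _ (hadjP _ _ fxy).
  rewrite (nth_map 0) ?size_iota // nth_iota // add0n => h.
  by apply: contraNneq h => h; rewrite -phi_fr // h map_f // mem_enum.
have BE x y : fr x y -> B (ix x) = forb a S x :|: pc @: pre x.
  by move=> /ixP[h1 h2]; rewrite /B /Pe h1 h2.
case: ce => c1 c2; exists phi; split.
- move=> x y z exy exz yz.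
  have one u v : e x u -> e x v -> [set x; u] \notin E -> [set x; v] \in E ->
      phi [set x; u] != phi [set x; v].
    move=> exu exv uE vE; have fxu : fr x u by rewrite /fr /free /restr exu.
    rewrite [phi [set x; v]]phi_E // phi_B // (BE _ _ fxu) inE; apply/orP; right.
    by apply: imset_f; apply/preP; exists v.
  have [yE|yE] := boolP ([set x; y] \in E); have [zE|zE] := boolP ([set x; z] \in E).
  + by rewrite !phi_E // c1.
  + by rewrite eq_sym one.
  + by rewrite one.
  have fxy : fr x y by rewrite /fr /free /restr exy.
  have fxz : fr x z by rewrite /fr /free /restr exz.
  rewrite -(inj_eq val_inj) /= !phi_fr // cN ?hadjP //.
  apply: contraNneq yz => /(congr1 w).
  have [_ ->] : ix y < size s /\ w (ix y) = y by apply: (ixP y x); rewrite fs.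
  have [_ ->] : ix z < size s /\ w (ix z) = z by apply: (ixP z x); rewrite fs.
  by move=> ->.
- move=> x y exy xS; have [yE|yE] := boolP ([set x; y] \in E).
    by rewrite phi_E // c2.
  have fxy : fr x y by rewrite /fr /free /restr exy.
  by rewrite phi_B // (BE _ _ fxy) /forb xS !inE eqxx.
- by move=> x y _; apply: phi_E.
Qed.

End Irreducible.

(** * At most four prescriptions on a single graph *)

Lemma card3P (V : finType) (A : pred V) : #|A| = 3 ->
  exists x y z, [/\ x != y, x != z & y != z] /\ forall v, A v = [|| v == x, v == y | v == z].
Proof.
rewrite cardE; case E : (enum A) (enum_uniq A) => [|x [|y [|z [|//]]]] //=.
rewrite !inE !negb_or !andbT => /andP[/andP[xy xz] yz] _.
exists x, y, z; split=> // v.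
by rewrite -[A v]/(v \in A) -mem_enum E !inE.
Qed.

(** Induction on the number of free edges. Two reductions lower it: deleting an edge with slack in
    [good_add], and removing a vertex of [S] that has a free edge, no precoloured edge and at most
    one free neighbour in [S]. When neither applies, the hypotheses of [irreducible_ext] hold. *)
Lemma extend_mixed (V : finType) (a : V -> 'I_5) (E : {set {set V}}) (pc : {set V} -> 'I_5)
    (e : rel V) (S : {set V}) :
  subcubic_rel e -> compat a E pc e S -> #|S| + #|E| <= 4 -> exists phi, good a E pc e S phi.
Proof.
have T5 : #|'I_5| = 5 by rewrite card_ord.
have [n] := ubnP (nedges (free E e)); elim: n e S => // n IH e S ltn e3 ce SE4.
have [es ei h3] := e3.
have lt_free e' u v : subrel e' e -> free E e u v -> ~~ e' u v -> nedges (free E e') < n.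
  by move=> s f nf; rewrite -ltnS; apply: leq_trans ltn; rewrite ltnS; apply: free_sub s f nf.
have [/existsP[x0 /existsP[y0 fxy0]]|nf] := boolP [exists u, exists v, free E e u v]; last first.
  exists pc; apply: good_all => // x y; apply: contraNN nf => fxy.
  by apply/existsP; exists x; apply/existsP; exists y.
have [/existsP[u /existsP[v /andP[fuv slack]]]|nslack] := boolP [exists u, exists v,
    free E e u v && ((u \in S) + (v \in S) + #|e u| + #|e v| <= 6)].
  have dsub := @del_sub V e u v.
  have [||phi gphi] := IH (del e u v) S _ (subcubic_restr _ e3) _ SE4.
  - by apply: lt_free dsub fuv _; rewrite del_edge eqxx andbF.
  - exact: compat_sub dsub (subxx _) ce.
  exact (good_add T5 e3 fuv slack gphi).
have tight u v : free E e u v -> 7 <= (u \in S) + (v \in S) + #|e u| + #|e v|.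
  move=> fuv; rewrite ltnNge; apply: contraNN nslack => h.
  by apply/existsP; exists u; apply/existsP; exists v; rewrite fuv.
have [/existsP[x /existsP[y /and4P[xS fxy /eqP px sx]]]|nk] := boolP [exists x, exists y,
    [&& x \in S, free E e x y, #|pre E e x| == 0 & #|[set z in S | free E e x z]| <= 1]]; last first.
  apply: (irreducible_ext e3 ce SE4 tight _ x0) => x y xS fxy.
  have [|px] := posnP #|pre E e x|; last by left.
  move=> px; right; rewrite ltnNge; apply: contraNN nk => sx.
  by apply/existsP; exists x; apply/existsP; exists y; rewrite xS fxy px eqxx.
have nE z : e x z -> [set x; z] \notin E.
  move=> exz; apply/negP=> zE; have : [set x; z] \in pre E e x by apply/preP; exists z.
  by rewrite (cards0_eq px) inE.
have fE z : e x z -> free E e x z by move=> exz; rewrite /free /restr exz nE.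
have sx1 z z' : e x z -> e x z' -> z \in S -> z' \in S -> z = z'.
  move=> exz exz' zS z'S; apply/eqP; apply: contraTT sx => zz'.
  by rewrite -ltnNge; apply/card_gt1P; exists z, z'; split; rewrite // inE ?zS ?z'S fE.
(* A neighbour outside [S] forces degree 3 by tightness. If there is none, [x] has a single
   neighbour, which is in [S], and tightness fails with at most 2 + 1 + 3. *)
have dx : #|e x| = 3.
  have nS z : e x z -> z \notin S -> #|e x| = 3.
    move=> exz zS; have := tight _ _ (fE _ exz); have := h3 x; have := h3 z.
    by rewrite xS (negPf zS); move: #|_| #|_|; clear; lia.
  have exy : e x y by case/andP: fxy.
  have [yS|yS] := boolP (y \in S); last exact: nS yS.
  have [/card_gt1P[z [z' [exz exz' zz']]]|le1] := ltnP 1 #|e x|.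
    have [zS|zS] := boolP (z \in S); last exact: nS zS.
    by apply: (nS z' exz'); apply: contraNN zz' => z'S; rewrite (sx1 z z').
  have := tight _ _ fxy; have := h3 y; rewrite xS yS; move: le1; move: #|_| #|_|; clear; lia.
have [y1 [y2 [y3 [[y12 y13 y23] nb]]]] := card3P dx.
have [phi gphi] : exists phi, good a E pc (restr e (fun f => x \notin f)) (S :\ x) phi.
  have rs : subrel (restr e (fun f => x \notin f)) e by move=> u v /andP[].
  apply: IH; last 3 first.
  - exact: subcubic_restr.
  - by apply: compat_sub rs _ ce; apply: subsetDl.
  - by apply: leq_trans SE4; rewrite leq_add2r subset_leq_card // subsetDl.
  by apply: lt_free rs fxy _; rewrite /restr !inE eqxx andbF.
have key z1 z2 z3 : [/\ z1 != z2, z1 != z3 & z2 != z3] ->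
    (forall v, e x v = [|| v == z1, v == z2 | v == z3]) -> z1 \notin S -> z2 \notin S ->
    exists phi, good a E pc e S phi.
  move=> d nbz z1S z2S; apply: (kempe_star T5 e3 xS nE SE4 d _ _ z1S z2S).
  - by split; rewrite nbz eqxx ?orbT.
  - by move=> v; rewrite nbz.
  - by exists phi.
have e1 : e x y1 by rewrite nb eqxx.
have e2 : e x y2 by rewrite nb eqxx orbT.
have e4 : e x y3 by rewrite nb eqxx !orbT.
have [y1S|y1S] := boolP (y1 \in S).
  apply: (key y2 y3 y1); first by rewrite y23 ![_ == y1]eq_sym.
  - by move=> v; rewrite nb orbC orbA.
  - by apply: contraNN y12 => h; rewrite (sx1 y1 y2).
  - by apply: contraNN y13 => h; rewrite (sx1 y1 y3).
have [y2S|y2S] := boolP (y2 \in S); last exact: (key y1 y2 y3).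
apply: (key y1 y3 y2) => //; first by rewrite y13 y12 eq_sym.
  by move=> v; rewrite nb [X in _ || X]orbC.
by apply: contraNN y23 => h; rewrite (sx1 y2 y3).
Qed.

(** * Colouring two copies of a graph *)

Section Copies.
Variables (V : finType) (e : rel V) (a : V -> 'I_5) (S : {set V}).
Hypothesis e3 : subcubic_rel e.
Implicit Types (F : {set {set V}}) (c phi : {set V} -> 'I_5).

(** A precoloured rung at [x] takes [a x], which [good] keeps off both copies; every other rung
    takes the common spare colour [b]. *)
Definition solution F0 c0 F1 c1 := exists phi0 phi1,
  [/\ good a F0 c0 e S phi0, good a F1 c1 e S phi1 &
   forall x, x \notin S -> exists b, b \notin used e phi0 x /\ b \notin used e phi1 x].

Definition on_edges F := forall f, f \in F -> exists x y, e x y /\ f = [set x; y].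

Lemma solution_sym F0 c0 F1 c1 : solution F0 c0 F1 c1 -> solution F1 c1 F0 c0.
Proof.
move=> [phi0 [phi1 [g0 g1 h]]]; exists phi1, phi0; split=> // x /h[b [b0 b1]].
by exists b.
Qed.

Lemma spare (A B : {set 'I_5}) : #|A :|: B| <= 4 -> exists b, b \notin A /\ b \notin B.
Proof.
move=> h; have [|b _] := @avoid _ [set: 'I_5] (A :|: B).
  by rewrite cardsT card_ord ltnS.
by rewrite inE negb_or => /andP[]; exists b.
Qed.

Lemma perm_proper phi (s : {perm 'I_5}) : proper_col e phi -> proper_col e (s \o phi).
Proof. by move=> p x y z exy exz yz; rewrite /= (inj_eq perm_inj); apply: p. Qed.

Lemma perm_used phi (s : {perm 'I_5}) x : used e (s \o phi) x = s @: used e phi x.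
Proof.
apply/setP=> k; apply/usedP/imsetP=> [[y exy ->]|[_ /usedP[y exy ->] ->]].
  by exists (phi [set x; y]); rewrite ?mem_used.
by exists y.
Qed.

Lemma card_used3 phi x : #|used e phi x| <= 3.
Proof. by apply: leq_trans (card_used _ _ _) _; case: e3. Qed.

(** A transposition adds at most one element to [A]: [p] if [p] is not in [A], and [q] otherwise. *)
Lemma twist_spare (A : {set 'I_5}) p q : #|A| <= 3 -> #|A :|: tperm p q @: A| <= 4.
Proof.
move=> A3; have [pA|pA] := boolP (p \in A); last first.
  apply: leq_trans (_ : #|p |: A| <= 4); last by rewrite cardsU1 pA.
  apply: subset_leq_card; rewrite subUset subsetUr /=.
  apply/subsetP=> k /imsetP[l lA ->]; case: tpermP => [E|_|_ _]; rewrite !inE ?eqxx ?lA ?orbT //.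
  by rewrite -E lA in pA.
apply: leq_trans (_ : #|q |: A| <= 4); last by rewrite cardsU1; case: (q \in A); rewrite // ltnW.
apply: subset_leq_card; rewrite subUset subsetUr /=.
by apply/subsetP=> k /imsetP[l lA ->]; case: tpermP => [E|_|_ _]; rewrite !inE ?eqxx ?lA ?pA ?orbT.
Qed.

Lemma twist_solution F0 c0 F1 c1 p q phi : proper_col e phi ->
  (forall x y, e x y -> [set x; y] \in F0 -> phi [set x; y] = c0 [set x; y]) ->
  (forall x y, e x y -> [set x; y] \in F1 -> tperm p q (phi [set x; y]) = c1 [set x; y]) ->
  (forall x, x \in S -> a x \notin used e phi x /\ tperm p q (a x) \notin used e phi x) ->
  solution F0 c0 F1 c1.
Proof.
move=> pp h0 h1 hS; exists phi, (tperm p q \o phi); split.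
- split=> // x y exy xS; have [h _] := hS _ xS.
  by apply: contraNneq h => <-; apply: mem_used.
- split=> //; first exact: perm_proper.
  move=> x y exy xS; have [_ h] := hS _ xS.
  by apply: contraNneq h => <-; rewrite tpermK; apply: mem_used.
- by move=> x _; apply: spare; rewrite perm_used twist_spare // card_used3.
Qed.

(** Pulling the second precolouring back along the transposition merges both into one precolouring
    [pc] of the base graph, to which [extend_mixed] applies. The last three hypotheses say that
    missing colours are fixed, shared edges agree and no clash arises. *)
Lemma twist F0 c0 F1 c1 p q :
  compat a F0 c0 e S -> compat a F1 c1 e S -> #|S| + #|F0| + #|F1| <= 4 ->
  (forall x, x \in S -> tperm p q (a x) = a x) ->
  (forall f, f \in F0 -> f \in F1 -> tperm p q (c0 f) = c1 f) ->
  (forall x y z, e x y -> e x z -> y != z -> [set x; y] \in F0 -> [set x; z] \in F1 ->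
     [set x; z] \notin F0 -> c0 [set x; y] != tperm p q (c1 [set x; z])) ->
  solution F0 c0 F1 c1.
Proof.
move=> [k0 l0] [k1 l1] F4 hS hd ha.
pose pc f := if f \in F0 then c0 f else tperm p q (c1 f).
have [phi [p1 p2 p3]] : exists phi, good a (F0 :|: F1) pc e S phi.
  apply: extend_mixed => //; last first.
    apply: leq_trans F4; rewrite -addnA leq_add2l.
    exact: leq_of_leqif (leq_card_setU _ _).
  split=> [x y z exy exz yz|x y exy xS]; rewrite /pc.
    rewrite !inE; have [yF|yF] := boolP (_ \in F0); have [zF|zF] := boolP (_ \in F0) => //=.
    - by move=> _ _; apply: k0.
    - by move=> _ h; apply: ha.
    - by move=> h _; rewrite eq_sym; apply: ha; rewrite // eq_sym.
    by move=> h h'; rewrite (inj_eq perm_inj); apply: k1.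
  rewrite !inE; case: (boolP (_ \in F0)) => [yF _|yF /= h]; first exact: l0.
  by rewrite -(hS _ xS) (inj_eq perm_inj); apply: l1.
apply: (@twist_solution _ _ _ _ p q phi p1).
- by move=> x y exy yF; rewrite p3 // ?inE ?yF // /pc yF.
- move=> x y exy yF; rewrite p3 // ?inE ?yF ?orbT // /pc.
  by case: ifP => h; [apply: hd | rewrite tpermK].
- move=> x xS; rewrite hS //; split; apply/negP=> /usedP[y exy E];
    by have := p2 _ _ exy xS; rewrite E eqxx.
Qed.

Lemma twist1 F0 c0 F1 c1 :
  compat a F0 c0 e S -> compat a F1 c1 e S -> #|S| + #|F0| + #|F1| <= 4 ->
  (forall f, f \in F0 -> f \in F1 -> c0 f = c1 f) ->
  (forall x y z, e x y -> e x z -> y != z -> [set x; y] \in F0 -> [set x; z] \in F1 ->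
     [set x; z] \notin F0 -> c0 [set x; y] != c1 [set x; z]) ->
  solution F0 c0 F1 c1.
Proof.
move=> k0 k1 F4 hd ha; apply: (@twist _ _ _ _ ord0 ord0) => //.
- by move=> x _; rewrite tperm1 perm1.
- by move=> f; rewrite tperm1 perm1; apply: hd.
- by move=> x y z; rewrite tperm1 perm1; apply: ha.
Qed.

Definition paint (mu : 'I_5) F c phi (f : {set V}) :=
  if (f \in F) && (c f == mu) then mu else phi f.

Lemma paint_good mu F c phi : compat a F c e S -> proper_col e phi ->
  ranges e phi [set~ mu] ->
  (forall x y, e x y -> [set x; y] \in F -> c [set x; y] != mu ->
     phi [set x; y] = c [set x; y]) ->
  (forall x, x \in S -> a x != mu -> a x \notin used e phi x) ->
  good a F c e S (paint mu F c phi).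
Proof.
move=> [c1 c2] p r hF hS.
have rn x y : e x y -> phi [set x; y] != mu by move/r; rewrite !inE.
split.
- move=> x y z exy exz yz; rewrite /paint.
  case: ifP => [/andP[yF /eqP yE]|_]; case: ifP => [/andP[zF /eqP zE]|_].
  + by have := c1 _ _ _ exy exz yz yF zF; rewrite yE zE eqxx.
  + by rewrite eq_sym rn.
  + by rewrite rn.
  exact: p.
- move=> x y exy xS; rewrite /paint; case: ifP => [/andP[yF /eqP <-]|_]; first exact: c2.
  have [->|n] := eqVneq (a x) mu; first exact: rn.
  by apply: contraNneq (hS _ xS n) => <-; apply: mem_used.
- move=> x y exy yF; rewrite /paint yF; case: eqP => //= /eqP n; exact: hF.
Qed.

Lemma paint_used mu F c phi x : used e (paint mu F c phi) x \subset mu |: used e phi x.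
Proof.
apply/subsetP=> k /usedP[y exy ->]; rewrite /paint.
by case: ifP; rewrite !inE ?eqxx ?mem_used ?orbT.
Qed.

(** Both copies use only [phi] and [mu], hence at most 3 + 1 colours at a vertex. By [compat], edges
    painted [mu] do not meet each other, nor a vertex that must miss [mu]. *)
Lemma paint_solution mu F0 c0 F1 c1 phi :
  compat a F0 c0 e S -> compat a F1 c1 e S -> proper_col e phi -> ranges e phi [set~ mu] ->
  (forall x y, e x y -> [set x; y] \in F0 -> c0 [set x; y] != mu ->
     phi [set x; y] = c0 [set x; y]) ->
  (forall x y, e x y -> [set x; y] \in F1 -> c1 [set x; y] != mu ->
     phi [set x; y] = c1 [set x; y]) ->
  (forall x, x \in S -> a x != mu -> a x \notin used e phi x) ->
  solution F0 c0 F1 c1.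
Proof.
move=> k0 k1 p r h0 h1 hS; exists (paint mu F0 c0 phi), (paint mu F1 c1 phi); split.
- exact: paint_good.
- exact: paint_good.
move=> x _; apply: spare; apply: leq_trans (_ : #|mu |: used e phi x| <= 4).
  by apply: subset_leq_card; rewrite subUset !paint_used.
by rewrite cardsU1; have := card_used3 phi x; case: (_ \notin _) => // /leqW.
Qed.

Lemma perm_ranges mu phi (s : {perm 'I_5}) : s mu = mu ->
  ranges e phi [set~ mu] -> ranges e (s \o phi) [set~ mu].
Proof. by move=> sm r x y /r; rewrite !inE -{2}sm /= (inj_eq perm_inj). Qed.

Lemma card_but (mu : 'I_5) : #|[set~ mu]| = 4.
Proof. by rewrite cardsC1 card_ord. Qed.

(** [vizing2] separates the colours of [f] and [g]; two transpositions fixing [mu] then rename them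
    to [k] and [l]. *)
Lemma two_named mu f g k l : on_edges [set f; g] -> f != g -> k != mu -> l != mu ->
  k != l -> exists phi, [/\ proper_col e phi, ranges e phi [set~ mu], phi f = k & phi g = l].
Proof.
move=> oE fg km lm kl.
have [x [y [exy fE]]] := oE f (setU11 _ _).
have [u [v [euv gE]]] := oE g (setU1r f (set11 g)).
have [||phi [p r n]] := @vizing2 _ _ _ [set~ mu] x y u v e3 _ exy euv.
- by rewrite card_but.
- by rewrite -fE -gE.
rewrite -fE -gE in n.
have fm : phi f != mu by have := r _ _ exy; rewrite -fE !inE.
have gm : phi g != mu by have := r _ _ euv; rewrite -gE !inE.
pose s1 := tperm (phi f) k; pose q := s1 (phi g); pose s := (s1 * tperm q l)%g.
have s1m : s1 mu = mu by rewrite /s1 tpermD.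
have qm : q != mu by rewrite -s1m (inj_eq perm_inj).
have qk : q != k.
  by rewrite -(tpermL (phi f) k) -/s1 (inj_eq perm_inj) eq_sym.
exists (s \o phi); split.
- exact: perm_proper.
- by apply: perm_ranges => //; rewrite permM s1m tpermD // eq_sym.
- by rewrite /= permM tpermL tpermD // eq_sym.
- by rewrite /= permM -/q tpermL.
Qed.

Lemma one_named mu f k : on_edges [set f] -> k != mu ->
  exists phi, [/\ proper_col e phi, ranges e phi [set~ mu] & phi f = k].
Proof.
move=> oE km; have [x [y [exy fE]]] := oE f (set11 f).
have [|phi [p r]] := @vizing _ _ _ [set~ mu] e3; first by rewrite card_but.
have fm : phi f != mu by have := r _ _ exy; rewrite -fE !inE.
exists (tperm (phi f) k \o phi); split; first exact: perm_proper.
  by apply: perm_ranges => //; rewrite tpermD.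
by rewrite /= tpermL.
Qed.

Lemma one_missing (mu : 'I_5) x k : k != mu ->
  exists phi, [/\ proper_col e phi, ranges e phi [set~ mu] & k \notin used e phi x].
Proof.
move=> km; have [|phi [p r]] := @vizing _ _ _ [set~ mu] e3; first by rewrite card_but.
have [|l] := @avoid _ [set~ mu] (used e phi x); first by rewrite card_but ltnS card_used3.
rewrite !inE => lm lx; exists (tperm l k \o phi); split; first exact: perm_proper.
  by apply: perm_ranges => //; rewrite tpermD.
by rewrite perm_used mem_tperm tpermR.
Qed.

(** In a Vizing colouring that avoids [mu] the other colours may be permuted freely, which meets one
    exceptional prescription. All others concern [mu] and are met by painting it or by its
    absence. *)
Lemma near_monochromatic mu F0 c0 F1 c1 : on_edges F0 -> on_edges F1 ->
  compat a F0 c0 e S -> compat a F1 c1 e S ->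
  #|[set x in S | a x != mu]| + #|[set f in F0 | c0 f != mu]|
    + #|[set f in F1 | c1 f != mu]| <= 1 ->
  solution F0 c0 F1 c1.
Proof.
move=> o0 o1 k0 k1 le1.
set A := [set x in S | _] in le1; set B := [set f in F0 | _] in le1.
set C := [set f in F1 | _] in le1.
have emp (W : finType) (X : {set W}) w : #|X| = 0 -> w \in X -> False.
  by move/cards0_eq => ->; rewrite inE.
have sing (W : finType) (X : {set W}) w w' : #|X| <= 1 -> w \in X -> w' \in X -> w = w'.
  move=> h wX w'X; apply/eqP; apply: contraTT h => n; rewrite -ltnNge.
  by apply/card_gt1P; exists w, w'.
have inA x : x \in S -> a x != mu -> x \in A by rewrite inE => -> ->.
have inB f : f \in F0 -> c0 f != mu -> f \in B by rewrite inE => -> ->.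
have inC f : f \in F1 -> c1 f != mu -> f \in C by rewrite inE => -> ->.
have [A0|[x xA]] := set_0Vmem A; last first.
  have /= [B0 C0] : #|B| = 0 /\ #|C| = 0.
    by have : 0 < #|A| by [apply/card_gt0P; exists x]; move: le1; move: #|A| #|B| #|C|; clear; lia.
  have A1 : #|A| <= 1 by apply: leq_trans le1; rewrite -addnA leq_addr.
  have xm : a x != mu by move: xA; rewrite inE => /andP[].
  have [phi [p r h]] := @one_missing mu x _ xm.
  apply: (paint_solution k0 k1 p r).
  - by move=> u v _ /inB h1 /h1 /(emp _ _ _ B0).
  - by move=> u v _ /inC h1 /h1 /(emp _ _ _ C0).
  - by move=> y yS ym; rewrite (sing _ _ _ _ A1 (inA _ yS ym) xA).
have hS x : x \in S -> a x != mu -> False by move=> /inA h /h; rewrite A0 inE.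
have [B0|[f fB]] := set_0Vmem B; last first.
  have /= C0 : #|C| = 0.
    by have : 0 < #|B| by [apply/card_gt0P; exists f]; move: le1; move: #|A| #|B| #|C|; clear; lia.
  have B1 : #|B| <= 1 by move: le1; move: #|A| #|B| #|C|; clear; lia.
  have [fF fm] : f \in F0 /\ c0 f != mu by move: fB; rewrite inE => /andP[].
  have [|phi [p r h]] := @one_named mu f _ _ fm; first by move=> g; rewrite inE => /eqP->; apply: o0.
  apply: (paint_solution k0 k1 p r).
  - by move=> u v _ h1 h2; rewrite (sing _ _ _ _ B1 (inB _ h1 h2) fB).
  - by move=> u v _ /inC h1 /h1 /(emp _ _ _ C0).
  - by move=> y yS ym; case: (hS _ yS ym).
have [C0|[f fC]] := set_0Vmem C; last first.
  have C1 : #|C| <= 1 by move: le1; move: #|A| #|B| #|C|; clear; lia.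
  have [fF fm] : f \in F1 /\ c1 f != mu by move: fC; rewrite inE => /andP[].
  have [|phi [p r h]] := @one_named mu f _ _ fm; first by move=> g; rewrite inE => /eqP->; apply: o1.
  apply: (paint_solution k0 k1 p r).
  - by move=> u v _ /inB h1 /h1; rewrite B0 inE.
  - by move=> u v _ h1 h2; rewrite (sing _ _ _ _ C1 (inC _ h1 h2) fC).
  - by move=> y yS ym; case: (hS _ yS ym).
have [|phi [p r]] := @vizing _ _ _ [set~ mu] e3; first by rewrite card_but.
apply: (paint_solution k0 k1 p r).
- by move=> u v _ /inB h1 /h1; rewrite B0 inE.
- by move=> u v _ /inC h1 /h1; rewrite C0 inE.
- by move=> y yS ym; case: (hS _ yS ym).
Qed.

End Copies.

(** * Systems of distinct representatives *)

Section Representatives.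
Variables (V T : finType).
Implicit Types (L : V -> {set T}) (A B : {set V}) (P : {set T}).

Lemma sdr (c0 : T) (s : seq V) L : uniq s ->
  (forall s1 y s2, s = s1 ++ y :: s2 -> size s1 < #|L y|) ->
  exists col : V -> T, {in s &, injective col} /\ {in s, forall y, col y \in L y}.
Proof.
elim/last_ind: s => [|s y IH] /=; first by exists (fun=> c0).
rewrite rcons_uniq => /andP[ys us] h.
have [|col [inj cL]] := IH us.
  by move=> s1 z s2 sE; apply: (h s1 z (rcons s2 y)); rewrite sE rcons_cat.
have [|c cy cs] := @avoid _ (L y) [set col z | z in s].
  apply: leq_ltn_trans (leq_imset_card _ _) _; apply: leq_ltn_trans (card_size _) _.
  by apply: (h s y [::]); rewrite cats1.
have new z : z \in s -> (z == y) = false by move=> zs; apply: contraNF ys => /eqP <-.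
have nc z : z \in s -> c != col z.
  by move=> zs; apply: contraNneq cs => ->; apply: imset_f.
exists (fun z => if z == y then c else col z); split.
- move=> z z'; rewrite !mem_rcons !inE => /orP[/eqP->|zs] /orP[/eqP->|z's] //.
  + by rewrite eqxx new // => E; have := nc _ z's; rewrite E eqxx.
  + by rewrite eqxx new // => E; have := nc _ zs; rewrite E eqxx.
  by rewrite !new //; apply: inj.
- move=> z; rewrite mem_rcons inE => /orP[/eqP->|zs]; first by rewrite eqxx.
  by rewrite new // cL.
Qed.

(** The elements of [A], whose lists may be short, are served first; the others need lists long
    enough to be served last. *)
Lemma sdr2 (c0 : T) A B L :
  (forall y, y \in A -> #|A| <= #|L y|) ->
  (forall y, y \in B :\: A -> #|A| + #|B :\: A| <= #|L y|) ->
  exists col : V -> T, {in A :|: B &, injective col} /\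
    {in A :|: B, forall y, col y \in L y}.
Proof.
move=> hA hB; pose s := enum A ++ enum (B :\: A).
have us : uniq s.
  rewrite cat_uniq !enum_uniq andbT /=; apply/hasPn=> x.
  by rewrite !mem_enum inE => /andP[].
have memE y : (y \in s) = (y \in A :|: B).
  by rewrite mem_cat !mem_enum !inE; case: (y \in A).
have [|col [inj cL]] := @sdr c0 s L us; last first.
  by exists col; split=> [y z|y]; rewrite -!memE; [apply: inj | apply: cL].
move=> s1 y s2 sE.
have szs : size s = #|A| + #|B :\: A| by rewrite size_cat -!cardE.
have nthE : nth y s (size s1) = y by rewrite sE nth_cat ltnn subnn.
have lts : size s1 < size s by rewrite sE size_cat /= -addSnnS leq_addr.
move: nthE; rewrite nth_cat -cardE; case: ltnP => h yE.
  have yA : y \in A by rewrite -(mem_enum A) -yE mem_nth // -cardE.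
  exact: (leq_trans h (hA _ yA)).
rewrite szs in lts; apply: (leq_trans lts); apply: hB.
by rewrite -(mem_enum (B :\: A)) -yE mem_nth // -cardE ltn_subLR.
Qed.

(** On [A] the first choice enumerates [P]; on [A :&: B] the second is its cyclic shift, which is
    injective and, as [P] has two colours, differs everywhere. The rest of [B] takes colours that
    the shift leaves over. *)
Lemma two_sdr A B P : #|A| <= #|P| -> #|B| <= #|P| -> 1 < #|P| ->
  exists col1 col2 : V -> T,
  [/\ {in A &, injective col1}, {in A, forall y, col1 y \in P},
      {in B &, injective col2}, {in B, forall y, col2 y \in P} &
      {in A, forall y, y \in B -> col1 y != col2 y}].
Proof.
move=> AP BP P1; have [c0 c0P] : exists c, c \in P by apply/card_gt0P; apply: ltnW.
pose n := #|P|; pose ix y := index y (enum A).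
pose col i := nth c0 (enum P) (i %% n).
have n0 : 0 < n by apply: ltnW.
have colP i : col i \in P by rewrite -mem_enum mem_nth // -cardE ltn_mod.
have colI i j : col i = col j -> i = j %[mod n].
  by move/eqP; rewrite nth_uniq -?cardE ?ltn_mod ?enum_uniq // => /eqP.
have ixn y : y \in A -> ix y < n.
  by move=> yA; apply: leq_trans AP; rewrite cardE index_mem mem_enum.
have ixI : {in A &, injective ix}.
  by move=> y z yA zA E; rewrite -(nth_index y (_ : y \in enum A)) ?mem_enum // -/(ix y) E nth_index ?mem_enum.
pose col1 y := col (ix y); pose colC y := col (ix y).+1.
have inj1 : {in A &, injective col1}.
  by move=> y z yA zA /colI; rewrite !modn_small ?ixn //; apply: ixI.
have injC : {in A &, injective colC}.
  move=> y z yA zA /colI /eqP; rewrite -(addn1 (ix y)) -(addn1 (ix z)) eqn_modDr => /eqP.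
  by rewrite !modn_small ?ixn //; apply: ixI.
have neqC y : y \in A -> col1 y != colC y.
  move=> yA; apply/negP=> /eqP/colI /eqP.
  by rewrite -{1}(addn0 (ix y)) -(addn1 (ix y)) eqn_modDl mod0n modn_small.
have [||col2 [inj2 c2]] := @sdr2 c0 (B :\: A) set0 (fun=> P :\: colC @: (A :&: B)).
- move=> y _; rewrite [leqRHS]cardsD.
  have -> : #|P :&: colC @: (A :&: B)| = #|A :&: B|.
    rewrite (setIidPr _); last by apply/subsetP=> c /imsetP[z _ ->]; apply: colP.
    by apply: card_in_imset => z z' /setIP[zA _] /setIP[z'A _]; apply: injC.
  by rewrite cardsD [B :&: A]setIC leq_sub2r.
- by move=> y; rewrite in_setD in_set0 andbF.
have c2B y : y \in B -> y \notin A -> col2 y \in P :\: colC @: (A :&: B).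
  by move=> yB yA; apply: c2; rewrite !inE yA yB.
exists col1, (fun y => if y \in A then colC y else col2 y); split=> //.
- by move=> y _; apply: colP.
- move=> y z yB zB; case: ifP => yA; case: ifP => zA.
  + exact: injC.
  + have := c2B z zB (negbT zA); rewrite inE => /andP[h _] E.
    by case/negP: h; rewrite -E imset_f // inE yA.
  + have := c2B y yB (negbT yA); rewrite inE => /andP[h _] E.
    by case/negP: h; rewrite E imset_f // inE zA.
  by apply: inj2; rewrite !inE ?yA ?zA ?yB ?zB.
- move=> y yB; case: ifP => yA; first exact: colP.
  by have := c2B y yB (negbT yA); rewrite inE => /andP[].
- by move=> y yA _; rewrite yA neqC.
Qed.

End Representatives.

(** * Prescribing one or two whole stars *)

Section Stars.
Variables (V : finType) (e : rel V).
Hypothesis e3 : subcubic_rel e.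
Implicit Types (E : {set {set V}}) (pc : {set V} -> 'I_5) (col : V -> 'I_5).

Definition preproper E pc := forall x y z, e x y -> e x z -> y != z ->
  [set x; y] \in E -> [set x; z] \in E -> pc [set x; y] != pc [set x; z].

Definition star_fits E pc x col := [/\ {in e x &, injective col},
  forall y z, e x y -> e y z -> z != x -> [set y; z] \in E -> col y != pc [set y; z] &
  forall y, e x y -> [set x; y] \in E -> col y = pc [set x; y]].

Lemma star_pre E pc x col : preproper E pc -> star_fits E pc x col ->
  exists pc', [/\ preproper (E :|: [set g | x \in (g : {set V})]) pc',
    forall y z, e y z -> [set y; z] \in E -> pc' [set y; z] = pc [set y; z] &
    forall y, e x y -> pc' [set x; y] = col y].
Proof.
move=> pp [inj hE hx]; have [es ei _] := e3.
pose pc' f := if [pick y | e x y && (f == [set x; y])] is Some y then col y else pc f.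
have at_x y : e x y -> pc' [set x; y] = col y.
  move=> exy; rewrite /pc'; case: pickP => [z /andP[_ /eqP /set2_inj->] //|].
  by move/(_ y); rewrite exy eqxx.
have off u v : u != x -> v != x -> pc' [set u; v] = pc [set u; v].
  move=> ux vx; rewrite /pc'; case: pickP => // z /andP[_ /eqP uvE].
  have: x \in [set u; v] by rewrite uvE !inE eqxx.
  by rewrite !inE ![x == _]eq_sym (negPf ux) (negPf vx).
have agree y z : e y z -> [set y; z] \in E -> pc' [set y; z] = pc [set y; z].
  move=> eyz yzE; have [yx|yx] := eqVneq y x.
    by rewrite yx in eyz yzE *; rewrite at_x // hx.
  have [zx|zx] := eqVneq z x; last exact: off.
  by rewrite zx setUC in eyz yzE *; rewrite at_x 1?es // hx // es.
exists pc'; split=> // u v w euv euw vw.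
have [ux|ux] := eqVneq u x.
  by rewrite ux in euv euw * => _ _; rewrite !at_x //; apply: contraNneq vw => /inj->.
have one v' w' : e u v' -> e u w' -> v' = x -> w' != v' ->
    [set u; w'] \in E :|: [set g | x \in (g : {set V})] -> pc' [set u; v'] != pc' [set u; w'].
  move=> h h' vx; rewrite vx in h * => wx.
  rewrite !inE ![x == _]eq_sym (negPf ux) (negPf wx) !orbF => wE.
  by rewrite setUC at_x ?off ?hE // es.
have [vx|vx] := eqVneq v x; first by move=> _; apply: one; rewrite // eq_sym.
have [wx|wx] := eqVneq w x; first by move=> h _; rewrite eq_sym; apply: one; rewrite // eq_sym.
rewrite !off // !inE ![x == _]eq_sym (negPf ux) (negPf vx) (negPf wx) !orbF; exact: pp.
Qed.

Lemma star_greedy E pc x col : preproper E pc -> star_fits E pc x col ->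
  exists phi, [/\ proper_col e phi,
    forall y z, e y z -> [set y; z] \in E -> phi [set y; z] = pc [set y; z] &
    forall y, e x y -> phi [set x; y] = col y].
Proof.
move=> pp sf; have [pc' [pp' h1 h2]] := star_pre pp sf.
have [|phi [p _ h]] := @greedy V _ (fun=> ord0) (E :|: [set g | x \in (g : {set V})]) pc' (card_ord 5) e e3.
  by split=> // y z _; rewrite inE.
exists phi; split=> // [y z eyz yzE|y exy].
  by rewrite -h1 // h // inE yzE.
by rewrite -h2 // h // !inE eqxx orbT.
Qed.

(** The first star joins the precolouring before the second is fitted. Hence the two must differ at
    common neighbours and agree on an edge joining the centres. *)
Lemma star2_greedy E pc x1 x2 col1 col2 : preproper E pc -> x1 != x2 ->
  star_fits E pc x1 col1 -> star_fits E pc x2 col2 ->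
  (forall y, e x1 y -> e x2 y -> col1 y != col2 y) ->
  (e x1 x2 -> col1 x2 = col2 x1) ->
  exists phi, [/\ proper_col e phi,
    forall y z, e y z -> [set y; z] \in E -> phi [set y; z] = pc [set y; z],
    forall y, e x1 y -> phi [set x1; y] = col1 y &
    forall y, e x2 y -> phi [set x2; y] = col2 y].
Proof.
move=> pp n12 sf1 [inj hE hx] c12 c21; have [es ei _] := e3.
have [pc' [pp' h1 h2]] := star_pre pp sf1; have [inj1 _ _] := sf1.
have [|phi [p h h']] := @star_greedy (E :|: [set g | x1 \in (g : {set V})]) pc' x2 col2 pp'.
  split=> // [y z e2y eyz zx2|y e2y].
    rewrite !inE => /orP[yzE|]; first by rewrite h1 // hE.
    case/orP=> /eqP E1; rewrite -E1 in eyz e2y *.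
      by rewrite h2 // -c21 1?es //; apply: contraNneq zx2 => /inj1->; rewrite // unfold_in es.
    rewrite setUC h2 1?es // eq_sym c12 //; by rewrite es.
  rewrite !inE => /orP[yzE|]; first by rewrite h1 // hx.
  case/orP=> /eqP E1; first by rewrite E1 eqxx in n12.
  rewrite -E1 in e2y *; by rewrite setUC h2 1?es // c21 // es.
exists phi; split=> // [y z eyz yzE|y e1y].
  by rewrite -h1 // h // inE yzE.
by rewrite -h2 // h // !inE eqxx orbT.
Qed.

End Stars.

(** * An edge with different colours in the two copies *)

Section Conflicts.
Variables (V : finType) (e : rel V).
Hypothesis e3 : subcubic_rel e.
Implicit Types (F : {set {set V}}) (c phi : {set V} -> 'I_5) (a : V -> 'I_5).

Lemma edge_at F f x : on_edges e F -> f \in F -> x \in f ->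
  exists2 y, e x y & f = [set x; y].
Proof.
move=> oF /oF[u [v [euv ->]]]; have [es _ _] := e3.
rewrite !inE => /orP[] /eqP->; first by exists v.
by exists u; rewrite 1?es // setUC.
Qed.

Lemma special_edge a F c X f x : compat a F c e X -> on_edges e F ->
  f \in F -> x \in X -> x \in f -> c f != a x.
Proof.
move=> [_ h] oF fF xX xf; have [y exy fE] := edge_at oF fF xf.
by rewrite fE in fF *; apply: h.
Qed.

Lemma adjacent_edges a F c X f g x : compat a F c e X -> on_edges e F ->
  f \in F -> g \in F -> f != g -> x \in f -> x \in g -> c f != c g.
Proof.
move=> [h _] oF fF gF fg xf xg; have [y exy fE] := edge_at oF fF xf.
have [z exz gE] := edge_at oF gF xg; rewrite fE gE in fF gF fg *.
by apply: h => //; apply: contraNneq fg => ->.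
Qed.

Lemma preproper_compat a F c X : compat a F c e X -> preproper e F c.
Proof. by case. Qed.

Lemma card_palette (k l : 'I_5) : k != l -> #|~: [set k; l]| = 3.
Proof.
move=> kl; apply/eqP; rewrite -(eqn_add2l #|[set k; l]|) cardsC card_ord cards2.
by rewrite kl.
Qed.

Lemma palette_twist (k l m : 'I_5) :
  (tperm k l m \in [set k; l]) = (m \in [set k; l]).
Proof.
rewrite !inE; case: tpermP => [->|->|/eqP/negPf-> /eqP/negPf->] //;
  by rewrite !eqxx ?orbT.
Qed.

Lemma card_nbr (x : V) : #|[set y | e x y]| <= 3.
Proof. by rewrite cardsE; case: e3. Qed.

Lemma card_nbr1 (x y : V) : #|[set z | e x z] :\ y| <= 3 - e x y.
Proof.
have := cardsD1 y [set z | e x z]; have := card_nbr x; rewrite inE.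
by move: #|_| #|_| => n m; case: (e x y) => /=; clear; lia.
Qed.

Lemma card_edge F f : on_edges e F -> f \in F -> #|f| = 2.
Proof.
move=> oF /oF[u [v [euv ->]]]; rewrite cards2; case: eqP => // uv.
by move: euv; rewrite uv; case: e3 => _ ->.
Qed.

(* The copies differ by exchanging the two colours of f, so a vertex at which one
   of them is prescribed to be missing must see neither: its edges are coloured
   first, from the other three colours. *)
Lemma doubled_edge_one_vertex a c0 c1 f h x : on_edges e [set f; h] -> h != f ->
  compat a [set f; h] c0 e [set x] -> compat a [set f] c1 e [set x] ->
  c0 f != c1 f -> a x \in [set c0 f; c1 f] ->
  (x \in h -> c0 h \notin [set c0 f; c1 f]) ->
  solution e a [set x] [set f; h] c0 [set f] c1.
Proof.
move=> oF hf k0 k1 fc ax hx; have [es ei _] := e3.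
have fF : f \in [set f; h] by rewrite !inE eqxx.
have hF : h \in [set f; h] by rewrite !inE eqxx orbT.
have o1 : on_edges e [set f] by move=> g; rewrite inE => /eqP->; apply: oF.
have xf : x \notin f.
  apply/negP=> xf; move: ax; rewrite !inE ![a x == _]eq_sym.
  by rewrite (negPf (special_edge k0 oF fF _ xf)) ?(negPf (special_edge k1 o1 _ _ xf)) ?set11.
pose P := ~: [set c0 f; c1 f]; have P3 : #|P| = 3 by apply: card_palette.
(* If [h] is at [x], its colour is forced; if [h] meets a neighbour of [x], that neighbour's list
   loses [c0 h]. Only neighbours in [h] get lists shorter than three, so they form the first tier of
   [sdr2]. *)
pose L y := if x \in h then (if y \in h then [set c0 h] else P)
            else if y \in h then P :\ c0 h else P.
pose B := [set y | e x y]; pose A := B :&: h.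
have [||col [inj cL]] := @sdr2 _ _ ord0 A B L.
- move=> y; rewrite inE => /andP[_ yh]; rewrite /L yh; case: ifP => xh.
    rewrite cards1; apply: leq_trans (_ : #|h :\ x| <= 1).
      apply: subset_leq_card; apply/subsetP=> z; rewrite !inE => /andP[exz ->].
      by rewrite andbT; apply: contraTneq exz => ->; rewrite ei.
    by have := cardsD1 x h; rewrite xh (card_edge oF hF) add1n => -[<-].
  apply: leq_trans (_ : 2 <= _).
    by rewrite -(card_edge oF hF) subset_leq_card // subsetIr.
  have := cardsD1 (c0 h) P; rewrite P3; move: #|_| => n; case: (_ \in _); clear; lia.
- move=> y; rewrite !inE negb_and => /andP[/orP[/negP//|yh] exy].
  have -> : B :\: A = B :\: h by apply/setP=> z; rewrite !inE negb_and andb_orl andNb.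
  rewrite cardsID /L (negPf yh) !if_same P3; exact: card_nbr.
have AB : A :|: B = B by apply/setUidPr; apply: subsetIl.
rewrite AB in inj cL.
have colP y : e x y -> col y \in P.
  move=> exy; have := cL y; rewrite inE => /(_ exy); rewrite /L.
  case: ifP => xh; case: ifP => _ //; first by rewrite inE => /eqP->; rewrite inE hx.
  by rewrite inE => /andP[].
have [|phi [p hE hcol]] := @star_greedy V e e3 [set f; h] c0 x col (preproper_compat k0).
  split=> [y z exy exz|y z exy eyz zx|y exy]; first by apply: inj; rewrite inE.
    rewrite !inE => /orP[] /eqP E.
      have := colP _ exy; rewrite E inE; apply: contraNneq => ->; exact: set21.
    have yh : y \in h by rewrite -E !inE eqxx.
    have xh : x \notin h.
      rewrite -E !inE negb_or ![x == _]eq_sym zx andbT.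
      by apply: contraTneq exy => ->; rewrite ei.
    have := cL y; rewrite inE => /(_ exy); rewrite /L (negPf xh) yh !inE E.
    by case/andP.
  rewrite !inE => /orP[] /eqP E; first by rewrite -E !inE eqxx in xf.
  have := cL y; rewrite inE => /(_ exy); rewrite /L -E !inE !eqxx orbT /=.
  by move/set1P.
have up l : l \in used e phi x -> l \in P.
  by case/usedP=> y exy ->; rewrite hcol // colP.
apply: (@twist_solution _ _ _ _ e3 _ _ _ _ (c0 f) (c1 f) phi p).
- by move=> u v; apply: hE.
- move=> u v euv; rewrite inE => /eqP E; rewrite hE // E //.
  exact: tpermL.
- move=> y; rewrite inE => /eqP->; split; apply/negP=> /up; rewrite inE.
    by rewrite ax.
  by rewrite palette_twist ax.
Qed.

(** Both stars must use only the three colours outside the clash, and differ at common neighbours,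
    which [two_sdr] provides. If [x1] and [x2] are adjacent, their edge takes a reserved colour [k],
    and two colours are left for at most two further edges at each. *)
Lemma doubled_edge_two_inside a c0 c1 f x1 x2 : on_edges e [set f] -> x1 != x2 ->
  compat a [set f] c0 e [set x1; x2] -> compat a [set f] c1 e [set x1; x2] ->
  c0 f != c1 f -> a x1 \in [set c0 f; c1 f] -> a x2 \in [set c0 f; c1 f] ->
  solution e a [set x1; x2] [set f] c0 [set f] c1.
Proof.
move=> oF n12 k0 k1 fc a1 a2; have [es ei _] := e3.
have fF := set11 f.
have nf x : x \in [set x1; x2] -> a x \in [set c0 f; c1 f] -> x \notin f.
  move=> xS ax; apply/negP=> xf; move: ax; rewrite !inE ![a x == _]eq_sym.
  by rewrite (negPf (special_edge k0 oF fF xS xf)) ?(negPf (special_edge k1 oF fF xS xf)).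
have {nf} [f1 f2] : x1 \notin f /\ x2 \notin f by rewrite !nf ?set21 ?set22.
pose P := ~: [set c0 f; c1 f]; have P3 : #|P| = 3 by apply: card_palette.
have [k kP] : exists k, k \in P by apply/card_gt0P; rewrite P3.
pose Q := if e x1 x2 then P :\ k else P.
have Q3 : #|Q| = 3 - e x1 x2.
  rewrite /Q; case: ifP => // _; have := cardsD1 k P; rewrite P3 kP => /eqP.
  by rewrite eqSS subSS subn0 => /eqP<-.
have QP l : l \in Q -> l \in P /\ (e x1 x2 -> l != k).
  by rewrite /Q; case: ifP => // _; rewrite !inE => /andP[].
have [|||col1 [col2 [inj1 c1Q inj2 c2Q c12]]] :=
    @two_sdr V _ ([set y | e x1 y] :\ x2) ([set y | e x2 y] :\ x1) Q.
- by rewrite Q3 card_nbr1.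
- by rewrite Q3 es card_nbr1.
- by rewrite Q3; case: (e _ _).
pose d x (col : V -> 'I_5) y := if y == x then k else col y.
have fits x x' col : x \notin f -> (e x x' -> e x1 x2) ->
    {in [set y | e x y] :\ x' &, injective col} ->
    {in [set y | e x y] :\ x', forall y, col y \in Q} ->
    star_fits e [set f] c0 x (d x' col) /\ forall y, e x y -> d x' col y \in P.
  move=> xf ex inj cQ.
  have dP y : e x y -> d x' col y \in P.
    by move=> exy; rewrite /d; case: eqP => // /eqP n; have [] := QP _ (cQ y _); rewrite ?inE ?n.
  split=> //; split=> [y z exy exz|y z exy eyz zx|y exy].
  - rewrite unfold_in in exy exz; rewrite /d.
    have [yE|yE] := eqVneq y x'; have [zE|zE] := eqVneq z x' => //.
    + by move=> _; rewrite yE.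
    + have [] := QP _ (cQ z _); first by rewrite !inE zE.
      by rewrite yE in exy => _ /(_ (ex exy)) /eqP n E; rewrite E in n.
    + have [] := QP _ (cQ y _); first by rewrite !inE yE.
      by rewrite zE in exz => _ /(_ (ex exz)) /eqP n E; rewrite E in n.
    by apply: inj; rewrite !inE ?yE ?zE.
  - rewrite inE => /eqP->; apply: contraTneq (dP _ exy) => ->.
    by rewrite !inE eqxx.
  by rewrite inE => /eqP E; rewrite -E !inE eqxx in xf.
have [fit1 d1] := fits _ _ _ f1 id inj1 c1Q.
have [|fit2 d2] := fits x2 x1 col2 f2 _ inj2 c2Q; first by rewrite es.
have [||phi [p hE h1 h2]] := @star2_greedy V e e3 [set f] c0 x1 x2 _ _
    (preproper_compat k0) n12 fit1 fit2.
- move=> y e1y e2y; rewrite /d.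
  have -> : (y == x2) = false by apply/negP=> /eqP E; rewrite E ei in e2y.
  have n1 : (y == x1) = false by apply/negP=> /eqP E; rewrite E ei in e1y.
  rewrite n1; apply: c12; rewrite !inE ?n1 ?e2y // e1y andbT.
  by apply: contraTneq e2y => ->; rewrite ei.
- by rewrite /d !eqxx.
apply: (@twist_solution _ _ _ _ e3 _ _ _ _ (c0 f) (c1 f) phi p).
- by move=> u v; apply: hE.
- move=> u v euv; rewrite inE => /eqP E; rewrite hE // E ?set11 //.
  exact: tpermL.
- have key x : x \in [set x1; x2] -> a x \in [set c0 f; c1 f] ->
      (forall y, e x y -> phi [set x; y] \in P) ->
      a x \notin used e phi x /\ tperm (c0 f) (c1 f) (a x) \notin used e phi x.
    move=> _ ax up; have up' l : l \in used e phi x -> l \in P by case/usedP=> y exy ->; apply: up.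
    split; apply/negP=> /up'; rewrite inE; first by rewrite ax.
    by rewrite palette_twist ax.
  move=> x xS; case/set2P: (xS) => E; apply: key => //; rewrite E // => y exy.
    by rewrite h1 // d1.
  by rewrite h2 // d2.
Qed.

(** The star at [x1] is restricted to the three colours of [P], whereas [b = a x2] is fixed by the
    exchange and only has to be missing at [x2]. So the star at [x1] is coloured first, with [b]
    kept off an edge to [x2], and a count shows that the star at [x2] can still be completed. *)
Lemma doubled_edge_one_inside a c0 c1 f x1 x2 : on_edges e [set f] -> x1 != x2 ->
  compat a [set f] c0 e [set x1; x2] -> compat a [set f] c1 e [set x1; x2] ->
  c0 f != c1 f -> a x1 \in [set c0 f; c1 f] -> a x2 \notin [set c0 f; c1 f] ->
  solution e a [set x1; x2] [set f] c0 [set f] c1.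
Proof.
move=> oF n12 k0 k1 fc a1 a2; have [es ei _] := e3.
have fF := set11 f.
have f1 : x1 \notin f.
  apply/negP=> xf; move: a1; rewrite !inE ![a x1 == _]eq_sym.
  by rewrite (negPf (special_edge k0 oF fF _ xf)) ?(negPf (special_edge k1 oF fF _ xf)) ?set21.
pose P := ~: [set c0 f; c1 f]; have P3 : #|P| = 3 by apply: card_palette.
pose b := a x2; have bP : b \in P by rewrite inE.
have Pb2 : #|P :\ b| = 2 by have := cardsD1 b P; rewrite bP P3 => -[].
have [||col1 [inj1 cL1]] := @sdr2 _ _ ord0 [set y | e x1 y & y == x2] [set y | e x1 y]
    (fun y => if y == x2 then P :\ b else P).
- move=> y; rewrite inE => /andP[_ ->]; rewrite Pb2.
  apply: leq_trans (_ : #|[set x2]| <= 2); last by rewrite cards1.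
  by apply: subset_leq_card; apply/subsetP=> z; rewrite !inE => /andP[].
- move=> y; rewrite !inE negb_and => /andP[/orP[/negP//|n] exy]; rewrite (negPf n) P3.
  have -> : [set y | e x1 y & y == x2] = [set y | e x1 y] :&: [set x2] by apply/setP=> z; rewrite !inE.
  by rewrite setDIr setDv set0U cardsID card_nbr.
have c1b y : e x1 y -> (col1 y \in P) /\ (y = x2 -> col1 y != b).
  move=> exy; have := cL1 y; rewrite in_setU [y \in [set y | e x1 y]]inE exy orbT => /(_ isT).
  by case: eqP => [_|n yP]; [rewrite in_setD1 => /andP[] | split].
have {}inj1 : {in e x1 &, injective col1}.
  have mem y : e x1 y -> y \in [set y | e x1 y & y == x2] :|: [set y | e x1 y].
    by rewrite !inE => ->; rewrite orbT.
  by move=> y z ey ez; apply: inj1; apply: mem.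
pose d := e x1 x2; pose q := x2 \in f.
(* [R] indexes the edges at [x2] still to be coloured; [d] and [q] tell whether the edge to [x1] and
   the edge [f] are among those already fixed there. *)
pose R := [set y | [&& e x2 y, y != x1 & [set x2; y] != f]].
pose forbidden y := (b |: (if d then [set col1 x2] else set0)) :|:
  ((if e x1 y then [set col1 y] else set0) :|: (if (y \in f) || q then [set c0 f] else set0)).
pose L y := ~: forbidden y.
have cardR : #|R| <= 3 - d - q.
  have sub : R \subset [set y | e x2 y] :\ x1.
    by apply/subsetP=> y; rewrite !inE => /and3P[-> ->].
  have := card_nbr1 x2 x1; rewrite es -/d => le.
  have [q0|nq] := boolP q; last by rewrite subn0 (leq_trans (subset_leq_card sub)).
  have [w exw fE] := edge_at oF fF q0.
  have : R \proper [set y | e x2 y] :\ x1.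
    apply/properP; split=> //; exists w; last by rewrite !inE fE eqxx !andbF.
    by rewrite !inE exw andbT; apply: contraNneq f1 => <-; rewrite fE set22.
  by move/proper_card; move: le; move: #|_| #|R| => m n; clear; case: d => /=; lia.
have cardL y : 4 - d - e x1 y - ((y \in f) || q) <= #|L y|.
  have := cardsC (forbidden y); rewrite card_ord -/(L y).
  have := leq_of_leqif (leq_card_setU (b |: (if d then [set col1 x2] else set0))
     ((if e x1 y then [set col1 y] else set0) :|: (if (y \in f) || q then [set c0 f] else set0))).
  have := leq_of_leqif (leq_card_setU (if e x1 y then [set col1 y] else set0) (if (y \in f) || q then [set c0 f] else set0)).
  have := leq_of_leqif (leq_card_setU [set b] (if d then [set col1 x2] else set0)).
  have cif (t : bool) (l : 'I_5) : #|if t then [set l] else set0| = t by case: t; rewrite ?cards1 ?cards0.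
  rewrite !cif cards1 -/(forbidden y).
  by move: #|_| #|_| #|_| #|_| => m n n1 n2; clear; lia.
(* Here [b] and [col1 y] are the same excluded colour, which improves [cardL] by one. *)
have cardLb y : e x1 y -> col1 y = b -> 4 - d - ((y \in f) || q) <= #|L y|.
  move=> _ cb; have -> : L y = ~: ((b |: (if d then [set col1 x2] else set0)) :|: (if (y \in f) || q then [set c0 f] else set0)).
    apply/setP=> l; rewrite /L /forbidden !inE; case: (e x1 y); rewrite ?inE ?cb.
      by case: (l == b); rewrite ?orbT.
    by [].
  set X := _ :|: _; have := cardsC X; rewrite card_ord.
  have := leq_of_leqif (leq_card_setU (b |: (if d then [set col1 x2] else set0)) (if (y \in f) || q then [set c0 f] else set0)).
  have := leq_of_leqif (leq_card_setU [set b] (if d then [set col1 x2] else set0)).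
  have cif (t : bool) (l : 'I_5) : #|if t then [set l] else set0| = t by case: t; rewrite ?cards1 ?cards0.
  rewrite !cif cards1 -/X.
  by move: #|_| #|_| #|_| => m n n1; clear; lia.
(* These are the lists too short to be served last; they form the first tier, and it remains to see
   that they are few. *)
pose A := [set y in R | #|L y| < #|R|].
have [||colR [injR cR]] := @sdr2 _ _ ord0 A R L.
- move=> y yA; have := yA; rewrite inE => /andP[yR ltL].
  have AR : #|A| <= #|R| by apply: subset_leq_card; apply/subsetP=> z; rewrite inE => /andP[].
  have exy : e x2 y by move: yR; rewrite inE => /andP[].
  have Af : ~~ q -> #|A| <= 2 /\ forall z, z \in A -> z \in f.
    move=> nq; have h z : z \in A -> z \in f.
      rewrite inE => /andP[zR]; apply: contraTT => zf; rewrite -leqNgt.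
      move: cardR (cardL z); rewrite (negPf zf) (negPf nq) /=.
      by move: #|_| #|_| => m n; case: (e x1 z); case: (d); clear; lia.
    split=> //; rewrite -(card_edge oF fF); apply: subset_leq_card; exact/subsetP.
  (* If [f] is at [x2], no list is short. Otherwise short lists occur only at the two ends of [f];
     without an edge [x1 x2] every list has at least two colours, which is enough. *)
  have [q0|nq] := boolP q.
    move: ltL AR cardR (cardL y); rewrite q0 orbT.
    move: #|_| #|_| #|_| => m n n1; case: (e x1 y); case: (d); clear; lia.
  have [A2 Asub] := Af nq.
  have [d0|nd] := boolP d; last first.
    move: ltL AR A2 cardR (cardL y); rewrite (negPf nq) (negPf nd) orbF.
    move: #|_| #|_| #|_| => m n n1; case: (e x1 y); case: (_ \in _); clear; lia.
  have big z : z \in A -> e x1 z /\ col1 z != b.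
    rewrite inE => /andP[zR ltz]; split.
      apply: contraTT ltz => nez; rewrite -leqNgt.
      move: cardR (cardL z); rewrite (negPf nez) (negPf nq) d0.
      by move: #|_| #|_| => m n; case: (_ \in _); clear; lia.
    apply: contraTneq ltz => cb; rewrite -leqNgt.
    have [ez|nez] := boolP (e x1 z).
      move: cardR (cardLb z ez cb); rewrite (negPf nq) d0.
      by move: #|_| #|_| => m n; case: (_ \in _); clear; lia.
    move: cardR (cardL z); rewrite (negPf nez) (negPf nq) d0.
    by move: #|_| #|_| => m n; case: (_ \in _); clear; lia.
  (* The edges from [x1] to [x2] and to the members of [A] have distinct colours in [P :\ b], which
     has only two elements. *)
  have A1 : #|A| <= 1.
    have x2A : x2 \notin A by apply/negP=> /Asub; apply/negP.
    have : #|[set col1 z | z in x2 |: A]| <= 2.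
      apply: leq_trans (eq_leq Pb2); apply: subset_leq_card; apply/subsetP=> l /imsetP[z].
      rewrite in_setU1 => /orP[/eqP->|zA] ->; rewrite in_setD1.
        by have [h1 h2] := c1b _ d0; rewrite h2.
      by have [ez nb] := big z zA; rewrite nb; have [h1 _] := c1b _ ez.
    rewrite card_in_imset ?cardsU1 ?x2A //.
    by move=> z z' hz hz'; apply: inj1; [move: hz|move: hz']; rewrite in_setU1 => /orP[/eqP->|/big[]].
  move: A1 (cardL y); rewrite (negPf nq) d0.
  by move: #|_| #|_| => m n; case: (e x1 y); case: (_ \in _); clear; lia.
- move=> y; rewrite inE => /andP[yA yR].
  have AR : A :&: R = A by apply/setIidPl; apply/subsetP=> z; rewrite inE => /andP[].
  have -> : #|A| + #|R :\: A| = #|R| by rewrite -{1}AR setIC cardsID.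
  by move: yA; rewrite inE yR /= -leqNgt.
have {}cR y : y \in R -> colR y \in L y by move=> yR; apply: cR; rewrite inE yR orbT.
have {}injR : {in R &, injective colR}.
  by move=> y z yR zR; apply: injR; rewrite inE ?yR ?zR orbT.
have LP y l : l \in L y -> [/\ l != b, d -> l != col1 x2, e x1 y -> l != col1 y &
    (y \in f) || q -> l != c0 f].
  rewrite inE in_setU in_setU1 !negb_or in_setU negb_or => /andP[/andP[-> h1] /andP[h2 h3]].
  by split=> // h; [move: h1 | move: h2 | move: h3]; rewrite h inE.
pose col2 y := if y == x1 then col1 x2 else if [set x2; y] == f then c0 f else colR y.
have fP : c0 f \notin P by rewrite !inE eqxx.
have mR y : e x2 y -> y != x1 -> [set x2; y] != f -> y \in R by move=> *; rewrite inE; apply/and3P.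
have fit1 : star_fits e [set f] c0 x1 col1.
  split=> // [y z exy eyz zx|y exy].
    rewrite inE => /eqP->; apply: contraNneq fP => <-; by case: (c1b _ exy).
  by rewrite inE => /eqP E; rewrite -E !inE eqxx in f1.
have fit2 : star_fits e [set f] c0 x2 col2.
  split=> [y z exy exz|y z exy eyz zx|y exy]; last first.
  - rewrite inE /col2 => /eqP E; rewrite E eqxx; case: eqP => // yx.
    by rewrite -E yx !inE eqxx orbT in f1.
  - rewrite inE => /eqP E; rewrite /col2.
    have [yx|yx] := eqVneq y x1; first by rewrite yx in E; rewrite -E !inE eqxx in f1.
    have [yf|yf] := eqVneq [set x2; y] f.
      by case/negP: zx; rewrite -yf [[set x2; y]]setUC in E; rewrite (set2_inj E).
    have [_ _ _ h] := LP _ _ (cR _ (mR _ exy yx yf)).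
    by rewrite E h // -E !inE eqxx.
  rewrite /col2; rewrite unfold_in in exy exz.
  have [yx|yx] := eqVneq y x1; have [zx|zx] := eqVneq z x1.
  - by move=> _; rewrite yx.
  - have dd : d by rewrite /d es -yx.
    case: eqP => [_ E|/eqP zf E]; first by case: (c1b _ dd) => h _; rewrite E (negPf fP) in h.
    by have [_ h _ _] := LP _ _ (cR _ (mR _ exz zx zf)); have := h dd; rewrite E eqxx.
  - have dd : d by rewrite /d es -zx.
    case: eqP => [_ E|/eqP yf E]; first by case: (c1b _ dd) => h _; rewrite -E (negPf fP) in h.
    by have [_ h _ _] := LP _ _ (cR _ (mR _ exy yx yf)); have := h dd; rewrite E eqxx.
  have [yf|yf] := eqVneq [set x2; y] f; have [zf|zf] := eqVneq [set x2; z] f.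
  - by move=> _; apply: (@set2_inj _ x2); rewrite yf.
  - have [_ _ _ h] := LP _ _ (cR _ (mR _ exz zx zf)) => E; move: h; rewrite -E eqxx /q -yf !inE eqxx orbT.
    by move=> /(_ isT).
  - have [_ _ _ h] := LP _ _ (cR _ (mR _ exy yx yf)) => E; move: h; rewrite E eqxx /q -zf !inE eqxx orbT.
    by move=> /(_ isT).
  by apply: injR; apply: mR.
have [||phi [p hE h1 h2]] := @star2_greedy V e e3 [set f] c0 x1 x2 _ _
    (preproper_compat k0) n12 fit1 fit2.
- move=> y e1y e2y; rewrite /col2.
  have n1 : y != x1 by apply: contraTneq e1y => ->; rewrite ei.
  rewrite (negPf n1); have [_|yf] := eqVneq [set x2; y] f.
    by apply: contraNneq fP => <-; case: (c1b _ e1y).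
  by have [_ _ h _] := LP _ _ (cR _ (mR _ e2y n1 yf)); rewrite eq_sym h.
- by rewrite /col2 eqxx.
apply: (@twist_solution _ _ _ _ e3 _ _ _ _ (c0 f) (c1 f) phi p).
- by move=> u v; apply: hE.
- move=> u v euv; rewrite inE => /eqP E; rewrite hE // E ?set11 //.
  exact: tpermL.
- have u1 l : l \in used e phi x1 -> l \in P.
    by case/usedP=> y exy ->; rewrite h1 //; case: (c1b _ exy).
  have u2 : b \notin used e phi x2.
    apply/negP=> /usedP[y exy]; rewrite h2 // /col2.
    have [yx|yx] := eqVneq y x1.
      move=> E; have dd : d by rewrite /d es -yx.
      by case: (c1b _ dd) => _ /(_ erefl); rewrite -E eqxx.
    have [yf|yf] := eqVneq [set x2; y] f; first by move=> E; rewrite -E bP in fP.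
    by have [h _ _ _] := LP _ _ (cR _ (mR _ exy yx yf)) => E; rewrite -E eqxx in h.
  move=> x /set2P[] ->.
    split; apply/negP=> /u1; rewrite inE; first by rewrite a1.
    by rewrite palette_twist a1.
  rewrite tpermD //; first by apply: contraNneq a2 => ->; rewrite set21.
  by apply: contraNneq a2 => ->; rewrite set22.
Qed.

Lemma used_recol_at x t phi k : symmetric e -> e x t ->
  used e (recol phi [set x; t] k) x \subset k |: used (del e x t) phi x.
Proof.
move=> es ext; apply/subsetP=> l /usedP[y exy ->]; rewrite /recol.
case: ifP => h; first by rewrite !inE eqxx.
by rewrite in_setU1 mem_used ?orbT // del_edge exy h.
Qed.

Lemma card_del_nbr x t : e x t -> #|[set y | del e x t x y]| <= 2.
Proof.
move=> ext; rewrite cardsE -ltnS; apply: leq_trans (card_del ext) _.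
by case: e3.
Qed.

(* The colour of h is one of the two that are exchanged, but only the first copy
   may use it at x: in the second copy h gets a third colour k, reserved at both
   ends of h. *)
Lemma doubled_edge_at_vertex a c0 c1 f h x : on_edges e [set f; h] -> h != f ->
  compat a [set f; h] c0 e [set x] -> compat a [set f] c1 e [set x] ->
  c0 f != c1 f -> a x \in [set c0 f; c1 f] ->
  x \in h -> c0 h \in [set c0 f; c1 f] ->
  solution e a [set x] [set f; h] c0 [set f] c1.
Proof.
move=> oF hf k0 k1 fc ax xh hc; have [es ei _] := e3.
have fF : f \in [set f; h] by rewrite !inE eqxx.
have hF : h \in [set f; h] by rewrite !inE eqxx orbT.
have o1 : on_edges e [set f] by move=> g; rewrite inE => /eqP->; apply: oF.
have xf : x \notin f.
  apply/negP=> xf; move: ax; rewrite !inE ![a x == _]eq_sym.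
  by rewrite (negPf (special_edge k0 oF fF _ xf)) ?(negPf (special_edge k1 o1 _ _ xf)) ?set11.
have ha : c0 h != a x by apply: special_edge k0 oF hF _ xh; rewrite inE.
have [t ext hE] := edge_at oF hF xh.
have etx : e t x by rewrite es.
pose P := ~: [set c0 f; c1 f]; have P3 : #|P| = 3 by apply: card_palette.
have [k kP] : exists k, k \in P by apply/card_gt0P; rewrite P3.
pose Q := P :\ k; have Q2 : #|Q| = 2 by have := cardsD1 k P; rewrite kP P3 => -[].
have QP l : l \in Q -> l \in P by rewrite in_setD1 => /andP[].
have notP l : l \in [set c0 f; c1 f] -> l \notin P by rewrite in_setC negbK.
have fP : c0 f \notin P by rewrite notP ?set21.
have tw l : l \in P -> tperm (c0 f) (c1 f) l = l.
  by rewrite inE in_set2 negb_or => /andP[? ?]; rewrite tpermD // eq_sym.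
pose e' := del e x t; have e'3 : subcubic_rel e' by apply: subcubic_restr.
have e'e : subrel e' e by apply: del_sub.
have e's : symmetric e' by case: e'3.
have xt : x != t by apply: contraTneq ext => ->; rewrite ei.
(* [f] may be an edge at [t]; it keeps [c0 f] and takes no part in the choice of representatives
   from [Q]. *)
pose B := [set y | e' t y & [set t; y] != f].
have B2 : #|B| <= 2.
  apply: leq_trans (card_del_nbr etx); apply: subset_leq_card.
  by apply/subsetP=> y; rewrite !inE -del_C => /andP[].
have [|||col1 [col2 [inj1 cQ1 inj2 cQ2 c12]]] := @two_sdr V _ [set y | e' x y] B Q.
- by rewrite Q2 card_del_nbr.
- by rewrite Q2.
- by rewrite Q2.
pose col2' y := if [set t; y] == f then c0 f else col2 y.
have Q1 y : e' x y -> col1 y \in Q by move=> exy; apply: cQ1; rewrite inE.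
have Q2' y : e' t y -> [set t; y] != f -> col2 y \in Q.
  by move=> ety n; apply: cQ2; rewrite inE ety.
have mB y : e' t y -> [set t; y] != f -> y \in B by rewrite inE => -> ->.
have fQ : c0 f \notin Q by apply: contraNN fP; apply: QP.
have fit1 : star_fits e' [set f] c0 x col1.
  split=> [y z exy exz|y z exy eyz zx|y exy].
  - by apply: inj1; rewrite inE.
  - by rewrite inE => /eqP->; apply: contraNneq fQ => <-; apply: Q1.
  by rewrite inE => /eqP E; rewrite -E !inE eqxx in xf.
have fit2 : star_fits e' [set f] c0 t col2'.
  split=> [y z ety etz|y z ety eyz zt|y ety]; rewrite /col2'.
  - have [yf|yf] := eqVneq [set t; y] f; have [zf|zf] := eqVneq [set t; z] f.
    + by move=> _; apply: (@set2_inj _ t); rewrite yf.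
    + by move=> E; rewrite E Q2' in fQ.
    + by move=> E; rewrite -E Q2' in fQ.
    by apply: inj2; apply: mB.
  - rewrite inE => /eqP E; have [yf|yf] := eqVneq [set t; y] f.
      by case/negP: zt; rewrite -yf [[set t; y]]setUC in E; rewrite (set2_inj E).
    by rewrite E; apply: contraNneq fQ => <-; apply: Q2'.
  by rewrite inE => /eqP ->; rewrite eqxx.
have pp : preproper e' [set f] c0.
  by move=> u v w _ _ vw; rewrite !inE => /eqP<- /eqP/set2_inj E; rewrite E eqxx in vw.
have [||phi [p hE' h1 h2]] := @star2_greedy V e' e'3 [set f] c0 x t _ _ pp xt fit1 fit2.
- move=> y exy ety; rewrite /col2'; have [_|yf] := eqVneq [set t; y] f.
    by apply: contraNneq fQ => <-; apply: Q1.
  by apply: c12; rewrite inE ?exy // ety.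
- by rewrite /e' del_edge eqxx andbF.
have ux l : l \in used e' phi x -> l \in Q.
  by case/usedP=> y exy ->; rewrite h1 // Q1.
have ut l : l \in used e' phi t -> (exists2 y, y \in B & l = col2 y) \/ (l = c0 f /\ t \in f).
  case/usedP=> y ety ->; rewrite h2 // /col2'; have [yf|yf] := eqVneq [set t; y] f.
    by right; rewrite -yf !inE eqxx.
  by left; exists y; rewrite // inE ety.
have utQ l : l \in used e' phi t -> l \in Q \/ (l = c0 f /\ t \in f).
  by case/ut=> [[y yB ->]|]; [left; apply: cQ2 | right].
have ft : t \in f -> c0 f != c0 h.
  by move=> tf; apply: (adjacent_edges k0 oF fF hF _ tf); rewrite 1?eq_sym // hE !inE eqxx orbT.
have hQ : c0 h \notin Q by apply: contraNN (notP _ hc); apply: QP.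
have kQ : k \notin Q by rewrite !inE eqxx.
pose s := tperm (c0 f) (c1 f).
have sQ l : l \in Q -> s l = l by move/QP; apply: tw.
have aP : a x \notin P by apply: notP.
have xtf u v : [set u; v] = f -> [set u; v] != [set x; t].
  by move=> ->; rewrite -hE eq_sym.
exists (recol phi [set x; t] (c0 h)), (recol (s \o phi) [set x; t] k); split.
- split.
  + apply: add_edge => //; first by apply: contraNN hQ; apply: ux.
    by apply/negP=> /utQ[|[E /ft]]; [apply/negP | rewrite E eqxx].
  + move=> u v euv; rewrite inE => /eqP E; rewrite {}E in euv *; rewrite /recol.
    case: ifP => [_|/negbT n]; first exact: ha.
    by apply: contraNneq aP => <-; apply/QP/ux/mem_used; rewrite /e' del_edge euv.
  + move=> u v euv; rewrite in_set2 => /orP[] /eqP E; last by rewrite E hE recol_same.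
    have n := xtf _ _ E; rewrite recol_diff // hE' ?E ?set11 //.
    by rewrite /e' del_edge euv.
- split.
  + apply: add_edge => //; first exact: perm_proper.
      rewrite perm_used; apply/negP=> /imsetP[l /ux lQ E].
      by rewrite sQ // in E; rewrite E lQ in kQ.
    rewrite perm_used; apply/negP=> /imsetP[l /utQ[lQ|[-> _]] E].
      by rewrite sQ // in E; rewrite E lQ in kQ.
    by rewrite E tpermL (negPf (notP _ _)) ?set22 in kP.
  + move=> u v euv; rewrite inE => /eqP E; rewrite {}E in euv *; rewrite /recol.
    case: ifP => [_|/negbT n]; first by apply: contraNneq aP => <-.
    have uQ : phi [set x; v] \in Q by apply/ux/mem_used; rewrite /e' del_edge euv.
    by rewrite /= sQ //; apply: contraNneq aP => <-; apply: QP.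
  + move=> u v euv; rewrite inE => /eqP E; have n := xtf _ _ E.
    rewrite recol_diff //= hE' ?E ?set11 //; first exact: tpermL.
    by rewrite /e' del_edge euv.
move=> y; rewrite inE => yx; have [->|yt] := eqVneq y t; last first.
  rewrite !used_recol_other // perm_used.
  by apply: spare; apply: twist_spare; apply: card_used3.
have in0 l : l \in used e (recol phi [set x; t] (c0 h)) t -> l = c0 h \/ l \in used e' phi t.
  move/(subsetP (_ : _ \subset c0 h |: used e' phi t)); rewrite in_setU1 => H.
  have {H} H0 : (l == c0 h) || (l \in used e' phi t).
    by apply: H; rewrite setUC /e' del_C; apply: used_recol_at.
  by case/orP: H0 => [/eqP|]; [left | right].
have in1 l : l \in used e (recol (s \o phi) [set x; t] k) t -> l = k \/ s l \in used e' phi t.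
  move/(subsetP (_ : _ \subset k |: used e' (s \o phi) t)); rewrite in_setU1 => H.
  have {H} H0 : (l == k) || (l \in used e' (s \o phi) t).
    by apply: H; rewrite setUC /e' del_C; apply: used_recol_at.
  case/orP: H0 => [/eqP|H0]; [by left | right].
  by rewrite perm_used mem_tperm in H0.
(* The rung at [t] needs a colour although [h] differs between the copies. If [f] is at [t], at most
   one colour of [Q] is used there and the other is spare. If not, the exchanged colour [s (c0 h)]
   is seen in neither copy. *)
have [tf|tf] := boolP (t \in f).
  have [w etw fE] := edge_at oF fF tf.
  have [|b bQ bB] := @avoid _ Q (col2 @: B).
    rewrite Q2; apply: leq_ltn_trans (leq_imset_card _ _) _.
    apply: leq_trans (card_del_nbr etx); apply: proper_card; apply/properP; split.
      by apply/subsetP=> z; rewrite !inE -del_C => /andP[].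
    exists w; last by rewrite inE fE eqxx andbF.
    by rewrite inE del_edge etw -fE setUC -hE eq_sym.
  have bt : b \notin used e' phi t.
    apply/negP=> /ut[[z zB E]|[E _]]; last by rewrite -E bQ in fQ.
    by case/negP: bB; rewrite E imset_f.
  exists b; split; apply/negP.
    by case/in0=> [E|]; [rewrite -E bQ in hQ | apply/negP].
  by case/in1=> [E|]; [rewrite -E bQ in kQ | rewrite sQ //; apply/negP].
have shc : s (c0 h) \in [set c0 f; c1 f] by rewrite palette_twist.
exists (s (c0 h)); split; apply/negP.
  case/in0=> [E|/utQ[/QP|[_]]]; last by apply/negP.
    move: hc E; rewrite in_set2 => /orP[] /eqP->; rewrite ?tpermL ?tpermR => E.
      by rewrite E eqxx in fc.
    by rewrite E eqxx in fc.
  by apply/negP; apply: notP.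
case/in1=> [E|]; first by rewrite -E (negPf (notP _ shc)) in kP.
by rewrite tpermK => /utQ[/QP|[_]]; apply/negP; rewrite ?notP.
Qed.

(* The two copies agree outside f, and the other edges at the ends of f avoid both
   colours of f. *)
Lemma doubled_edge_two_single a c0 c1 f h g : on_edges e [set f; h] -> on_edges e [set f; g] ->
  h != f -> g != f -> h != g ->
  compat a [set f; h] c0 e set0 -> compat a [set f; g] c1 e set0 ->
  c0 f = c0 h -> c1 f = c1 g -> c0 f != c1 f ->
  solution e a set0 [set f; h] c0 [set f; g] c1.
Proof.
move=> o0 o1 hf gf hg k0 k1 fh fg fc; have [es ei _] := e3.
have fF0 := set21 f h; have fF1 := set21 f g.
have nh x : x \in f -> x \notin h.
  move=> xf; apply/negP=> xh; have := adjacent_edges k0 o0 fF0 (set22 f h) _ xf xh.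
  by rewrite eq_sym hf fh eqxx => /(_ isT).
have ng x : x \in f -> x \notin g.
  move=> xf; apply/negP=> xg; have := adjacent_edges k1 o1 fF1 (set22 f g) _ xf xg.
  by rewrite eq_sym gf fg eqxx => /(_ isT).
have [y [z [eyz fE]]] := o0 f fF0.
have ezy : e z y by rewrite es.
have yz : y != z by apply: contraTneq eyz => ->; rewrite ei.
pose P := ~: [set c0 f; c1 f]; have P3 : #|P| = 3 by apply: card_palette.
have P0 : c0 f \notin P by rewrite in_setC negbK set21.
have P1 : c1 f \notin P by rewrite in_setC negbK set22.
pose e' := del e y z; have e'3 : subcubic_rel e' by apply: subcubic_restr.
have [|||col1 [col2 [inj1 cP1 inj2 cP2 c12]]] :=
    @two_sdr V _ [set w | e' y w] [set w | e' z w] P.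
- by rewrite P3 ltnW // ltnS card_del_nbr.
- by rewrite P3 /e' del_C ltnW // ltnS card_del_nbr.
- by rewrite P3.
have yf : y \in f by rewrite fE !inE eqxx.
have zf : z \in f by rewrite fE !inE eqxx orbT.
(* By hypothesis these are the colours of [h] and [g] in their own copies. Both are prescribed in
   the common colouring, although each is precoloured in one copy only. *)
pose pc k := if k == h then c0 f else c1 f.
have fits x col : x \in f -> {in [set w | e' x w] &, injective col} ->
    {in [set w | e' x w], forall w, col w \in P} -> star_fits e' [set h; g] pc x col.
  move=> xf inj cP; split=> [u v exu exv|u v exu euv vx|u exu].
  - by apply: inj; rewrite inE.
  - have uP : col u \in P by rewrite cP // inE.
    move=> _; rewrite /pc; case: ifP => _.
      by apply: contraNneq P0 => <-.
    by apply: contraNneq P1 => <-.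
  rewrite in_set2 => /orP[] /eqP E.
    by have := nh _ xf; rewrite -E !inE eqxx.
  by have := ng _ xf; rewrite -E !inE eqxx.
have pp : preproper e' [set h; g] pc.
  move=> u v w _ _ vw; rewrite !in_set2 /pc => /orP[] /eqP E /orP[] /eqP E'.
  - by rewrite -E in E'; rewrite (set2_inj E') eqxx in vw.
  - by rewrite E E' eqxx [g == h]eq_sym (negPf hg).
  - by rewrite E E' eqxx [g == h]eq_sym (negPf hg) eq_sym.
  by rewrite -E in E'; rewrite (set2_inj E') eqxx in vw.
have [||phi [p hE h1 h2]] := @star2_greedy V e' e'3 [set h; g] pc y z _ _ pp yz
    (fits _ _ yf inj1 cP1) (fits _ _ zf inj2 cP2).
- by move=> w e1 e2; apply: c12; rewrite inE.
- by rewrite /e' del_edge eqxx andbF.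
have uP x l : x \in f -> l \in used e' phi x -> l \in P.
  rewrite fE => /set2P[] -> /usedP[w exw ->]; first by rewrite h1 // cP1 // inE.
  by rewrite h2 // cP2 // inE.
have goodk k F c : k \notin P -> (forall m, m \in F -> m = f /\ c m = k \/
      [/\ m \in [set h; g], m != f & pc m = c m]) ->
    good a F c e set0 (recol phi f k).
  move=> kP hm; split.
  - rewrite fE; apply: add_edge => //; first by apply: contraNN kP; apply: uP.
    by apply: contraNN kP; apply: uP.
  - by move=> u v _; rewrite inE.
  - move=> u v euv /hm[[-> ->]|[mF mf <-]]; first exact: recol_same.
    by rewrite recol_diff // hE // /e' del_edge euv -fE.
exists (recol phi f (c0 f)), (recol phi f (c1 f)); split.
- apply: goodk => // m /set2P[] ->; first by left.
  by right; rewrite set21 /pc eqxx; split=> //; rewrite fh.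
- apply: goodk => // m /set2P[] ->; first by left.
  by right; rewrite set22 /pc [g == h]eq_sym (negPf hg) fg; split.
move=> x _; have [xf|xf] := boolP (x \in f); last first.
  rewrite fE !used_recol_other ?(contraNneq (_ : _ -> x \in f) xf) //; try by move->.
  apply: spare; rewrite setUid; apply: leq_trans (card_used3 e3 _ _) _ => //.
(* An end of [f] has at most two other edges, so one of the three colours of [P] is missing there in
   both copies. *)
have [|b bP bu] := @avoid _ P (used e' phi x).
  rewrite P3 ltnS; apply: leq_trans (card_used _ _ _) _.
  rewrite -cardsE; move: xf; rewrite fE => /set2P[] ->; first exact: card_del_nbr.
  by rewrite /e' del_C card_del_nbr.
have key k : k \notin P -> b \notin used e (recol phi f k) x.
  move=> kP; apply: contraNN bu => bk.
  have : b \in k |: used e' phi x.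
    move: xf bk; rewrite fE => /set2P[] ->; first by apply/subsetP/used_recol_at.
    by rewrite setUC /e' del_C; apply/subsetP/used_recol_at.
  by rewrite in_setU1 => /orP[/eqP E|//]; rewrite -E bP in kP.
by exists b; split; apply: key.
Qed.

End Conflicts.

(** * Case analysis on the prescriptions of the two copies *)

Section Pairs.
Variables (V : finType) (e : rel V).
Hypothesis e3 : subcubic_rel e.
Implicit Types (F : {set {set V}}) (S : {set V}) (c phi : {set V} -> 'I_5) (a : V -> 'I_5).

(** Exchanging [c0 f] and [c1 f] works unless some vertex [x] prescribes one of them to be missing.
    Besides [f] and [x] there is then at most one more prescription. If there is none or its colour
    is [a x], only one copy of [f] deviates from [a x]; otherwise its kind selects the lemma. *)
Lemma pair_doubled a S F0 c0 f c1 : on_edges e F0 ->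
  compat a F0 c0 e S -> compat a [set f] c1 e S ->
  #|S| + #|F0| <= 3 -> f \in F0 -> solution e a S F0 c0 [set f] c1.
Proof.
move=> o0 k0 k1 le3 fF; have o1 : on_edges e [set f] by move=> g /set1P->; apply: o0.
have le4 : #|S| + #|F0| + #|[set f]| <= 4 by rewrite cards1 addn1 ltnS.
have vac x y z : e x y -> e x z -> y != z -> [set x; y] \in F0 -> [set x; z] \in [set f] ->
    [set x; z] \notin F0 -> False.
  by move=> _ _ _ _ /set1P ->; rewrite fF.
have [fc|fc] := eqVneq (c0 f) (c1 f).
  apply: (twist1 e3 k0 k1 le4); first by move=> g _ /set1P->.
  by move=> x y z h1 h2 h3 h4 h5 h6; case: (vac x y z).
have [/existsP[x /andP[xS ax]]|nx] :=
    boolP [exists x, (x \in S) && (a x \in [set c0 f; c1 f])]; last first.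
  apply: (@twist _ _ _ _ e3 _ _ _ _ (c0 f) (c1 f) k0 k1 le4).
  - move=> x xS; have : a x \notin [set c0 f; c1 f].
      by apply: contraNN nx => h; apply/existsP; exists x; rewrite xS.
    by rewrite in_set2 negb_or => /andP[? ?]; rewrite tpermD // eq_sym.
  - by move=> g _ /set1P->; rewrite tpermL.
  by move=> x y z h1 h2 h3 h4 h5 h6; case: (vac x y z).
have monox : (forall y, y \in S -> a y = a x) ->
    (forall g, g \in F0 -> g != f -> c0 g = a x) -> solution e a S F0 c0 [set f] c1.
  move=> hS hF; apply: (@near_monochromatic _ _ _ _ e3 (a x)) => //.
  have -> : [set y in S | a y != a x] = set0.
    by apply/setP=> y; rewrite !inE; apply/negP=> /andP[/hS->]; rewrite eqxx.
  rewrite cards0 add0n; case/set2P: ax => ax.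
    have -> : [set g in F0 | c0 g != a x] = set0.
      apply/setP=> g; rewrite !inE; apply/negP=> /andP[gF].
      by have [->|n] := eqVneq g f; [rewrite ax eqxx | rewrite hF // eqxx].
    rewrite cards0 add0n; apply: leq_trans (eq_leq (cards1 f)); apply: subset_leq_card.
    by apply/subsetP=> g; rewrite inE => /andP[].
  have -> : [set g in [set f] | c1 g != a x] = set0.
    by apply/setP=> g; rewrite !inE; apply/negP=> /andP[/eqP->]; rewrite ax eqxx.
  rewrite cards0 addn0; apply: leq_trans (eq_leq (cards1 f)); apply: subset_leq_card.
  apply/subsetP=> g; rewrite !inE => /andP[gF].
  by apply: contraNT => n; rewrite hF // eqxx.
have S1 := cardsD1 x S; have F1 := cardsD1 f F0; rewrite xS in S1; rewrite fF in F1.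
have rest : #|S :\ x| + #|F0 :\ f| <= 1 by lia.
have [Sx|[x2]] := set_0Vmem (S :\ x); last first.
  rewrite !inE => /andP[x2x x2S].
  have SE : S = [set x; x2].
    apply/eqP; rewrite eq_sym eqEcard subUset !sub1set xS x2S cards2 eq_sym x2x /=.
    by lia.
  have FE : F0 = [set f].
    apply/eqP; rewrite eq_sym eqEcard sub1set fF cards1.
    have : 0 < #|S :\ x| by apply/card_gt0P; exists x2; rewrite !inE x2x.
    by lia.
  have [E|n] := eqVneq (a x2) (a x).
    apply: monox; last by move=> g; rewrite FE inE => ->.
    by rewrite SE => y /set2P[] ->.
  rewrite SE FE in k0 k1 *.
  have [a2|a2] := boolP (a x2 \in [set c0 f; c1 f]).
    by apply: doubled_edge_two_inside; rewrite // eq_sym.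
  by apply: doubled_edge_one_inside; rewrite // eq_sym.
have SE : S = [set x].
  apply/setP=> y; rewrite inE; have [->//|n] := eqVneq y x.
  by apply/negP=> yS; have : y \in S :\ x; [rewrite !inE n | rewrite Sx inE].
have [Ff|[h]] := set_0Vmem (F0 :\ f).
  apply: monox; first by rewrite SE => y /set1P->.
  by move=> g gF gf; have : g \in F0 :\ f; [rewrite !inE gf | rewrite Ff inE].
rewrite !inE => /andP[hf hF].
have FE : F0 = [set f; h].
  apply/eqP; rewrite eq_sym eqEcard subUset !sub1set fF hF cards2 eq_sym hf /=.
  by rewrite F1 add1n ltnS (leq_trans _ rest) ?leq_addl.
have [E|n] := eqVneq (c0 h) (a x).
  apply: monox; first by rewrite SE => y /set1P->.
  by rewrite FE => g /set2P[] -> //; rewrite eqxx.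
rewrite SE FE in o0 k0 k1 *.
have [/andP[xh hc]|nh] := boolP ((x \in h) && (c0 h \in [set c0 f; c1 f])).
  exact: doubled_edge_at_vertex.
by apply: doubled_edge_one_vertex => // xh; apply: contraNN nh => ->; rewrite xh.
Qed.

(** A clash needs an edge [g] of colour [c1 f] meeting [f]. Exchanging [c1 f] with a colour [m]
    outside the at most three other prescriptions removes it, unless [c1 f] must be missing at some
    [x]; then [f], [g] and [x] share a colour and at most one prescription deviates from it. *)
Lemma pair_single a S F0 c0 f c1 : on_edges e F0 -> on_edges e [set f] ->
  compat a F0 c0 e S -> compat a [set f] c1 e S ->
  #|S| + #|F0| <= 3 -> f \notin F0 -> solution e a S F0 c0 [set f] c1.
Proof.
move=> o0 o1 k0 k1 le3 fF.
have le4 : #|S| + #|F0| + #|[set f]| <= 4 by rewrite cards1 addn1 ltnS.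
have dbl g : g \in F0 -> g \in [set f] -> False by move=> gF /set1P E; rewrite -E gF in fF.
have [/existsP[g /and3P[gF _ /eqP gc]]|ng] :=
    boolP [exists g : {set V}, [&& g \in F0, g :&: f != set0 & c0 g == c1 f]]; last first.
  apply: (twist1 e3 k0 k1 le4); first by move=> g h1 h2; case: (dbl g).
  move=> x y z exy exz yz yF /set1P zE _; apply: contraNneq ng => E.
  apply/existsP; exists [set x; y]; rewrite yF E zE eqxx andbT /=.
  by apply/set0Pn; exists x; rewrite -zE !inE !eqxx.
have [/existsP[x /andP[xS /eqP ax]]|nx] := boolP [exists x, (x \in S) && (a x == c1 f)].
  apply: (@near_monochromatic _ _ _ _ e3 (c1 f)) => //.
  have -> : [set h in [set f] | c1 h != c1 f] = set0.
    by apply/setP=> h; rewrite !inE; apply/negP=> /andP[/eqP->]; rewrite eqxx.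
  rewrite cards0 addn0.
  have h1 : #|[set y in S | a y != c1 f]| <= #|S :\ x|.
    apply: subset_leq_card; apply/subsetP=> y; rewrite !inE => /andP[-> n].
    by rewrite andbT; apply: contraNneq n => ->; rewrite ax.
  have h2 : #|[set h in F0 | c0 h != c1 f]| <= #|F0 :\ g|.
    apply: subset_leq_card; apply/subsetP=> y; rewrite !inE => /andP[-> n].
    by rewrite andbT; apply: contraNneq n => ->; rewrite gc.
  apply: leq_trans (leq_add h1 h2) _.
  by move: le3; rewrite (cardsD1 x S) (cardsD1 g F0) xS gF !add1n addSn addnS !ltnS.
have [|m _] := @avoid _ [set: 'I_5] (a @: S :|: c0 @: F0).
  rewrite cardsT card_ord; apply: leq_ltn_trans (leq_of_leqif (leq_card_setU _ _)) _.
  apply: leq_ltn_trans (leq_add (leq_imset_card _ _) (leq_imset_card _ _)) _.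
  exact: leq_ltn_trans le3 _.
rewrite inE negb_or => /andP[mS mF].
apply: (@twist _ _ _ _ e3 _ _ _ _ (c1 f) m k0 k1 le4).
- move=> x xS; rewrite tpermD //.
    by apply: contraNneq nx => E; apply/existsP; exists x; rewrite xS E eqxx.
  by apply: contraNneq mS => ->; apply: imset_f.
- by move=> h h1 h2; case: (dbl h).
move=> x y z _ _ _ yF /set1P-> _; rewrite tpermL.
by apply: contraNneq mF => <-; apply: imset_f.
Qed.

Lemma good_set0 a F c phi : proper_col e phi ->
  (forall f, f \in F -> phi f = c f) -> good a F c e set0 phi.
Proof. by move=> p h; split=> // x y _; [rewrite inE | apply: h]. Qed.

(** The four prescribed colours leave a fifth, [m]. The copies are coloured independently without
    [m], which then serves every rung. *)
Lemma pair_diff_diff a f0 g0 c0 f1 g1 c1 : on_edges e [set f0; g0] -> on_edges e [set f1; g1] ->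
  f0 != g0 -> f1 != g1 -> c0 f0 != c0 g0 -> c1 f1 != c1 g1 ->
  solution e a set0 [set f0; g0] c0 [set f1; g1] c1.
Proof.
move=> o0 o1 n0 n1 d0 d1.
have [|m _] := @avoid _ [set: 'I_5] ([set c0 f0; c0 g0] :|: [set c1 f1; c1 g1]).
  rewrite cardsT card_ord; apply: leq_ltn_trans (leq_of_leqif (leq_card_setU _ _)) _.
  by rewrite !cards2; do 2 case: (_ != _).
rewrite in_setU !in_set2 !negb_or ![m == _]eq_sym => /andP[/andP[h1 h2] /andP[h3 h4]].
have [phi0 [p0 r0 E1 E2]] := two_named e3 o0 n0 h1 h2 d0.
have [phi1 [p1 r1 E3 E4]] := two_named e3 o1 n1 h3 h4 d1.
exists phi0, phi1; split.
- by apply: good_set0 => // f /set2P[] ->.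
- by apply: good_set0 => // f /set2P[] ->.
move=> x _; exists m; split; apply/negP=> /usedP[y exy E].
  by have := r0 _ _ exy; rewrite -E !inE eqxx.
by have := r1 _ _ exy; rewrite -E !inE eqxx.
Qed.

(** If the colour of the first pair recurs in the second, one prescription deviates from it. If not,
    a colouring without it meets the second pair, and it is painted on the first. *)
Lemma pair_same_diff a f0 g0 c0 f1 g1 c1 : on_edges e [set f0; g0] -> on_edges e [set f1; g1] ->
  compat a [set f0; g0] c0 e set0 -> compat a [set f1; g1] c1 e set0 ->
  f1 != g1 -> c0 f0 = c0 g0 -> c1 f1 != c1 g1 ->
  solution e a set0 [set f0; g0] c0 [set f1; g1] c1.
Proof.
move=> o0 o1 k0 k1 n1 s0 d1.
have no0 g : g \in [set f0; g0] -> c0 g = c0 f0 by case/set2P=> ->.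
have mono0 h : h \in [set f1; g1] -> c1 h = c0 f0 ->
    solution e a set0 [set f0; g0] c0 [set f1; g1] c1.
  move=> hF hc; apply: (@near_monochromatic _ _ _ _ e3 (c0 f0)) => //.
  have -> : [set x in set0 | a x != c0 f0] = set0 by apply/setP=> x; rewrite !inE.
  have -> : [set g in [set f0; g0] | c0 g != c0 f0] = set0.
    by apply/setP=> g; rewrite [RHS]inE inE; apply/negP=> /andP[/no0->]; rewrite eqxx.
  rewrite !cards0 !add0n; apply: leq_trans (_ : #|[set f1; g1] :\ h| <= 1).
    apply: subset_leq_card; apply/subsetP=> g; rewrite inE in_setD1 => /andP[-> n].
    by rewrite andbT; apply: contraNneq n => ->; rewrite hc.
  by have := cardsD1 h [set f1; g1]; rewrite hF cards2 n1 add1n => -[<-].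
have [E|h1] := eqVneq (c1 f1) (c0 f0); first exact: (mono0 f1 (set21 _ _)).
have [E|h2] := eqVneq (c1 g1) (c0 f0); first exact: (mono0 g1 (set22 _ _)).
have [phi [p r E1 E2]] := two_named e3 o1 n1 h1 h2 d1.
apply: (paint_solution e3 k0 k1 p r).
- by move=> x y _ /no0->; rewrite eqxx.
- by move=> x y _ /set2P[] ->.
by move=> x; rewrite inE.
Qed.

(** When the two colours differ, the number of shared edges decides. If both are shared, the colours
    are exchanged; if one is, [doubled_edge_two_single] applies; if none is, a single colouring
    serves both copies. *)
Lemma pair_same_same a f0 g0 c0 f1 g1 c1 : on_edges e [set f0; g0] -> on_edges e [set f1; g1] ->
  compat a [set f0; g0] c0 e set0 -> compat a [set f1; g1] c1 e set0 ->
  f0 != g0 -> f1 != g1 -> c0 f0 = c0 g0 -> c1 f1 = c1 g1 ->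
  solution e a set0 [set f0; g0] c0 [set f1; g1] c1.
Proof.
move=> o0 o1 k0 k1 n0 n1 s0 s1.
have no0 g : g \in [set f0; g0] -> c0 g = c0 f0 by case/set2P=> ->.
have no1 g : g \in [set f1; g1] -> c1 g = c1 f1 by case/set2P=> ->.
have le4 : #|(set0 : {set V})| + #|[set f0; g0]| + #|[set f1; g1]| <= 4.
  by rewrite cards0 !cards2 n0 n1.
have [E|n] := eqVneq (c0 f0) (c1 f1).
  apply: (@near_monochromatic _ _ _ _ e3 (c0 f0)) => //.
  have -> : [set x in set0 | a x != c0 f0] = set0 by apply/setP=> x; rewrite !inE.
  have -> : [set g in [set f0; g0] | c0 g != c0 f0] = set0.
    by apply/setP=> g; rewrite [RHS]inE inE; apply/negP=> /andP[/no0->]; rewrite eqxx.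
  have -> : [set g in [set f1; g1] | c1 g != c0 f0] = set0.
    by apply/setP=> g; rewrite [RHS]inE inE E; apply/negP=> /andP[/no1->]; rewrite eqxx.
  by rewrite !cards0.
have caseB f h : [set f0; g0] = [set f; h] -> h != f -> f \in [set f1; g1] ->
    h \notin [set f1; g1] -> solution e a set0 [set f0; g0] c0 [set f1; g1] c1.
  move=> F0E hf fF hF; have [g gf F1E] : exists2 g, g != f & [set f1; g1] = [set f; g].
    case/set2P: fF => ->; first by exists g1; rewrite // eq_sym.
    by exists f1; rewrite // setUC.
  have fh : c0 f = c0 h by rewrite !no0 ?F0E ?set21 ?set22.
  have fg : c1 f = c1 g by rewrite !no1 ?F1E ?set21 ?set22.
  have fc : c0 f != c1 f by rewrite no0 ?no1 // F0E set21.
  have hg : h != g by apply: contraNneq hF => ->; rewrite F1E set22.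
  by rewrite F0E F1E in o0 o1 k0 k1 *; apply: doubled_edge_two_single.
have [f0F|f0F] := boolP (f0 \in [set f1; g1]); have [g0F|g0F] := boolP (g0 \in [set f1; g1]).
- have FE : [set f0; g0] = [set f1; g1].
    by apply/eqP; rewrite eqEcard !cards2 n0 n1 subUset !sub1set f0F g0F.
  apply: (@twist _ _ _ _ e3 _ _ _ _ (c0 f0) (c1 f1) k0 k1 le4).
  + by move=> x; rewrite inE.
  + by move=> f /no0-> /no1->; rewrite tpermL.
  by move=> x y z _ _ _ _ zF; rewrite FE zF.
- by apply: (caseB f0 g0); rewrite // eq_sym.
- by apply: (caseB g0 f0); rewrite // setUC.
apply: (twist1 e3 k0 k1 le4).
  by move=> f /set2P[] ->; rewrite ?(negPf f0F) ?(negPf g0F).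
by move=> x y z _ _ _ /no0-> /no1->.
Qed.

Lemma pair_solution a S F0 c0 F1 c1 : on_edges e F0 -> on_edges e F1 ->
  compat a F0 c0 e S -> compat a F1 c1 e S -> #|S| + #|F0| + #|F1| <= 4 ->
  solution e a S F0 c0 F1 c1.
Proof.
wlog le10 : F0 c0 F1 c1 / #|F1| <= #|F0|.
  move=> W; case: (leqP #|F1| #|F0|) => [|/ltnW] le o0 o1 k0 k1 le4; first exact: W.
  by apply: solution_sym; apply: W => //; rewrite addnAC.
move=> o0 o1 k0 k1 le4.
have [/cards0_eq F1E|] := posnP #|F1|.
  by apply: twist1 => // [f _|x y z _ _ _ _]; rewrite F1E inE.
rewrite leq_eqVlt => /orP[|gt1].
  rewrite eq_sym => /cards1P[f F1E]; rewrite F1E in o1 k1 le4 *.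
  rewrite cards1 addn1 ltnS in le4.
  have [fF|fF] := boolP (f \in F0); first exact: pair_doubled.
  exact: pair_single.
(* Two precoloured edges in each copy exhaust the bound, so no rung is precoloured. *)
have [S0 [F02 F12]] : #|S| = 0 /\ #|F0| = 2 /\ #|F1| = 2 by lia.
have SE := cards0_eq S0; rewrite SE in k0 k1 *.
move/eqP/cards2P: F02 => [f0 [g0 [n0 F0E]]]; move/eqP/cards2P: F12 => [f1 [g1 [n1 F1E]]].
rewrite F0E F1E in o0 o1 k0 k1 *.
have [s0|d0] := eqVneq (c0 f0) (c0 g0); have [s1|d1] := eqVneq (c1 f1) (c1 g1).
- exact: pair_same_same.
- exact: pair_same_diff.
- by apply: solution_sym; apply: pair_same_diff.
exact: pair_diff_diff.
Qed.

End Pairs.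

(** * The prism over a graph *)

Section Prism.
Variable G : sgraph.
Hypothesis G3 : subcubic G.
Let H := cart G (complete 2).
Implicit Types (f g : {set G}) (x y z : G) (i j : 'I_2) (m : {set H}).

Lemma subcubic_adj : subcubic_rel (@adj G).
Proof.
split=> [||x]; [exact: adj_sym | exact: adj_irrefl |].
by apply: leq_trans G3; rewrite -cardsE; apply: (@leq_bigmax _ (@degree G)).
Qed.

Definition copy i f : {set H} := [set (x, i) | x in f].
Definition rung x : {set H} := [set (x, ord0); (x, ord_max)].

Lemma mem_copy i f (u : H) : (u \in copy i f) = (u.2 == i) && (u.1 \in f).
Proof.
case: u => x j; apply/imsetP/andP=> [[y yf [-> ->]]|[/eqP /= -> xf]]; first by rewrite eqxx.
by exists x.
Qed.

Lemma mem_rung x (u : H) : (u \in rung x) = (u.1 == x).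
Proof.
case: u => y j; rewrite !inE !xpair_eqE -andb_orr.
by case: j => [[|[|//]]] j2; rewrite ?andbT // orbT andbT.
Qed.

Lemma copy_inj i : injective (copy i).
Proof.
by move=> f g E; apply/setP=> x; have := mem_copy i f (x, i); rewrite E mem_copy /= eqxx.
Qed.

Lemma rung_inj : injective rung.
Proof.
move=> x y E; have : (x, ord0) \in rung y by rewrite -E mem_rung.
by rewrite mem_rung => /eqP.
Qed.

Lemma copy2 i x y : copy i [set x; y] = [set (x, i); (y, i)].
Proof. by rewrite /copy imsetU1 imset_set1. Qed.

Lemma edges_prism m : m \in edges H ->
  (exists x, m = rung x) \/ exists i x y, adj x y /\ m = copy i [set x; y].
Proof.
rewrite inE => /existsP[[x i] /existsP[[y j] /andP[]]].
rewrite /= /cart_adj /= => /orP[/andP[/eqP <- ij] /eqP ->|/andP[/eqP <- xy] /eqP ->].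
  left; exists x; apply/setP=> -[z k]; rewrite mem_rung !inE !xpair_eqE -andb_orr /=.
  rewrite andb_idr // => _; move: ij; rewrite /complete_adj.
  by case: i => [[|[|//]]] ?; case: j => [[|[|//]]] ?; case: k => [[|[|//]]] ?.
by right; exists i, x, y; rewrite copy2.
Qed.

Lemma copy_edge i f : copy i f \in edges H -> exists x y, adj x y /\ f = [set x; y].
Proof.
(* An empty set has the same copy for both indices, hence the separate case. *)
have sub j g : copy i f = copy j g -> f = g.
  move=> E; have [f0|[x xf]] := set_0Vmem f.
    have [->//|[y yg]] := set_0Vmem g.
    by have : (y, j) \in copy i f; [rewrite E mem_copy eqxx | rewrite f0 mem_copy inE andbF].
  have : (x, i) \in copy j g by rewrite -E mem_copy eqxx.
  by rewrite mem_copy => /andP[/eqP /= ij _]; rewrite -ij in E; apply: copy_inj E.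
case/edges_prism=> [[x E]|[j [x [y [xy /sub->]]]]]; last by exists x, y.
have h j : (x, j) \in copy i f by rewrite E mem_rung.
have := h ord0; have := h ord_max; rewrite !mem_copy /= => /andP[/eqP <- _].
by rewrite -val_eqE.
Qed.

Section Precoloring.
Variables (F : {set {set H}}) (c : {set H} -> 'I_5).
Hypotheses (F4 : #|F| <= 4) (Fc : is_precoloring F c).

Let S := [set x | rung x \in F].
Let a x := c (rung x).
Let Fi i := [set f | copy i f \in F].
Let ci i f := c (copy i f).

Lemma on_edges_copy i : on_edges (@adj G) (Fi i).
Proof.
move=> f; rewrite inE => fF; apply: (@copy_edge i); apply: subsetP fF.
by case: Fc.
Qed.

Lemma compat_copy i : compat a (Fi i) (ci i) (@adj G) S.
Proof.
have [_ p] := Fc; split=> [x y z _ _ yz|x y _]; rewrite !inE => h1 h2; apply: p => //;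
  apply/andP; split.
- by apply: contraNneq yz => /copy_inj/set2_inj ->.
- by apply/set0Pn; exists (x, i); rewrite inE !mem_copy !inE !eqxx.
- apply/negP=> /eqP E; have : forall j, (x, j) \in copy i [set x; y] by move=> j; rewrite E mem_rung.
  move=> h; have := h ord0; have := h ord_max; rewrite !mem_copy => /andP[/eqP <- _].
  by rewrite -val_eqE.
by apply/set0Pn; exists (x, i); rewrite inE mem_copy mem_rung !inE !eqxx.
Qed.

Lemma card_parts : #|S| + #|Fi ord0| + #|Fi ord_max| <= 4.
Proof.
apply: leq_trans F4.
rewrite -(card_imset S rung_inj) -(card_imset _ (@copy_inj ord0)) -(card_imset _ (@copy_inj ord_max)).
have nonempty i f : f \in Fi i -> exists x, x \in f.
  by move/on_edges_copy=> [x [y [_ ->]]]; exists x; rewrite !inE eqxx.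
have d1 : [disjoint rung @: S & copy ord0 @: Fi ord0].
  rewrite disjoints_subset; apply/subsetP=> m /imsetP[x _ ->]; rewrite inE.
  apply/imsetP=> -[f _ E]; have : (x, ord_max) \in copy ord0 f by rewrite -E mem_rung.
  by rewrite mem_copy => /andP[].
have d2 : [disjoint rung @: S :|: copy ord0 @: Fi ord0 & copy ord_max @: Fi ord_max].
  rewrite disjoints_subset; apply/subsetP=> m /setUP[] /imsetP[x xF ->]; rewrite inE;
    apply/imsetP=> -[f _ E].
    have : (x, ord0) \in copy ord_max f by rewrite -E mem_rung.
    by rewrite mem_copy => /andP[].
  have [y yx] := nonempty _ _ xF.
  have : (y, ord0) \in copy ord_max f by rewrite -E mem_copy yx.
  by rewrite mem_copy => /andP[].
rewrite -(eqTleqif (leq_card_setU _ _) d1) -(eqTleqif (leq_card_setU _ _) d2).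
apply: subset_leq_card; rewrite !subUset -andbA; apply/and3P.
by split; apply/subsetP=> m /imsetP[x]; rewrite inE => xF ->.
Qed.

Lemma prism_extendable : extendable F c.
Proof.
have [phi0 [phi1 [g0 g1 free]]] := pair_solution subcubic_adj (on_edges_copy (i := ord0))
  (on_edges_copy (i := ord_max)) (compat_copy ord0) (compat_copy ord_max) card_parts.
pose phi i := if i == ord0 then phi0 else phi1.
have gphi i : good a (Fi i) (ci i) (@adj G) S (phi i).
  have [->//|] := eqVneq i ord0; rewrite /phi => n.
  have -> : i = ord_max by apply/val_inj; case: i n => [[|[|//]]].
  by [].
(* Outside [S] the [pick] succeeds by [free], so the default is never taken. *)
pose b x := if x \in S then a x else odflt ord0
  [pick k | (k \notin used (@adj G) phi0 x) && (k \notin used (@adj G) phi1 x)].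
have bP i x y : adj x y -> b x != phi i [set x; y].
  move=> xy; rewrite /b; case: ifP => [xS|/negbT /free[k [k0 k1]]].
    by have [_ h _] := gphi i; rewrite eq_sym h.
  case: pickP => [l /andP[l0 l1]|/(_ k)]; last by rewrite k0 k1.
  rewrite /phi; case: ifP => _ /=.
    by apply: contraNneq l0 => ->; apply: mem_used.
  by apply: contraNneq l1 => ->; apply: mem_used.
pose c' m := if [pick x | m == rung x] is Some x then b x else
  if [pick q : 'I_2 * {set G} | m == copy q.1 q.2] is Some q then phi q.1 q.2 else ord0.
have c'_rung x : c' (rung x) = b x.
  rewrite /c'; case: pickP => [y /eqP/rung_inj->//|/(_ x)]; by rewrite eqxx.
have copy_rung i x y z : copy i [set x; y] = rung z -> False.
  move=> E; have h j : (z, j) \in copy i [set x; y] by rewrite E mem_rung.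
  have := h ord0; have := h ord_max; rewrite !mem_copy => /andP[/eqP <- _].
  by rewrite -val_eqE.
have c'_copy i x y : c' (copy i [set x; y]) = phi i [set x; y].
  rewrite /c'; case: pickP => [z /eqP/copy_rung//|_].
  case: pickP => [[j f] /= /eqP E|/(_ (i, [set x; y]))]; last by rewrite eqxx.
  have : (x, i) \in copy j f by rewrite -E mem_copy !inE !eqxx.
  rewrite mem_copy => /andP[/eqP /= ij _]; rewrite -ij in E *.
  by rewrite (copy_inj E).
exists c'; split.
- have one i x y z : adj x y -> copy i [set x; y] :&: rung z != set0 ->
      c' (copy i [set x; y]) != c' (rung z).
    move=> xy /set0Pn[u]; rewrite inE mem_copy mem_rung => /andP[/andP[_ h] /eqP uz].
    rewrite c'_copy c'_rung eq_sym; move: h; rewrite uz => /set2P[] ->; first exact: bP.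
    by rewrite setUC; apply: bP; rewrite adj_sym.
  move=> m m' /edges_prism[[x ->]|[i [x [y [xy ->]]]]] /edges_prism[[x' ->]|[j [x' [y' [xy' ->]]]]] /andP[n I].
  + case/set0Pn: I => u; rewrite inE !mem_rung => /andP[/eqP E1 /eqP E2].
    by rewrite -E1 -E2 eqxx in n.
  + by rewrite eq_sym; apply: one; rewrite // setIC.
  + exact: one.
  case/set0Pn: I => u; rewrite inE !mem_copy => /andP[/andP[/eqP ui uf] /andP[/eqP uj ug]].
  rewrite -ui -uj in n *; rewrite !c'_copy.
  have at_u v w : adj v w -> u.1 \in [set v; w] -> exists2 t, adj u.1 t & [set v; w] = [set u.1; t].
    move=> vw /set2P[] ->; first by exists w.
    by exists v; rewrite 1?adj_sym // setUC.
  have [t ut E1] := at_u _ _ xy uf; have [t' ut' E2] := at_u _ _ xy' ug.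
  have [p _ _] := gphi u.2; rewrite E1 E2 in n *; apply: p => //.
  by apply: contraNneq n => ->.
move=> m mF; have [sub _] := Fc; have := subsetP sub _ mF.
case/edges_prism=> [[x E]|[i [x [y [xy E]]]]]; rewrite E in mF *.
  by have xS : x \in S; [rewrite inE | rewrite c'_rung /b xS].
rewrite c'_copy; have [_ _ h] := gphi i.
by rewrite h // inE.
Qed.

End Precoloring.
End Prism.

Theorem theorem5 (G : sgraph) (hG : subcubic G)
    (F : {set {set cart G (complete 2)}})
    (c : {set cart G (complete 2)} -> 'I_5)
    (hF : #|F| <= 4) (hc : is_precoloring F c) :
  extendable F c.
Proof. exact: prism_extendable. Qed.
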